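(* Let $\delta\in(0,n]$ and $p\in[1,\infty)$. Then $w\in\mathcal A_{p,\delta}$ if and only if there exist two weights $w_0,w_1\in\mathcal A_{1,\delta}$ such that $w=w_0w_1^{1-p}$.
   Context: A cube $Q\subset\mathbb R^n$ is a left-open right-closed cube with sides parallel to the axes; $l(Q)$ is its edge length. For $\delta\in(0,n]$ and $E\subset\mathbb R^n$, the Hausdorff content is $\mathcal H^\delta_\infty(E):=\inf\{\sum_i l(Q_i)^\delta:\ E\subset\bigcup_i Q_i\}$, the infimum over all finite or countable coverings of $E$ by cubes. For $E\subset\mathbb R^n$ and a non-negative function $g$ (no measurability required) the Choquet integral is $\int_E g\,d\mathcal H^\delta_\infty:=\int_0^\infty \mathcal H^\delta_\infty(\{x\in E: g(x)>t\})\,dt$. ''Almost everywhere'' with respect to $\mathcal H^\delta_\infty$ means outside a set of zero $\mathcal H^\delta_\infty$-content. A (capacitary) weight is a non-negative function $w$ on $\mathbb R^n$ with $\int_E w\,d\mathcal H^\delta_\infty<\infty$ for all compact $E$ and $w\in(0,\infty)$ $\mathcal H^\delta_\infty$-almost everywhere. For $p\in(1,\infty)$, $w\in\mathcal A_{p,\delta}$ means $w$ is a capacitary weight with $[w]_{\mathcal A_{p,\delta}}:=\sup_Q\{\frac1{\mathcal H^\delta_\infty(Q)}\int_Qw\,d\mathcal H^\delta_\infty\}\{\frac1{\mathcal H^\delta_\infty(Q)}\int_Qw^{-\frac1{p-1}}d\mathcal H^\delta_\infty\}^{p-1}<\infty$ (supremum over all cubes). $w\in\mathcal A_{1,\delta}$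 means $w$ is a capacitary weight with $[w]_{\mathcal A_{1,\delta}}:=\inf\{K\in(0,\infty):\ \mathcal M_{\mathcal H^\delta_\infty}w\le Kw\ \ \mathcal H^\delta_\infty\text{-a.e.}\}<\infty$, where $\mathcal M_{\mathcal H^\delta_\infty}f(x):=\sup_{Q\ni x}\frac1{\mathcal H^\delta_\infty(Q)}\int_Q|f|\,d\mathcal H^\delta_\infty$, the supremum over all cubes containing $x$. *)

(* Defs.v *)
From HB Require Import structures.
From mathcomp Require Import all_boot all_order all_algebra.
From mathcomp Require Import all_classical all_reals all_analysis.

Set Implicit Arguments.
Unset Strict Implicit.
Unset Printing Implicit Defensive.

Import Order.TTheory GRing.Theory Num.Theory.
Import numFieldNormedType.Exports.

Local Open Scope classical_set_scope.
Local Open Scope ring_scope.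
Local Open Scope ereal_scope.

Record cube (R : realType) (n : nat) := Cube {
  corner : 'rV[R]_n;
  edge : R;
  edge_gt0 : (0 < edge)%R }.

Definition cube_set (R : realType) (n : nat) (Q : cube R n) : set 'rV[R]_n :=
  [set x | forall i : 'I_n,
     (corner Q ord0 i < x ord0 i)%R /\
     (x ord0 i <= corner Q ord0 i + edge Q)%R].

Coercion cube_set : cube >-> set.

(* The index set D ranges over all sets of naturals, so that both finite and
   countably infinite coverings are allowed. *)
Definition hcontent (R : realType) (n : nat) (delta : R)
    (E : set 'rV[R]_n) : \bar R :=
  ereal_inf [set s | exists (D : set nat) (Q : nat -> cube R n),
    E `<=` \bigcup_(i in D) cube_set (Q i) /\
    s = \esum_(i in D) (edge (Q i) `^ delta)%:E].

Definition hcontent_ae (R : realType) (n : nat) (delta : R)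
    (P : 'rV[R]_n -> Prop) : Prop :=
  hcontent delta [set x | ~ P x] = 0.

(* The integrand is nonincreasing in t, hence measurable whatever g is. *)
Definition choquet (R : realType) (n : nat) (delta : R)
    (E : set 'rV[R]_n) (g : 'rV[R]_n -> \bar R) : \bar R :=
  \int[@lebesgue_measure R]_(t in `[0%R, +oo[)
    hcontent delta [set x | E x /\ t%:E < g x].

Definition average (R : realType) (n : nat) (delta : R)
    (Q : cube R n) (g : 'rV[R]_n -> \bar R) : \bar R :=
  (hcontent delta Q)^-1 * choquet delta Q g.

(* Powers on [0, +oo] with 0 ^ r = +oo and +oo ^ r = 0 for r < 0, and
   x ^ 0 = 1. The library's poweR has 0 `^ r = 0 and +oo `^ r = +oo for
   r < 0. *)
Definition epow (R : realType) (x : \bar R) (r : R) : \bar R :=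
  if (0 <= r)%R then x `^ r else (x `^ (- r)%R)^-1.

Definition cap_weight (R : realType) (n : nat) (delta : R)
    (w : 'rV[R]_n -> \bar R) : Prop :=
  [/\ forall x, 0 <= w x,
      forall E : set 'rV[R]_n, compact E -> choquet delta E w < +oo
    & hcontent_ae delta (fun x => 0 < w x /\ w x < +oo)].

Definition cap_maximal (R : realType) (n : nat) (delta : R)
    (f : 'rV[R]_n -> \bar R) (x : 'rV[R]_n) : \bar R :=
  ereal_sup [set average delta Q (fun y => `|f y|) |
             Q in [set Q : cube R n | cube_set Q x]].

Definition A1_const (R : realType) (n : nat) (delta : R)
    (w : 'rV[R]_n -> \bar R) : \bar R :=
  ereal_inf [set K%:E | K in [set K : R | (0 < K)%R /\
    hcontent_ae delta (fun x => cap_maximal delta w x <= K%:E * w x)]].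

Definition Ap_const (R : realType) (n : nat) (p delta : R)
    (w : 'rV[R]_n -> \bar R) : \bar R :=
  ereal_sup (range (fun Q : cube R n =>
    average delta Q w *
    epow (average delta Q (fun x => epow (w x) (- (p - 1)^-1)%R)) (p - 1)%R)).

Definition A_class (R : realType) (n : nat) (p delta : R)
    (w : 'rV[R]_n -> \bar R) : Prop :=
  cap_weight delta w /\
  (if p == 1%R then A1_const delta w else Ap_const p delta w) < +oo.

(* Main.v *)
Require Import Defs.
From mathcomp Require Import all_boot all_order all_algebra.
From mathcomp Require Import all_classical all_reals all_analysis.
From mathcomp Require Import measurable_realfun ring lra zify.

Set Implicit Arguments.
Unset Strict Implicit.
Unset Printing Implicit Defensive.

Import Order.TTheory GRing.Theory Num.Theory.
Import numFieldNormedType.Exports.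

Local Open Scope classical_set_scope.
Local Open Scope ring_scope.
Local Open Scope ereal_scope.

(** Everything is transferred from the Choquet integral to the functional
    [dnorm A f], the least total mass [sum_Q lam_Q l(Q)^delta] of a weighted
    family of dyadic cubes whose stack dominates [f] almost everywhere on [A].
    It is equivalent to the Choquet integral but countably subadditive and
    homogeneous, so that a.e. statements and series can be handled without any
    measurability.

    Two facts about the dyadic content replace measure theory: the content of a
    cube is comparable to [l(Q)^delta], and any set has a packing of cubes in
    which it has content at least half of that of the cube.  With these, an
    [A_p] pair gives a strong-type bound for the maximal function relative to
    the weight, and Lerner's pointwise estimate by two weighted maximal
    functions gives the [L^p(w)] bound of the maximal function itself, for [w]
    and for the dual weight [w^(-1/(p-1))].

    The factorization is then the Rubio de Francia iteration: with
    [s = min(1, p-1)] the sum [eta] of the rescaled iterates of the two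
    sublinear operators attached to [w] and its dual satisfies
    [eta < +oo] a.e., and [eta^(1/s) w^(-1/p)] and [eta^((p-1)/s) w^(1/p)] are
    the two [A_1] weights.  Conversely an [A_1] weight is bounded below on a cube
    by its average there, which gives the [A_p] condition for
    [w_0 w_1^(1-p)] directly. *)

(** The obstacle is that a content does not add up over disjoint sets, so sums over pieces need a
    separate reason each time. Over the bands [{v ~ 2^j}] of a cube the reason is geometric decay
    away from the average of [v], which uses both halves of the [A_p] condition. Over disjoint cubes
    it is a count of how often each cube of one near-optimal stack is charged. Over maximal cubes it
    is that each covering cube lies in at most one of them.

    Lerner's estimate needs only maximal functions relative to a weight, hence neither a reverse
    Holder inequality nor the openness of [A_p].

    The maximal operator is bounded on [L^p(w)] and on [L^p'] of the dual weight. Inserting the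
    powers [1/s] and [(p-1)/s] moves both bounds to one exponent [q = p/s], so that a single [eta]
    serves both. With [s = min(1, p-1)] both powers are at least [1], and Minkowski's inequality for
    series, with constant one, makes both operators countably sublinear. *)

(** * Sums of nonnegative families over arbitrary index sets *)

Section esum_complements.
Context {R : realType}.

Lemma le_esum_subset (I : choiceType) (A B : set I) (a : I -> \bar R) :
  A `<=` B -> (forall i, B i -> 0 <= a i) ->
  \esum_(i in A) a i <= \esum_(i in B) a i.
Proof.
move=> AB _; apply: ge_ereal_sup => /= _ [X [finX XA] <-].
by apply: ereal_sup_ubound; exists X => //; split=> //; apply: subset_trans AB.
Qed.

Lemma esum_lb (I : choiceType) (A : set I) (a : I -> \bar R) i :
  A i -> (forall i, A i -> 0 <= a i) -> a i <= \esum_(i in A) a i.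
Proof.
move=> Ai a0; rewrite -(esum_set1 (a0 _ Ai)); apply: le_esum_subset => //.
by move=> j ->.
Qed.

(** Tonelli when the inner index set depends on the outer index: both sides sum over the same set of
    pairs. *)
Lemma esum_exchange (I J : choiceType) (P : set I) (Q : I -> set J)
    (Q' : set J) (P' : J -> set I) (a : I -> J -> \bar R) :
  (forall i j, P i /\ Q i j <-> Q' j /\ P' j i) ->
  (forall i j, P i -> Q i j -> 0 <= a i j) ->
  \esum_(i in P) \esum_(j in Q i) a i j =
  \esum_(j in Q') \esum_(i in P' j) a i j.
Proof.
move=> PQ a0; rewrite !esum_esum//; last first.
  by move=> j i Qj Pi; have [] := (PQ i j).2 (conj Qj Pi); exact: a0.
rewrite (reindex_esum (Q' `*`` P') _ (fun x => (x.2, x.1)))//; split=> //=.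
- by move=> [j i] /= [h1 h2]; apply PQ.
- by move=> [i1 i2] [j1 j2] /= _ _ [] -> ->.
- by move=> [i j] [h1 h2] /=; exists (j, i) => //; apply PQ.
Qed.

Lemma esum_exchangeT (I J : choiceType) (a : I -> J -> \bar R) :
  (forall i j, 0 <= a i j) ->
  \esum_(i in [set: I]) \esum_(j in [set: J]) a i j =
  \esum_(j in [set: J]) \esum_(i in [set: I]) a i j.
Proof. by move=> a0; apply: esum_exchange. Qed.

Lemma esumZl (I : choiceType) (A : set I) (a : I -> \bar R) (c : R) :
  (0 <= c)%R -> (forall i, 0 <= a i) ->
  \esum_(i in A) (c%:E * a i) = c%:E * \esum_(i in A) a i.
Proof.
move=> c0 a0.
have le (d : R) (b : I -> \bar R) : (0 <= d)%R -> (forall i, 0 <= b i) ->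
    \esum_(i in A) (d%:E * b i) <= d%:E * \esum_(i in A) b i.
  move=> d0 b0; apply: ge_ereal_sup => /= _ [X [finX XA] <-].
  rewrite -ge0_mule_fsumr//.
  by apply: lee_wpmul2l; rewrite ?lee_fin//; apply: ereal_sup_ubound; exists X.
apply/eqP; rewrite eq_le le//=.
have [c_eq0|c_neq0] := eqVneq c 0%R.
  subst c.
  by rewrite mul0e; apply: esum_ge0 => i _; rewrite mul0e.
have {}c0 : (0 < c)%R by rewrite lt_neqAle eq_sym c_neq0.
have c1 : (0 <= c^-1)%R by rewrite invr_ge0 ltW.
have := le _ (fun i => c%:E * a i) c1 (fun i => mule_ge0 (ltW c0 : 0 <= c%:E) (a0 i)).
under eq_esum do rewrite muleA -EFinM mulVf ?gt_eqF// mul1e.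
move=> /(@lee_wpmul2l _ c%:E (ltW c0)).
by rewrite muleA -EFinM mulfV ?gt_eqF// mul1e.
Qed.

Lemma esumZr (I : choiceType) (A : set I) (a : I -> R) (c : \bar R) :
  0 <= c -> (forall i, 0 <= a i)%R ->
  \esum_(i in A) ((a i)%:E * c) <= (\esum_(i in A) (a i)%:E) * c.
Proof.
move=> c0 a0; apply: ge_ereal_sup => /= _ [X [finX XA] <-].
rewrite -ge0_mule_fsuml//; apply: lee_wpmul2r => //.
by apply: ereal_sup_ubound; exists X.
Qed.

Lemma esum_le_single (I : choiceType) (A : set I) (c : \bar R) :
  0 <= c -> (forall i j, A i -> A j -> i = j) -> \esum_(i in A) c <= c.
Proof.
move=> c0 A1; have [->|/set0P[i Ai]] := eqVneq A set0.
  by rewrite esum_set0.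
suff -> : A = [set i] by rewrite esum_set1.
by apply/seteqP; split=> [j Aj|j ->//]; exact: A1.
Qed.

Lemma esum_bigcup_le (I J : choiceType) (P : set I) (Q : I -> set J)
    (a : J -> \bar R) : (forall j, 0 <= a j) ->
  \esum_(j in \bigcup_(i in P) Q i) a j <= \esum_(i in P) \esum_(j in Q i) a j.
Proof.
move=> a0; rewrite (@esum_exchange _ _ _ _ (\bigcup_(i in P) Q i)
  (fun j => [set i | P i /\ Q i j])) => //; last first.
  by move=> i j; split=> [[Pi Qij]|[] _ []//]; split=> //; exists i.
apply: le_esum => j [i Pi Qij].
exact: (@esum_lb _ [set i | P i /\ Q i j] (fun=> a j) i).
Qed.

Lemma esum_disjoint_le (I J : choiceType) (P : set I) (Q : I -> set J)
    (K : set J) (a : J -> \bar R) : (forall j, 0 <= a j) ->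
  (forall i j, P i -> Q i j -> K j) ->
  (forall i i' j, P i -> P i' -> Q i j -> Q i' j -> i = i') ->
  \esum_(i in P) \esum_(j in Q i) a j <= \esum_(j in K) a j.
Proof.
move=> a0 QK Q1; rewrite (@esum_exchange _ _ _ _ K
  (fun j => [set i | P i /\ Q i j])) => //; last first.
  by move=> i j; split=> [[Pi Qij]|[] _ []//]; split=> //; apply: QK Qij.
apply: le_esum => j Kj; apply: esum_le_single => // i i' [? ?] [? ?].
exact: Q1 (j) _ _ _ _.
Qed.

Lemma ereal_inf_adherent_eps (S : set \bar R) (e : R) :
  (0 < e)%R -> (forall y, S y -> 0 <= y) -> ereal_inf S < +oo ->
  exists2 y, S y & y <= ereal_inf S + e%:E.
Proof.
move=> e0 S0 Sfin.
have [|y Sy ye] := @lb_ereal_inf_adherent _ S e e0; last by exists y => //; exact: ltW.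
by rewrite ge0_fin_numE//; exact/ereal_infP.
Qed.

Lemma esum_pickle_eps (I : countType) (e : R) : (0 < e)%R ->
  \esum_(i in [set: I]) (e / (2 ^ (pickle i).+1)%:R)%:E <= e%:E.
Proof.
move=> e0; rewrite -(@esum_image _ _ _ _ pickle
   (fun k => (e / (2 ^ k.+1)%:R)%:E)); last first.
  by move=> i j _ _; exact: (pcan_inj pickleK).
apply: (@le_trans _ _ (\esum_(k in [set: nat]) (e / (2 ^ k.+1)%:R)%:E)).
  by apply: le_esum_subset => // k _; rewrite lee_fin divr_ge0// ltW.
rewrite -nneseries_esumT; last by move=> k; rewrite lee_fin divr_ge0// ltW.
by apply: (@epsilon_trick0 R e xpredT); exact: ltW.
Qed.

(** Near-optimal choices with errors [e / 2^(i+1)], [i] the code of the index, cost at most [e] in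
    total. Countable subadditivity of the content, of [dcontent] and of [dnorm] all reduce to this
    exchange of infimum and sum. *)
Lemma ereal_inf_esum_le (J : countType) (P : set J) (S : J -> set \bar R)
    (x : \bar R) :
  (forall j y, S j y -> 0 <= y) ->
  (forall y : J -> \bar R, (forall j, P j -> S j (y j)) ->
     x <= \esum_(j in P) y j) ->
  x <= \esum_(j in P) ereal_inf (S j).
Proof.
move=> S0 HX.
have inf0 j : 0 <= ereal_inf (S j) by apply/ereal_infP => y /S0.
have [Pfin|/existsNP[j /not_implyP[Pj /negP]]] :=
    pselect (forall j, P j -> ereal_inf (S j) < +oo); last first.
  rewrite -leNgt leye_eq => /eqP Sj.
  suff -> : \esum_(j in P) ereal_inf (S j) = +oo by rewrite leey.
  by apply/eqP; rewrite -leye_eq -Sj; exact: esum_lb (fun i => ereal_inf (S i)) _ _ _.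
apply/lee_addgt0Pr => e e0.
have /choice[y Hy] : forall j, exists y, P j -> S j y /\
    y <= ereal_inf (S j) + (e / (2 ^ (pickle j).+1)%:R)%:E.
  move=> j; have [Pj|nPj] := pselect (P j); last by exists 0.
  have e0' : (0 < e / (2 ^ (pickle j).+1)%:R)%R by rewrite divr_gt0// ltr0n expn_gt0.
  by have [y Sy ye] := ereal_inf_adherent_eps e0' (S0 j) (Pfin _ Pj); exists y.
apply: (le_trans (HX y (fun j Pj => (Hy j Pj).1))).
apply: (@le_trans _ _ (\esum_(j in P) (ereal_inf (S j) +
    (e / (2 ^ (pickle j).+1)%:R)%:E))).
  by apply: le_esum => j Pj; exact: (Hy j Pj).2.
rewrite esumD//; last by move=> j _; rewrite lee_fin divr_ge0// ltW.
rewrite leeD2l//; apply: le_trans (esum_pickle_eps J e0).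
by apply: le_esum_subset => // j _; rewrite lee_fin divr_ge0// ltW.
Qed.

End esum_complements.

(** * Subadditivity of the Hausdorff content and its null sets *)

Section hausdorff_content.
Context {R : realType} {n : nat} (delta : R).
Local Notation hc := (@hcontent R n delta).
Implicit Types A B : set 'rV[R]_n.

Lemma hcontent_ge0 A : 0 <= hc A.
Proof.
apply/ereal_infP => y [D [Q [_ ->]]]; apply: esum_ge0 => i _.
by rewrite lee_fin powR_ge0.
Qed.

(** Transport along [pickle] lets coverings be indexed by any countable type; the placeholder [Q0]
    occurs only outside the summation set. *)
Lemma hcontent_cover (J : countType) (D : set J) (Q : J -> cube R n) A :
  A `<=` \bigcup_(j in D) cube_set (Q j) ->
  hc A <= \esum_(j in D) (edge (Q j) `^ delta)%:E.
Proof.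
move=> AD; pose Q0 : cube R n := @Cube R n 0%R 1%R ltr01.
pose Q' i := if unpickle i is Some j then Q j else Q0.
have Q'E j : Q' (pickle j) = Q j by rewrite /Q' pickleK.
apply: ereal_inf_lbound; exists (pickle @` D), Q'; split.
  by move=> x /AD[j Dj Qjx]; exists (pickle j); [exists j|rewrite Q'E].
rewrite esum_image; last by move=> i j _ _; exact: (pcan_inj pickleK).
by apply: eq_esum => j _; rewrite Q'E.
Qed.

Lemma hcontent_subadd (J : countType) (P : set J) (B : J -> set 'rV[R]_n) A :
  A `<=` \bigcup_(j in P) B j -> hc A <= \esum_(j in P) hc (B j).
Proof.
move=> AB; apply: ereal_inf_esum_le.
  move=> j y [D [Q [_ ->]]]; apply: esum_ge0 => i _.
  by rewrite lee_fin powR_ge0.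
move=> y Hy.
have /choice[DQ HDQ] : forall j, exists DQ : set nat * (nat -> cube R n), P j ->
    B j `<=` \bigcup_(i in DQ.1) cube_set (DQ.2 i) /\
    y j = \esum_(i in DQ.1) (edge (DQ.2 i) `^ delta)%:E.
  move=> j; have [Pj|nPj] := pselect (P j); last first.
    by exists (set0, fun=> @Cube R n 0%R 1%R ltr01).
  by have [D [Q ?]] := Hy j Pj; exists (D, Q).
rewrite (_ : \esum_(j in P) y j = \esum_(ji in P `*`` (fun j => (DQ j).1))
    (edge ((DQ ji.1).2 ji.2) `^ delta)%:E); last first.
  rewrite -(@esum_esum _ _ _ _ _ (fun j i => (edge ((DQ j).2 i) `^ delta)%:E)).
    by apply: eq_esum => j Pj; exact: (HDQ j Pj).2.
  by move=> i j _ _; rewrite lee_fin powR_ge0.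
apply: hcontent_cover => x /AB[j Pj Bjx].
by have [i Di Qi] := (HDQ j Pj).1 x Bjx; exists (j, i).
Qed.

Lemma hcontent_le A B : A `<=` B -> hc A <= hc B.
Proof.
move=> AB; apply: ereal_inf_le_tmp => _ [D [Q [BD ->]]].
by exists D, Q; split=> //; exact: subset_trans BD.
Qed.

Lemma hcontent_cube (Q : cube R n) : hc Q <= (edge Q `^ delta)%:E.
Proof.
apply: le_trans (@hcontent_cover unit setT (fun=> Q) Q _) _.
  by move=> x Qx; exists tt.
by apply: esum_le_single; rewrite ?lee_fin ?powR_ge0// => -[] [].
Qed.

Definition null A := hc A = 0.

Lemma null_le0 A : hc A <= 0 -> null A.
Proof. by move=> A0; apply/eqP; rewrite eq_le A0 hcontent_ge0. Qed.

Lemma null_sub A B : A `<=` B -> null B -> null A.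
Proof. by move=> AB B0; apply: null_le0; rewrite -B0 hcontent_le. Qed.

Lemma null_bigcup (J : countType) (P : set J) (B : J -> set 'rV[R]_n) :
  (forall j, P j -> null (B j)) -> null (\bigcup_(j in P) B j).
Proof.
move=> B0; apply: null_le0; rewrite (le_trans (@hcontent_subadd J P B _ _))//.
by rewrite esum1.
Qed.

Lemma nullU A B : null A -> null B -> null (A `|` B).
Proof.
move=> A0 B0; apply: (@null_sub _ (\bigcup_(b in [set: bool]) if b then A else B)).
  by move=> x [Ax|Bx]; [exists true|exists false].
by apply: null_bigcup => -[].
Qed.

Lemma null0 : null set0.
Proof.
apply: null_le0; apply: le_trans (@hcontent_cover unit set0
  (fun=> @Cube R n 0%R 1%R ltr01) _ _) _ => //.
by rewrite esum_set0.
Qed.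

End hausdorff_content.

(** * Dyadic cubes and the content of a cube *)

(** A pair [(k, m)] encodes the half-open cube with lower corner [2^k m] and side [2^k]; [k] runs
    over all integers, so there are arbitrarily large and arbitrarily small cubes. *)
Notation dyadic n := (int * {ffun 'I_n -> int})%type.

Section dyadic_cubes.
Context {R : realType} {n : nat}.
Implicit Types (k : int) (P Q : dyadic n) (x y : 'rV[R]_n).

Definition mesh k : R := (2%:R : R) ^ k.

Lemma mesh_gt0 k : (0 < mesh k)%R.
Proof. by rewrite exprz_gt0. Qed.

Lemma meshS k : mesh (k + 1) = (2 * mesh k)%R.
Proof. by rewrite /mesh expfzDr ?pnatr_eq0// mulrC. Qed.

Lemma meshD k (j : nat) : mesh (k + j%:Z) = ((2 ^ j)%N%:R * mesh k)%R.
Proof. by rewrite /mesh expfzDr ?pnatr_eq0// natrX mulrC -exprnP. Qed.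

Lemma le_mesh k k' : (k <= k')%R -> (mesh k <= mesh k')%R.
Proof. by move=> kk; rewrite ler_eXz2l// ltr1n. Qed.

Lemma mesh_itv (e : R) : (0 < e)%R -> exists k, (mesh k < e <= mesh (k + 1))%R.
Proof.
move=> e0.
have l2 : (0 < ln (2 : R))%R by rewrite ln_gt0// ltr1n.
have meshE j : mesh j = expR (j%:~R * ln 2).
  by rewrite /mesh -powR_intmul// /powR pnatr_eq0.
have [h1 h2] := andP (ceil_itv (ln e / ln 2 : R)).
have eE : e = expR (ln e) by rewrite lnK.
have [k Hk] : exists k : int, (k%:~R * ln 2 < ln e <= (k + 1)%:~R * ln 2)%R.
  exists (Num.ceil (ln e / ln 2) - 1)%R.
  by rewrite -ltr_pdivlMr// -ler_pdivrMr// subrK h2 andbT.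
by exists k; rewrite !meshE eE ltr_expR ler_expR.
Qed.

Definition cell Q : set 'rV[R]_n := [set x | forall i : 'I_n,
  ((Q.2 i)%:~R * mesh Q.1 < x ord0 i)%R /\
  (x ord0 i <= (Q.2 i)%:~R * mesh Q.1 + mesh Q.1)%R].

Definition dcube Q : cube R n :=
  Cube (\row_i ((Q.2 i)%:~R * mesh Q.1)%R) (mesh_gt0 Q.1).

Lemma dcubeE Q : cube_set (dcube Q) = cell Q.
Proof.
by apply/seteqP; split=> x Qx i; move: (Qx i); rewrite /= mxE.
Qed.

(** Cells are open on the left and closed on the right, hence the ceiling minus one and not the
    floor. *)
Definition idx k x : {ffun 'I_n -> int} :=
  [ffun i => Num.ceil (x ord0 i / mesh k) - 1]%R.

Lemma idxP Q x : cell Q x <-> Q.2 = idx Q.1 x.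
Proof.
have m0 := mesh_gt0 Q.1; split=> [Qx|QE].
  apply/ffunP => i; rewrite ffunE; have [h1 h2] := Qx i.
  apply/eqP; rewrite eq_sym subr_eq; apply/eqP/ceil_def.
  by rewrite addrK ltr_pdivlMr// h1 ler_pdivrMr// rmorphD/= mulrDl mul1r.
move=> i; rewrite QE ffunE; have [h1 h2] := andP (ceil_itv (x ord0 i / mesh Q.1)%R).
rewrite -ltr_pdivlMr// h1; split=> //.
by rewrite rmorphB/= mulrBl mul1r subrK -ler_pdivrMr.
Qed.

Definition at_level k x : dyadic n := (k, idx k x).

Lemma at_levelP k x : cell (at_level k x) x.
Proof. exact/idxP. Qed.

Lemma cell_at Q x : cell Q x -> Q = at_level Q.1 x.
Proof. by move=> /idxP; rewrite /at_level => <-; case: Q. Qed.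

Definition tip Q : 'rV[R]_n := \row_i ((Q.2 i)%:~R * mesh Q.1 + mesh Q.1)%R.

Lemma cell_tip Q : cell Q (tip Q).
Proof. by move=> i; rewrite mxE ltrDl mesh_gt0 lexx. Qed.

Lemma level_split k k' : (k <= k')%R -> exists N : nat,
  [/\ k' = (k + N%:Z)%R & mesh k' = ((2 ^ N)%N%:R * mesh k)%R].
Proof.
move=> kk; exists `|k' - k|%N.
have e : k' = (k + `|k' - k|%N%:Z)%R by rewrite gez0_abs ?subr_ge0// subrKC.
by split=> //; rewrite {1}e meshD.
Qed.

(* An integer inequality in disguise: dyadic intervals are nested. *)
Lemma nested_itv (m : R) (F : nat) (p q : int) (t : R) : (0 < m)%R ->
  (q%:~R * m < t <= q%:~R * m + m)%R ->
  (p%:~R * (F%:R * m) < t <= p%:~R * (F%:R * m) + F%:R * m)%R ->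
  (p%:~R * (F%:R * m) <= q%:~R * m)%R /\
  (q%:~R * m + m <= p%:~R * (F%:R * m) + F%:R * m)%R.
Proof.
move=> m0 /andP[h1 h2] /andP[h3 h4].
have e1 : (p%:~R * (F%:R * m) = (p * F%:Z)%:~R * m)%R.
  by rewrite rmorphM/= mulrA.
have e2 : (q%:~R * m + m = (q + 1)%:~R * m)%R by rewrite rmorphD/= mulrDl mul1r.
have e3 : (p%:~R * (F%:R * m) + F%:R * m = ((p + 1) * F%:Z)%:~R * m)%R.
  by rewrite rmorphM rmorphD/= -mulrA mulrDl mul1r.
move: h2 h3 h4; rewrite e3 e2 e1 => h2 h3 h4.
rewrite !ler_pM2r// !ler_int.
have := lt_le_trans h3 h2; rewrite ltr_pM2r// ltr_int => g1.
have := lt_le_trans h1 h4; rewrite ltr_pM2r// ltr_int => g2.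
by split; lia.
Qed.

Lemma nested_cell P Q x : (Q.1 <= P.1)%R -> cell Q x -> cell P x -> forall i,
  ((P.2 i)%:~R * mesh P.1 <= (Q.2 i)%:~R * mesh Q.1)%R /\
  ((Q.2 i)%:~R * mesh Q.1 + mesh Q.1 <= (P.2 i)%:~R * mesh P.1 + mesh P.1)%R.
Proof.
move=> QP Qx Px i; have [N [_ e]] := level_split QP.
have [h1 h2] := Qx i; have [h3 h4] := Px i; rewrite e in h3 h4 *.
by apply: (@nested_itv _ _ _ _ (x ord0 i)); rewrite ?mesh_gt0// ?h1 ?h3.
Qed.

(* Containment of dyadic cubes; the top corner [tip Q] lies in the half-open
   cell of [Q], so it suffices to test it. *)
Definition sub Q P := (Q.1 <= P.1)%R /\ cell P (tip Q).

Lemma subI Q P x : (Q.1 <= P.1)%R -> cell Q x -> cell P x -> sub Q P.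
Proof.
move=> QP Qx Px; split=> // i; rewrite mxE.
have [h1 h2] := nested_cell QP Qx Px i; split=> //.
by rewrite (le_lt_trans h1)// ltrDl mesh_gt0.
Qed.

Lemma sub_cell Q P : sub Q P -> cell Q `<=` cell P.
Proof.
move=> [QP PQ] x Qx i; have [h1 h2] := nested_cell QP (cell_tip Q) PQ i.
by have [h3 h4] := Qx i; split; [exact: le_lt_trans h3|exact: le_trans h2].
Qed.

Lemma sub_refl Q : sub Q Q.
Proof. by split=> //; exact: cell_tip. Qed.

Lemma sub_trans P Q S : sub S Q -> sub Q P -> sub S P.
Proof.
move=> SQ QP; split; first exact: le_trans SQ.1 QP.1.
by apply: (sub_cell QP); exact: SQ.2.
Qed.

Lemma sub_level P Q : sub Q P -> Q.1 = P.1 -> Q = P.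
Proof. by move=> [_ QP] e; rewrite (cell_at QP) -e; exact/cell_at/cell_tip. Qed.

Lemma sub_linear P Q S : sub S P -> sub S Q -> (P.1 <= Q.1)%R -> sub P Q.
Proof. by move=> [_ SP] [_ SQ] PQ; exact: subI PQ SP SQ. Qed.

Lemma cell_sub_or P Q x : cell P x -> cell Q x -> sub P Q \/ sub Q P.
Proof.
move=> Px Qx; have [le|/ltW le] := leP P.1 Q.1; first by left; exact: subI Px Qx.
by right; exact: subI Qx Px.
Qed.

Definition anc k Q : dyadic n := at_level k (tip Q).

Lemma sub_anc k Q : (Q.1 <= k)%R -> sub Q (anc k Q).
Proof. by split=> //; exact: at_levelP. Qed.

Lemma sub_ancE Q P : sub Q P -> P = anc P.1 Q.
Proof. by move=> [_ /cell_at]. Qed.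

Definition up Q := anc (Q.1 + 1)%R Q.

Lemma sub_up Q : sub Q (up Q).
Proof. by apply: sub_anc; rewrite lerDl. Qed.

Lemma sub_strict Q P : sub Q P -> Q <> P -> sub (up Q) P.
Proof.
move=> QP QneP; apply: (sub_linear (sub_up Q) QP).
rewrite /up/= lezD1 lt_neqAle (proj1 QP) andbT.
by apply/eqP => e; apply: QneP; exact: sub_level.
Qed.

(** The concentric cube with three times the side. Enlarging cells in this way makes a single dyadic
    grid sufficient. *)
Definition star P : set 'rV[R]_n := [set x | forall i : 'I_n,
  ((P.2 i)%:~R * mesh P.1 - mesh P.1 < x ord0 i)%R /\
  (x ord0 i <= (P.2 i)%:~R * mesh P.1 + 2 * mesh P.1)%R].

Lemma star_edge_gt0 P : (0 < 3 * mesh P.1)%R.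
Proof. by rewrite mulr_gt0// mesh_gt0. Qed.

Definition dstar P : cube R n :=
  Cube (\row_i ((P.2 i)%:~R * mesh P.1 - mesh P.1)%R) (star_edge_gt0 P).

Lemma dstarE P : cube_set (dstar P) = star P.
Proof.
apply/seteqP; split=> x Px i; move: (Px i); rewrite /= mxE => -[h1 h2]; split => //; lra.
Qed.

Definition nbr P (e : {ffun 'I_n -> 'I_3}) : dyadic n :=
  (P.1, [ffun i => P.2 i + (e i : nat)%:Z - 1]%R).

Lemma sub_star_nbr P e : cell (nbr P e) `<=` star P.
Proof.
move=> x Px i; have [] := Px i; have m0 := mesh_gt0 P.1.
rewrite /= ffunE rmorphB rmorphD/= => h1 h2.
have e0 : (0 <= (e i)%:R :> R)%R by rewrite ler0n.
have e2 : ((e i)%:R <= 2 :> R)%R by rewrite ler_nat -ltnS.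
split; nra.
Qed.

Lemma star_nbr P x : star P x -> exists e, cell (nbr P e) x.
Proof.
move=> Px; have m0 := mesh_gt0 P.1; pose Q := at_level P.1 x.
have H i : (P.2 i - 1 <= Q.2 i <= P.2 i + 1)%R.
  have [h1 h2] := Px i; have [h3 h4] := at_levelP P.1 x i.
  apply/andP; split.
    rewrite -ltzD1 -(ltr_int R) -(ltr_pM2r m0) rmorphB rmorphD/=; lra.
  rewrite -ltzD1 -(ltr_int R) -(ltr_pM2r m0) !rmorphD/=; lra.
exists [ffun i => inord (absz (Q.2 i - P.2 i + 1)%R)].
apply/idxP; rewrite /=; apply/ffunP => i; rewrite 2!ffunE.
have /andP[h1 h2] := H i.
have -> : idx P.1 x i = Q.2 i by [].
move: h1 h2; move: (Q.2 i) (P.2 i) => q p h1 h2.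
have h3 : (0 <= q - p + 1)%R by lia.
rewrite inordK; first by rewrite gez0_abs//; lia.
by rewrite -ltz_nat gez0_abs//; lia.
Qed.

Lemma sub_star P : cell P `<=` star P.
Proof.
move=> x Px i; have [h1 h2] := Px i; have m0 := mesh_gt0 P.1; split; lra.
Qed.

Lemma star_up P : cell (up P) `<=` star P.
Proof.
move=> x ux i; have [h1 h2] := ux i; have m0 := mesh_gt0 P.1.
have [[] ] := nested_cell (sub_up P).1 (cell_tip P) (sub_up P).2 i.
move: h1 h2; rewrite !meshS => h1 h2 h3 h4; split; lra.
Qed.

Lemma star_mono P Q : sub P Q -> star P `<=` star Q.
Proof.
move=> PQ x Px i; have [h1 h2] := Px i; have m0 := mesh_gt0 P.1.
have [] := nested_cell PQ.1 (cell_tip P) PQ.2 i.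
have := le_mesh PQ.1 => h3 h4 h5; split; lra.
Qed.

(** The integer indices of the two cells differ by at most one in each coordinate, which is a
    symmetric relation. *)
Lemma star_sym k x y : star (at_level k x) y -> star (at_level k y) x.
Proof.
move=> xy i; have m0 := mesh_gt0 k.
have [h1 h2] := xy i; have [h3 h4] := at_levelP k x i; have [h5 h6] := at_levelP k y i.
rewrite /= in h1 h2 h3 h4 h5 h6 *.
move: h1 h2 h3 h4 h5 h6; set p := idx k x i; set q := idx k y i => h1 h2 h3 h4 h5 h6.
have g1 : (q <= p + 1)%R.
  rewrite -ltzD1 -(ltr_int R) -(ltr_pM2r m0) !rmorphD/=; lra.
have g2 : (p <= q + 1)%R.
  rewrite -ltzD1 -(ltr_int R) -(ltr_pM2r m0) !rmorphD/=; lra.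
move: g1 g2; rewrite -(ler_int R) -(ler_pM2r m0) => g1.
rewrite -(ler_int R) -(ler_pM2r m0) => g2.
move: g1 g2; rewrite !rmorphD/= !mulrDl !mul1r => g1 g2; split; lra.
Qed.

(** The bridge from arbitrary cubes to the grid: [Q] reaches at most one mesh beyond the cell of any
    of its points. *)
Lemma cube_sub_star (Q : cube R n) k x : (edge Q <= mesh k)%R -> cube_set Q x ->
  cube_set Q `<=` star (at_level k x).
Proof.
move=> Qk Qx y Qy i; have [h1 h2] := Qx i; have [h3 h4] := Qy i.
have [h5 h6] := at_levelP k x i; split; lra.
Qed.

(** Two points of the parent that are one mesh apart along an axis lie in different children, and
    one of these is not [P]. Siblings drive the growth of weights along ancestors. *)
Lemma sibling P : (0 < n)%N -> exists S, [/\ S.1 = P.1, S <> P & sub S (up P)].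
Proof.
move=> n0; pose i0 := Ordinal n0; have m0 := mesh_gt0 P.1.
pose y := tip (up P); pose y' := (\row_i (y ord0 i - (i == i0)%:R * mesh P.1))%R.
have uy : cell (up P) y := cell_tip (up P).
have uy' : cell (up P) y'.
  move=> i; have [h1 h2] := uy i; rewrite !mxE meshS in h1 h2 *.
  by case: (i == i0) => /=; split; lra.
have sy z : cell (up P) z -> sub (at_level P.1 z) (up P).
  by move=> uz; apply: (subI _ (at_levelP _ _) uz); rewrite lerDl.
have neq : at_level P.1 y <> at_level P.1 y'.
  move=> e; have := at_levelP P.1 y i0; have := at_levelP P.1 y' i0.
  rewrite -e [y' _ _]mxE eqxx /= => -[h1 h2] [h3 h4]; lra.
have [e|ne] := eqVneq (at_level P.1 y) P; last by exists (at_level P.1 y); split=> //; [exact/eqP|exact: sy].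
by exists (at_level P.1 y'); split=> //; [move=> e'; apply: neq; rewrite e|exact: sy].
Qed.
Lemma finite_level_lb (X : set (dyadic n)) : finite_set X ->
  exists k, forall Q, X Q -> (k <= Q.1)%R.
Proof.
move=> finX; have [s sX] := (finite_seqP X).1 finX.
exists (foldr Num.min 0%R (map (fun Q => Q.1) s)) => Q; rewrite sX /=.
elim: s {sX} => //= a s IH; rewrite inE => /orP[/eqP ->|/IH h].
  by rewrite ge_min lexx.
by rewrite ge_min h orbT.
Qed.

End dyadic_cubes.

(** * Sums over finite types *)

Section finite_esum.
Context {R : realType}.

Lemma esum_finType (T : finType) (f : T -> \bar R) : (forall t, 0 <= f t) ->
  \esum_(t in [set: T]) f t = \sum_(t : T) f t.
Proof.
move=> f0; rewrite esum_fset//; last exact: finite_finset.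
rewrite fsbig_finite//=.
rewrite -big_enum/=; apply: perm_big.
apply: uniq_perm; [exact: finmap.fset_uniq|exact: enum_uniq|move=> t].
by rewrite in_fset_set ?mem_enum ?in_setT//; exact: finite_finset.
Qed.

Lemma esum_finType_cst (T : finType) (c : R) : (0 <= c)%R ->
  \esum_(t in [set: T]) c%:E = (#|T|%:R * c)%:E.
Proof.
move=> c0; rewrite esum_finType// sumEFin; congr (_%:E).
by rewrite big_const iter_addr_0 mulr_natl.
Qed.

End finite_esum.

(** * Lower bound for the content of a dyadic cell *)

Section content_lower_bound.
Context {R : realType} {n : nat} (delta : R).
Hypotheses (delta_gt0 : (0 < delta)%R) (delta_le : (delta <= n%:R)%R).
Implicit Types P Q S : dyadic n.
Local Notation hc := (@hcontent R n delta).
Local Notation mesh := (@mesh R).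
Local Notation sub := (@sub R n).

Definition ell Q : R := (mesh Q.1 `^ delta)%R.

Lemma ell_gt0 Q : (0 < ell Q)%R.
Proof. by rewrite powR_gt0// mesh_gt0. Qed.

Lemma ell_ge0 Q : (0 <= ell Q)%R. Proof. exact/ltW/ell_gt0. Qed.
Local Hint Resolve ell_gt0 ell_ge0 : core.

Lemma le_ell Q P : (Q.1 <= P.1)%R -> (ell Q <= ell P)%R.
Proof.
move=> QP; apply: ge0_ler_powR; rewrite ?nnegrE ?(ltW delta_gt0)//.
- exact/ltW/mesh_gt0.
- exact/ltW/mesh_gt0.
- exact: le_mesh.
Qed.

Lemma ell_up Q P : (P.1 = Q.1 + 1)%R -> ell P = (2 `^ delta * ell Q)%R.
Proof. by move=> e; rewrite /ell e meshS powRM// ltW// mesh_gt0. Qed.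

Definition child P (e : {ffun 'I_n -> bool}) : dyadic n :=
  (P.1 - 1, [ffun i => 2 * P.2 i + (e i : nat)%:Z])%R.

Lemma mesh_pred k : mesh k = (2 * mesh (k - 1))%R.
Proof. by rewrite -meshS subrK. Qed.

Lemma sub_child P e : sub (child P e) P.
Proof.
split=> [|i]; first by rewrite /= gerBl.
rewrite !mxE /= ffunE (mesh_pred P.1).
have m0 := mesh_gt0 (R := R) (P.1 - 1).
rewrite rmorphD rmorphM/=; case: (e i) => /=; split; lra.
Qed.

Lemma child_inj P : injective (child P).
Proof.
move=> e e' /(congr1 (@snd _ _)) /= E; apply/ffunP => i.
have := congr1 (fun f : {ffun 'I_n -> int} => f i) E; rewrite /= !ffunE.
by move=> /addrI; case: (e i); case: (e' i).
Qed.

Let mass (C : set (dyadic n)) P := \esum_(Q in C `&` [set Q | sub Q P]) (ell Q)%:E.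

(** Pigeonhole with [delta <= n]: each of the [2^n] children has [ell] equal to [ell P / 2^delta],
    so if none were light, their masses would add up to at least [ell P]. *)
Lemma exists_light_child (C : set (dyadic n)) P : mass C P < (ell P)%:E ->
  exists e, mass C (child P e) < (ell (child P e))%:E.
Proof.
move=> CP; apply/not_existsP => H; move: CP; apply/negP; rewrite -leNgt.
apply: (@le_trans _ _ (\esum_(e in [set: {ffun 'I_n -> bool}]) mass C (child P e))).
  pose c := (ell P / 2 `^ delta)%R.
  have cE e : ell (child P e) = c.
    rewrite /c (@ell_up (child P e) P) /= ?subrK//.
    by rewrite mulrC mulKf// gt_eqF// powR_gt0.
  apply: (@le_trans _ _ (\esum_(e in [set: {ffun 'I_n -> bool}]) c%:E)).
    rewrite esum_finType_cst ?divr_ge0 ?powR_ge0// lee_fin.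
    rewrite card_ffun card_bool card_ord /c mulrA ler_pdivlMr ?powR_gt0// mulrC.
    rewrite ler_wpM2r// natrX -powR_mulrn//.
    by apply: ler_powR => //; rewrite ler1n.
  by apply: le_esum => e _; rewrite -(cE e) leNgt; apply/negP; exact: H.
apply: esum_disjoint_le => [Q|e Q _ [CQ Qe]|e e' Q _ _ [_ Qe] [_ Qe']].
- by rewrite lee_fin.
- by split=> //; apply: sub_trans (sub_child P e).
- by apply: (@child_inj P); rewrite (sub_ancE Qe) (sub_ancE Qe').
Qed.

Let lo (P : dyadic n) (i : 'I_n) : R := ((P.2 i)%:~R * mesh P.1)%R.
Let hi (P : dyadic n) (i : 'I_n) : R := (lo P i + mesh P.1)%R.

(** Light children chosen recursively form a nested chain whose closures share a point, the
    coordinatewise supremum of the lower corners. *)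
Lemma light_chain (C : set (dyadic n)) P : mass C P < (ell P)%:E ->
  exists (S : nat -> dyadic n) (x : 'rV[R]_n),
   [/\ S 0%N = P, forall k, (S k).1 = (P.1 - k%:Z)%R,
    forall k, mass C (S k) < (ell (S k))%:E &
    forall k i, (lo (S k) i <= x ord0 i <= hi (S k) i)%R].
Proof.
move=> CP.
have /choice[f Hf] : forall Q, exists Q', mass C Q < (ell Q)%:E ->
    [/\ Q'.1 = (Q.1 - 1)%R, sub Q' Q & mass C Q' < (ell Q')%:E].
  move=> Q; have [CQ|nCQ] := pselect (mass C Q < (ell Q)%:E); last by exists Q.
  by have [e he] := exists_light_child CQ; exists (child Q e) => _; split=> //; exact: sub_child.
pose S k := iter k f P.
have Slight k : mass C (S k) < (ell (S k))%:E.
  by elim: k => //= k IH; have [_ _] := Hf _ IH.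
have Slev k : (S k).1 = (P.1 - k%:Z)%R.
  elim: k => [|k IH]; first by rewrite subr0.
  by have [/= -> _ _] := Hf _ (Slight k); rewrite IH; lia.
have SS k j : sub (S (k + j)%N) (S k).
  elim: j => [|j IH]; first by rewrite addn0; exact: sub_refl.
  by rewrite addnS; have [_ h _] := Hf _ (Slight (k + j)%N); exact: sub_trans IH.
have lohi k j i : (lo (S k) i <= hi (S j) i)%R.
  have sub_lohi Q Q' : sub Q Q' -> (lo Q' i <= lo Q i)%R /\ (hi Q i <= hi Q' i)%R.
    by move=> QQ; exact: nested_cell QQ.1 (cell_tip Q) QQ.2 i.
  have [kj|/ltnW jk] := leqP k j.
    have [h1 h2] := sub_lohi _ _ (SS k (j - k)%N); rewrite subnKC// in h1 h2.
    by rewrite (le_trans h1)// lerDl ltW// mesh_gt0.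
  have [h1 h2] := sub_lohi _ _ (SS j (k - j)%N); rewrite subnKC// in h1 h2.
  by apply: le_trans h2; rewrite lerDl ltW// mesh_gt0.
exists S, (\row_i sup (range (fun k => lo (S k) i)))%R; split=> // k i.
rewrite mxE; apply/andP; split.
  apply: ub_le_sup; last by exists k.
  by exists (hi (S 0%N) i) => _ [j _ <-]; exact: lohi.
by apply: ge_sup; [exists (lo (S 0%N) i), 0%N|move=> _ [j _ <-]; exact: lohi].
Qed.

(* The dyadic cubes of the level of [P] whose closure meets [star P]. *)
Let fat P (e : {ffun 'I_n -> 'I_4}) : dyadic n :=
  (P.1, [ffun i => P.2 i + (e i : nat)%:Z - 1]%R).

(** Four offsets per coordinate instead of three, because [x] is only known to lie in the closure of
    [S]. *)
Let fatP P S x : S.1 = P.1 -> star P x ->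
  (forall i, lo S i <= x ord0 i <= hi S i)%R -> exists e, S = fat P e.
Proof.
move=> SP Px xS; have m0 := mesh_gt0 (R := R) P.1.
have H i : (P.2 i - 1 <= S.2 i <= P.2 i + 2)%R.
  have [h1 h2] := Px i; have /andP[h3 h4] := xS i.
  rewrite /hi /lo SP in h3 h4.
  apply/andP; split.
    rewrite lerBlDr -ltzD1 -(ltr_int R) -(ltr_pM2r m0) !rmorphD/=; lra.
  rewrite -(ler_int R) -(ler_pM2r m0) !rmorphD/=; lra.
exists [ffun i => inord (absz (S.2 i - P.2 i + 1)%R)].
rewrite [LHS]surjective_pairing /fat -SP; congr pair; apply/ffunP => i; rewrite 2!ffunE.
have /andP[h1 h2] := H i; move: h1 h2; move: (S.2 i) (P.2 i) => q p h1 h2.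
have h3 : (0 <= q - p + 1)%R by lia.
rewrite inordK; first by rewrite gez0_abs//; lia.
by rewrite -ltz_nat gez0_abs//; lia.
Qed.

(** A covering cheaper than the bound is replaced by the family [C] of dyadic cubes near its
    members, [4^n] for each. Then [C] is too light for a subcube [P0]. The limit point of a light
    chain below [P0] lies in some covering cube, and the level of that cube exhibits a member of [C]
    that is too heavy. *)
Lemma hcontent_cell_ge :
  exists2 c : R, (0 < c)%R & forall P, (c * ell P)%:E <= hc (cell P).
Proof.
pose K : R := ((4 ^ n)%:R * 2 `^ delta)%R.
have K0 : (0 < K)%R by rewrite mulr_gt0 ?powR_gt0// ltr0n expn_gt0.
have q0 : (0 < 4 `^ delta :> R)%R by rewrite powR_gt0.
exists (K * 4 `^ delta)^-1%R; first by rewrite invr_gt0 mulr_gt0.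
move=> P; apply/ereal_infP => _ [D [Q [PQ ->]]]; rewrite leNgt; apply/negP => small.
(* The mesh lies between the edge of [Q j] and twice it; the top corner is used because it belongs
   to the half-open cube. *)
pose cen j : dyadic n := at_level (projT1 (cid (mesh_itv (edge_gt0 (Q j)))) + 1)%R
  (corner (Q j) + const_mx (edge (Q j)))%R.
have cenP j : (mesh (cen j).1 <= 2 * edge (Q j))%R /\ cube_set (Q j) `<=` star (cen j).
  rewrite /cen; case: cid => /= k /andP[h1 h2]; split.
    by rewrite meshS ler_pM2l// ltW.
  apply: cube_sub_star => // i; rewrite !mxE ltrDl lexx edge_gt0; by [].
pose C := \bigcup_(je in D `*` [set: {ffun 'I_n -> 'I_4}]) [set fat (cen je.1) je.2].
(* Two levels down with offset one, the closure of [P0] stays inside the half-open cell of [P], so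
   the limit point cannot escape. The price is the factor [4^delta]. *)
pose P0 : dyadic n := (P.1 - 2%:Z, [ffun i => 4 * P.2 i + 1])%R.
have meshP : mesh P.1 = (4 * mesh P0.1)%R.
  by rewrite (mesh_pred P.1) (mesh_pred (P.1 - 1)) /= mulrA -addrA; congr (_ * _)%R; ring.
have ellP : ell P = (4 `^ delta * ell P0)%R.
  by rewrite /ell meshP powRM// ltW// mesh_gt0.
have Csmall : \esum_(S in C) (ell S)%:E < (ell P0)%:E.
  have le1 : \esum_(S in C) (ell S)%:E <= K%:E * \esum_(j in D) (edge (Q j) `^ delta)%:E.
    apply: le_trans (esum_bigcup_le _ _ _) _ => [S|]; first by rewrite lee_fin.
    rewrite -(@esum_esum _ _ _ _ (fun=> setT)
      (fun j e => \esum_(S in [set fat (cen j) e]) (ell S)%:E)); last first.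
      by move=> j e _ _; apply: esum_ge0 => S _; rewrite lee_fin.
    rewrite -esumZl ?(ltW K0)//; last by move=> j; rewrite lee_fin powR_ge0.
    apply: le_esum => j _.
    have E e : \esum_(S in [set fat (cen j) e]) (ell S)%:E = (ell (cen j))%:E.
      by rewrite esum_set1 ?lee_fin.
    under eq_esum do rewrite E.
    rewrite esum_finType_cst// card_ffun !card_ord -EFinM lee_fin /K -mulrA.
    rewrite ler_wpM2l// -powRM ?(ltW (edge_gt0 _))//.
    apply: ge0_ler_powR; rewrite ?nnegrE ?(ltW delta_gt0) ?(ltW (mesh_gt0 _)) ?mulr_ge0 ?(ltW (edge_gt0 _))//.
    exact: (cenP j).1.
  apply: le_lt_trans le1 _; rewrite -lte_pdivlMl//.
  apply: lt_le_trans small _; rewrite -EFinM lee_fin ellP invfM.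
  by rewrite -mulrA mulKf// gt_eqF.
have massC S : mass C S <= \esum_(S in C) (ell S)%:E.
  by apply: le_esum_subset => [? []//|? _]; rewrite lee_fin.
have [S [x [S0 Slev Slight Sx]]] := light_chain (le_lt_trans (massC P0) Csmall).
have Px : cell P x.
  move=> i; have /andP[] := Sx 0%N i; rewrite /hi /lo S0 /= ffunE.
  rewrite meshP rmorphD rmorphM/= => h1 h2.
  have := mesh_gt0 (R := R) P0.1; rewrite /= in h1 h2 *; split; nra.
have [j Dj Qjx] := PQ x Px.
have [_ Qstar] := cenP j.
have inC S' e : S' = fat (cen j) e -> C S' by move=> ->; exists (j, e).
(* If the level of [cen j] is at most that of [P0], the chain has a cube there and it belongs to
   [C], against lightness. Otherwise the ancestor of [P0] at that level belongs to [C] and alone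
   outweighs [P0]. *)
have [lev|/ltW lev] := leP (cen j).1 P0.1.
  pose k := `|(P0.1 - (cen j).1)%R|%N.
  have Sk : (S k).1 = (cen j).1 by rewrite Slev /k; lia.
  have [e Se] := fatP Sk (Qstar _ Qjx) (Sx k).
  have := Slight k; apply/negP; rewrite -leNgt.
  apply: (@esum_lb _ _ _ (fun S => (ell S)%:E)) => [|? _]; last by rewrite lee_fin.
  by split; [exact: inC Se|exact: sub_refl].
pose A := anc (R := R) (cen j).1 P0.
have P0A : sub P0 A := sub_anc lev.
have [e Ae] : exists e, A = fat (cen j) e.
  apply: fatP (Qstar _ Qjx) _ => // i.
  have [h1 h2] := nested_cell P0A.1 (cell_tip P0) P0A.2 i.
  have := Sx 0%N i; rewrite S0 => /andP[h3 h4].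
  by rewrite (le_trans h1 h3) (le_trans h4 h2).
move: Csmall; apply/negP; rewrite -leNgt.
apply: (@le_trans _ _ (ell A)%:E); first by rewrite lee_fin le_ell// P0A.1.
by apply: (@esum_lb _ _ _ (fun S => (ell S)%:E)) => [|? _]; [exact: inC Ae|rewrite lee_fin].
Qed.

End content_lower_bound.

(** * Dyadic contents and the Choquet integral *)

Section contents_and_norms.
Context {R : realType} {n : nat} (delta : R).
Hypotheses (delta_gt0 : (0 < delta)%R) (delta_le : (delta <= n%:R)%R).
Implicit Types (P Q S : dyadic n) (A B : set 'rV[R]_n) (f g : 'rV[R]_n -> \bar R)
  (phi : dyadic n -> \bar R).
Local Notation hc := (@hcontent R n delta).
Local Notation null := (@null R n delta).
Local Notation ell := (@ell R n delta).
Local Notation cell := (@cell R n).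

Let ell0 Q : (0 <= (ell Q)%:E :> \bar R). Proof. by rewrite lee_fin ell_ge0. Qed.

(** Only up to a null set, so that contents and selections of cubes ignore null sets from the
    start. *)
Definition covers A (C : set (dyadic n)) := null (A `\` \bigcup_(Q in C) cell Q).

(* For [phi = ell] this is the dyadic Hausdorff content. *)
Definition dcontent phi A : \bar R :=
  ereal_inf [set \esum_(Q in C) phi Q | C in covers A].

Definition stack (lam : dyadic n -> \bar R) (x : 'rV[R]_n) : \bar R :=
  \esum_(Q in [set Q | cell Q x]) lam Q.

Definition dominates A f (lam : dyadic n -> \bar R) :=
  (forall Q, 0 <= lam Q) /\ null [set x | A x /\ ~ (f x <= stack lam x)].

Definition total (lam : dyadic n -> \bar R) : \bar R :=
  \esum_(Q in [set: dyadic n]) (ell Q)%:E * lam Q.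

(* Countably subadditive functional equivalent to the Choquet integral of [f]
   over [A]. *)
Definition dnorm A f : \bar R := ereal_inf [set total lam | lam in dominates A f].

Lemma total_ge0 lam : (forall Q, 0 <= lam Q) -> 0 <= total lam.
Proof. by move=> l0; apply: esum_ge0 => Q _; rewrite mule_ge0. Qed.

Lemma dcontent_cover phi A C : covers A C -> dcontent phi A <= \esum_(Q in C) phi Q.
Proof. by move=> AcC; apply: ereal_inf_lbound; exists C. Qed.

Lemma dcontent_ge0 phi A : (forall Q, 0 <= phi Q) -> 0 <= dcontent phi A.
Proof. by move=> p0; apply/ereal_infP => _ [C _ <-]; exact: esum_ge0. Qed.

Lemma dcontent_sub (J : countType) (D : set J) (B : J -> set 'rV[R]_n) phi A :
  (forall Q, 0 <= phi Q) -> null (A `\` \bigcup_(j in D) B j) ->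
  dcontent phi A <= \esum_(j in D) dcontent phi (B j).
Proof.
move=> p0 AB; apply: ereal_inf_esum_le.
  by move=> j y [C _ <-]; exact: esum_ge0.
move=> y Hy.
have /choice[C HC] : forall j, exists C, D j -> covers (B j) C /\
    y j = \esum_(Q in C) phi Q.
  move=> j; have [Dj|nDj] := pselect (D j); last by exists set0.
  by have [C BC <-] := Hy j Dj; exists C.
apply: le_trans (@dcontent_cover phi A (\bigcup_(j in D) C j) _) _.
  apply: null_sub (nullU AB (null_bigcup (fun j Dj => (HC j Dj).1))).
  move=> x [Ax nx]; have [[j Dj Bjx]|nB] := pselect ((\bigcup_(j in D) B j) x); last by left.
  right; exists j => //; split=> // -[Q CQ Qx]; apply: nx; exists Q => //.
  by exists j.
apply: le_trans (esum_bigcup_le _ _ p0) _.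
by apply: le_esum => j Dj; rewrite (HC j Dj).2.
Qed.

Lemma dcontent_le phi A B : (forall Q, 0 <= phi Q) ->
  null (A `\` B) -> dcontent phi A <= dcontent phi B.
Proof.
move=> p0 AB; rewrite -(@esum_set1 _ _ tt (fun=> dcontent phi B)) ?dcontent_ge0//.
apply: dcontent_sub => //; apply: null_sub AB => x [Ax nx]; split=> // Bx.
by apply: nx; exists tt.
Qed.

Lemma dcontent_subset phi A B : (forall Q, 0 <= phi Q) ->
  A `<=` B -> dcontent phi A <= dcontent phi B.
Proof.
move=> p0 AB; apply: dcontent_le => //; apply: null_sub (null0 delta) => x [Ax].
by apply; exact: AB.
Qed.

Lemma dcontent_null phi A : (forall Q, 0 <= phi Q) -> null A -> dcontent phi A = 0.
Proof.
move=> p0 A0; apply/eqP; rewrite eq_le dcontent_ge0// andbT.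
apply: le_trans (@dcontent_cover phi A set0 _) _; last by rewrite esum_set0.
by apply: null_sub A0 => x [].
Qed.

Lemma dcontent_cell phi Q : (forall Q, 0 <= phi Q) -> dcontent phi (cell Q) <= phi Q.
Proof.
move=> p0; rewrite -(esum_set1 (p0 Q)); apply: dcontent_cover.
apply: null_sub (null0 delta) => x [Qx]; apply; exists Q => //.
Qed.

Lemma hcontentU A B : hc (A `|` B) <= hc A + hc B.
Proof.
apply: le_trans (@hcontent_subadd _ _ delta bool setT (fun b => if b then A else B) _ _) _.
  by move=> x [Ax|Bx]; [exists true|exists false].
by rewrite esum_finType ?big_bool// => -[]; exact: hcontent_ge0.
Qed.

Lemma hcontent_le_dcontent A : hc A <= dcontent (fun Q => (ell Q)%:E) A.
Proof.
apply/ereal_infP => _ [C AcC <-].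
apply: le_trans (@hcontent_le _ _ delta _ (\bigcup_(Q in C) cell Q `|` (A `\` \bigcup_(Q in C) cell Q)) _) _.
  by move=> x Ax; have [Cx|nCx] := pselect ((\bigcup_(Q in C) cell Q) x); [left|right].
apply: le_trans (hcontentU _ _) _; rewrite [hc (_ `\` _)]AcC adde0.
apply: le_trans (@hcontent_subadd _ _ delta _ C cell _ _) _ => //.
by apply: le_esum => Q CQ; rewrite -dcubeE; exact: hcontent_cube.
Qed.

Lemma null_dcontent A : dcontent (fun Q => (ell Q)%:E) A = 0 -> null A.
Proof. by move=> A0; apply: null_le0; rewrite -A0 hcontent_le_dcontent. Qed.

Let star_cst : R := (3 ^ n)%:R.

Lemma star_sum (phi' : dyadic n -> \bar R) (c : R) P :
  (0 <= c)%R -> (forall e, phi' (nbr P e) <= c%:E) ->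
  \esum_(e in [set: {ffun 'I_n -> 'I_3}]) phi' (nbr P e) <= (star_cst * c)%:E.
Proof.
move=> c0 le; apply: le_trans (@le_esum _ _ _ _ (fun=> c%:E) _) _ => [e _//|].
by rewrite esum_finType_cst// card_ffun !card_ord.
Qed.

Lemma dcontent_star P : dcontent (fun Q => (ell Q)%:E) (star P) <= (star_cst * ell P)%:E.
Proof.
apply: le_trans (@dcontent_sub _ setT (fun e => cell (nbr P e)) _ _ _ _) _ => //.
  apply: null_sub (null0 delta) => x [/star_nbr[e ex]]; apply.
  by exists e.
apply: (star_sum (phi' := fun Q => dcontent _ (cell Q))); first exact: ell_ge0.
by move=> e; exact: dcontent_cell.
Qed.

(** Each covering cube sits in the star of a cell of side at most twice its edge, and a star
    consists of [3^n] cells. *)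
Lemma dcontent_le_hcontent A :
  dcontent (fun Q => (ell Q)%:E) A <= (star_cst * 2 `^ delta)%:E * hc A.
Proof.
have K0 : (0 <= star_cst * 2 `^ delta)%R by rewrite mulr_ge0 ?powR_ge0// ler0n.
have K1 : (0 < star_cst * 2 `^ delta)%R by rewrite mulr_gt0 ?powR_gt0// ltr0n expn_gt0.
rewrite -lee_pdivrMl//; apply/ereal_infP => _ [D [Q [AQ ->]]].
rewrite lee_pdivrMl//.
rewrite -esumZl//; last by move=> j; rewrite lee_fin powR_ge0.
apply: le_trans (@dcontent_sub _ D (fun j => cube_set (Q j)) _ _ _ _) _ => //.
  by apply: null_sub (null0 delta) => x [/AQ Ax].
apply: le_esum => j _; have [k /andP[h1 h2]] := mesh_itv (edge_gt0 (Q j)).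
pose x := (corner (Q j) + const_mx (edge (Q j)))%R.
have Qx : cube_set (Q j) x by move=> i; rewrite !mxE ltrDl lexx edge_gt0.
apply: le_trans (@dcontent_subset _ _ (star (at_level (k + 1) x)) _ _) _ => //.
  exact: cube_sub_star.
apply: le_trans (dcontent_star _) _.
rewrite -EFinM lee_fin -mulrA ler_wpM2l// ?ler0n//.
rewrite -powRM ?(ltW (edge_gt0 _))//.
apply: ge0_ler_powR; rewrite ?nnegrE ?(ltW delta_gt0)//.
- exact/ltW/mesh_gt0.
- by rewrite mulr_ge0// ltW// edge_gt0.
- by rewrite meshS ler_pM2l// ltW.
Qed.

Lemma dnorm_ge0 A f : 0 <= dnorm A f.
Proof. by apply/ereal_infP => _ [lam [l0 _] <-]; exact: total_ge0. Qed.

(** Near-optimal stacks for the [g j] add up to a stack dominating [f], and [total] is additive by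
    Tonelli. Letting only the [j] with [x] in [B j] contribute treats sums of functions and unions
    of sets in one statement. *)
Lemma dnorm_sub (J : countType) (D : set J) (B : J -> set 'rV[R]_n)
    (g : J -> 'rV[R]_n -> \bar R) A f :
  null [set x | A x /\ ~ (f x <= \esum_(j in [set j | D j /\ B j x]) g j x)] ->
  dnorm A f <= \esum_(j in D) dnorm (B j) (g j).
Proof.
move=> Afg; apply: ereal_inf_esum_le.
  by move=> j y [lam [l0 _] <-]; exact: total_ge0.
move=> y Hy.
have /choice[lam Hlam] : forall j, exists lam, (forall Q, 0 <= lam Q) /\
    (D j -> dominates (B j) (g j) lam /\ y j = total lam).
  move=> j; have [Dj|nDj] := pselect (D j); last by exists (fun=> 0).
  by have [lam Blam <-] := Hy j Dj; exists lam; split=> //; exact: Blam.1.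
have l0 j Q : 0 <= lam j Q := (Hlam j).1 Q.
pose mu Q := \esum_(j in D) lam j Q.
have mu0 Q : 0 <= mu Q by exact: esum_ge0.
rewrite (_ : \esum_(j in D) y j = total mu).
  apply: ereal_inf_lbound; exists mu => //; split=> //.
  apply: null_sub (nullU Afg (null_bigcup (P := D)
    (fun j Dj => ((Hlam j).2 Dj).1.2))) => x [Ax nf].
  have [fg|] := pselect (f x <= \esum_(j in [set j | D j /\ B j x]) g j x); last by left.
  right; apply: contrapT => H; apply: nf.
  apply: (le_trans fg).
  apply: (@le_trans _ _ (\esum_(j in [set j | D j /\ B j x]) stack (lam j) x)).
    apply: le_esum => j [Dj Bj]; apply: contrapT => nle.
    by apply: H; exists j.
  rewrite /stack; apply: (@le_trans _ _ (\esum_(j in D) \esum_(Q in [set Q | cell Q x]) lam j Q)).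
    by apply: le_esum_subset => [j []//|j _]; exact: esum_ge0.
  by rewrite (@esum_exchange _ _ _ _ _ [set Q | cell Q x] (fun=> D))// => j Q; split=> -[].
rewrite /total /mu.
under [RHS]eq_esum do rewrite -esumZl ?ell_ge0//.
rewrite [RHS](@esum_exchange _ _ _ _ _ D (fun=> setT)) => //.
- by apply: eq_esum => j Dj; exact: ((Hlam j).2 Dj).2.
- by move=> Q j; split=> -[].
- by move=> Q j _ _; rewrite mule_ge0.
Qed.

Lemma dnorm_le A B f g :
  null [set x | A x /\ ~ (B x /\ f x <= g x)] -> (forall x, 0 <= g x) ->
  dnorm A f <= dnorm B g.
Proof.
move=> AB g0; rewrite -(@esum_set1 _ _ tt (fun=> dnorm B g)) ?dnorm_ge0//.
apply: dnorm_sub; apply: null_sub AB => x [Ax nf]; split=> // -[Bx fg]; apply: nf.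
apply: (le_trans fg).
by apply: (@esum_lb _ _ _ (fun=> g x) tt).
Qed.

Lemma dnorm_mono A B f g : A `<=` B -> (forall x, A x -> f x <= g x) ->
  (forall x, 0 <= g x) -> dnorm A f <= dnorm B g.
Proof.
move=> AB fg g0; apply: dnorm_le => //; apply: null_sub (null0 delta) => x [Ax]; apply.
by split; [exact: AB|exact: fg].
Qed.

Lemma dnormZ_le A f (c : R) : (0 < c)%R ->
  dnorm A (fun x => c%:E * f x) <= c%:E * dnorm A f.
Proof.
move=> c0; rewrite -lee_pdivrMl//; apply/ereal_infP => _ [lam [l0 Alam] <-].
rewrite lee_pdivrMl//; apply: ereal_inf_lbound; exists (fun Q => c%:E * lam Q).
  split=> [Q|]; first by rewrite mule_ge0// lee_fin ltW.
  apply: null_sub Alam => x [Ax nf]; split=> // fx; apply: nf.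
  rewrite /stack (esumZl _ (ltW c0) l0).
  by apply: lee_wpmul2l fx; rewrite lee_fin ltW.
rewrite /total -(esumZl _ (ltW c0)); last by move=> Q; rewrite mule_ge0.
by apply: eq_esum => Q _; rewrite muleCA.
Qed.

Lemma dnormZ A f (c : R) : (0 < c)%R ->
  dnorm A (fun x => c%:E * f x) = c%:E * dnorm A f.
Proof.
move=> c0; apply/eqP; rewrite eq_le dnormZ_le//=.
have ci0 : (0 < c^-1)%R by rewrite invr_gt0.
have := @dnormZ_le A (fun x => c%:E * f x) _ ci0.
under [X in dnorm A X]eq_fun do rewrite muleA -EFinM mulVf ?gt_eqF// mul1e.
move=> h; have := @lee_wpmul2l _ c%:E (ltW c0) _ _ h.
by rewrite muleA -EFinM mulfV ?gt_eqF// mul1e.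
Qed.

Lemma dnorm_bigcup (J : countType) (D : set J) (B : J -> set 'rV[R]_n) A f :
  null (A `\` \bigcup_(j in D) B j) -> (forall x, 0 <= f x) ->
  dnorm A f <= \esum_(j in D) dnorm (B j) f.
Proof.
move=> AB f0; apply: dnorm_sub; apply: null_sub AB => x [Ax nf]; split=> // -[j Dj Bj].
by apply: nf; exact: (@esum_lb _ _ _ (fun=> f x) j).
Qed.

(** For a weight [f], the right-hand side is the content generated by the weights of cells; this is
    how norms pass to [Hw] later. *)
Lemma dnorm_le_dcontent A f : (forall x, 0 <= f x) ->
  dnorm A f <= dcontent (fun Q => dnorm (cell Q) f) A.
Proof. by move=> f0; apply/ereal_infP => _ [C AcC <-]; exact: dnorm_bigcup. Qed.

Lemma dnorm_cell_cst Q c : 0 <= c -> dnorm (cell Q) (fun=> c) <= (ell Q)%:E * c.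
Proof.
move=> c0; pose lam S : \bar R := if S == Q then c else 0.
have l0 S : 0 <= lam S by rewrite /lam; case: ifP.
apply: (@le_trans _ _ (total lam)).
  apply: ereal_inf_lbound; exists lam => //; split=> //.
  apply: null_sub (null0 delta) => x [Qx]; apply.
  have <- : lam Q = c by rewrite /lam eqxx.
  exact: (@esum_lb _ _ _ lam Q).
rewrite /total (@esumID _ _ [set Q])// ?setTI; last by move=> S _; rewrite mule_ge0.
rewrite esum_set1 ?mule_ge0// esum1 ?adde0; first by rewrite /lam eqxx.
by move=> S SQ; rewrite /lam; case: eqP => [/SQ//|_]; rewrite mule0.
Qed.

Lemma dnorm_cell1 Q : dnorm (cell Q) (fun=> 1) <= (ell Q)%:E.
Proof. by rewrite -[leRHS]mule1; exact: dnorm_cell_cst. Qed.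

Lemma dcontentU phi A B : (forall Q, 0 <= phi Q) ->
  dcontent phi (A `|` B) <= dcontent phi A + dcontent phi B.
Proof.
move=> p0; apply: le_trans (@dcontent_sub bool setT (fun b => if b then A else B) _ _ p0 _) _.
  by apply: null_sub (null0 delta) => x [[Ax|Bx]]; apply; [exists true|exists false].
by rewrite esum_finType ?big_bool// => -[]; exact: dcontent_ge0.
Qed.

Lemma dnorm1_le_dcontent A : dnorm A (fun=> 1) <= dcontent (fun Q => (ell Q)%:E) A.
Proof.
apply: le_trans (dnorm_le_dcontent _ _) _ => [x|]; first exact: lee01.
apply/ereal_infP => _ [C AcC <-]; apply: le_trans (dcontent_cover _ AcC) _.
by apply: le_esum => Q _; exact: dnorm_cell1.
Qed.

End contents_and_norms.

(** * Measurability of monotone functions and integrals of superposed intervals *)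

Section layer_cake.
Context {R : realType}.
Local Notation leb := (@lebesgue_measure R).

Lemma nonincreasing_emeasurable (D : set R) (g : R -> \bar R) :
  measurable D -> (forall s t, (s <= t)%R -> g t <= g s) -> measurable_fun D g.
Proof.
move=> mD ng; apply: (measurability _ (ErealGenOInfty.measurableE R)) => _ /= -[_ [x ->] <-].
apply: measurableI => //.
apply: is_interval_measurable => s t /= hs ht u /andP[su ut].
move: hs ht; rewrite !in_itv/= !andbT => hs ht.
exact: lt_le_trans ht (ng _ _ ut).
Qed.

Lemma esum_pickle (T : countType) (a : T -> \bar R) : (forall j, 0 <= a j) ->
  \esum_(j in [set: T]) a j =
  \sum_(i <oo) (if @pickle_inv T i is Some j then a j else 0).
Proof.
move=> a0; rewrite nneseries_esumT; last by move=> i; case: pickle_inv.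
have -> : [set: nat] = (@pickle T @` setT) `|` ~` (@pickle T @` setT) by rewrite setUv.
rewrite (@esumID _ _ (@pickle T @` setT)); last by move=> i _; case: pickle_inv.
rewrite setUv !setTI [X in _ + X]esum1 ?adde0; last first.
  move=> i ni; case e : (pickle_inv i) => [j|//]; exfalso; apply: ni; exists j => //.
  by have := @pickle_invK T i; rewrite e /=.
rewrite esum_image; last by move=> i j _ _; exact: (pcan_inj pickleK).
by apply: eq_esum => j _; rewrite pickleK_inv.
Qed.

(** A countable superposition of indicators of [[lo j, hi j[] is integrated term by term. Its
    measurability is recorded because comparing integrals requires it. *)
Lemma integral_layers (T : countType) (b : T -> \bar R) (lo hi : T -> R) :
  (forall j, 0 <= b j) -> (forall j, 0 <= lo j)%R -> (forall j, lo j <= hi j)%R ->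
  let u (t : R) : \bar R := \esum_(j in [set j | (lo j <= t < hi j)%R]) b j in
  measurable_fun (`[0%R, +oo[%classic : set R) u /\
  \int[leb]_(t in `[0%R, +oo[) u t = \esum_(j in [set: T]) b j * (hi j - lo j)%:E.
Proof.
move=> b0 lo0 lohi u.
pose E j : set R := `[lo j, hi j[%classic.
pose F i : R -> \bar R := if @pickle_inv T i is Some j then (cst (b j)) \_ (E j) else cst 0.
have F0 i t : 0 <= F i t.
  rewrite /F; case: pickle_inv => // j; rewrite patchE; case: ifP => // _; exact: b0.
have uE : u = fun t => \sum_(i <oo) F i t.
  apply/funext => t; rewrite /u esum_mkcond esum_pickle; last by move=> j; case: ifP.
  apply: eq_eseriesr => i _; rewrite /F; case: pickle_inv => //.
have mF i : measurable_fun (`[0%R, +oo[%classic : set R) (F i).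
  rewrite /F; case: pickle_inv => [j|]; last exact: measurable_cst.
  by apply/measurable_restrict => //; exact: measurable_itv.
split.
  by rewrite uE; apply: ge0_emeasurable_sum.
rewrite uE integral_nneseries// esum_pickle; last first.
  by move=> j; rewrite mule_ge0// lee_fin subr_ge0.
apply: eq_eseriesr => i _; rewrite /F; case: pickle_inv => [j|]; last exact: integral0.
rewrite -integral_mkcondr (_ : _ `&` _ = E j); last first.
  apply/seteqP; split=> [t []//|t]; rewrite /E /= !in_itv/= andbT => /andP[h1 h2].
  by rewrite h1 h2 (le_trans (lo0 j) h1).
rewrite integral_cst//; last exact: measurable_itv.
rewrite [X in _ * X](_ : _ = leb `[lo j, hi j[%classic)// lebesgue_measure_itv/= lte_fin.
have := lohi j; rewrite le_eqVlt => /orP[/eqP ->|-> //].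
by rewrite ltxx subrr.
Qed.

End layer_cake.

(** * Comparison of the Choquet integral with dyadic stacks and dyadic levels *)

Section choquet_dnorm.
Context {R : realType} {n : nat} (delta : R).
Hypotheses (delta_gt0 : (0 < delta)%R) (delta_le : (delta <= n%:R)%R).
Implicit Types (P Q S : dyadic n) (A B : set 'rV[R]_n) (f g : 'rV[R]_n -> \bar R).
Local Notation hc := (@hcontent R n delta).
Local Notation null := (@null R n delta).
Local Notation ell := (@ell R n delta).
Local Notation cell := (@cell R n).
Local Notation sub := (@sub R n).
Local Notation total := (@total R n delta).

Let ell0 Q : (0 <= (ell Q)%:E :> \bar R). Proof. by rewrite lee_fin ell_ge0. Qed.

Let strict_ancestors (lam : dyadic n -> \bar R) Q :=
  \esum_(P in [set P | sub Q P /\ Q <> P]) lam P.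

(* The stack over ancestors of [x] tends to [0] at large scales, so there is a
   first cube at which it exceeds [t]. *)
Let stack_crossing lam (t : R) x : (forall Q, 0 <= lam Q) -> total lam < +oo ->
  (0 < t)%R -> t%:E < stack lam x ->
  exists2 Q, cell Q x & strict_ancestors lam Q <= t%:E /\
    t%:E < strict_ancestors lam Q + lam Q.
Proof.
move=> l0 Lfin t0 tx.
pose S k := \esum_(Q in [set Q | cell Q x /\ (k <= Q.1)%R]) lam Q.
have Sle k k' : (k <= k')%R -> S k' <= S k.
  move=> kk; apply: le_esum_subset => [Q [Qx le]|//]; split=> //.
  exact: le_trans le.
have [k0 tk0] : exists k, t%:E < S k.
  have [_ [X [finX Xx] <-] tX] := ereal_sup_gt tx.
  have [k Hk] := finite_level_lb finX.
  exists k; apply: (lt_le_trans tX); apply: ereal_sup_ubound; exists X => //.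
  by split=> // Q XQ; split; [exact: Xx|exact: Hk].
have [k1 tk1] : exists k, S k <= t%:E.
  pose L := fine (total lam).
  have LE : total lam = L%:E by rewrite fineK// ge0_fin_numE ?total_ge0.
  have L0 : (0 <= L)%R by rewrite fine_ge0// total_ge0.
  (* The level is chosen so that [ell] is at least [L / t] there; cubes from that level on which
     contain [x] carry at most [L / ell <= t]. *)
  have e0 : (0 < (L / t) `^ delta^-1 + 1)%R by rewrite ltr_wpDl ?powR_ge0.
  have [k /andP[_ hk]] := mesh_itv e0; exists (k + 1)%R.
  pose Q0 : dyadic n := (k + 1, [ffun=> 0])%R.
  have : (ell Q0)%:E * S (k + 1)%R <= L%:E.
    rewrite -LE -esumZl ?ell_ge0// /total.
    apply: (@le_trans _ _ (\esum_(Q in [set Q | cell Q x /\ (k + 1 <= Q.1)%R])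
        (ell Q)%:E * lam Q)).
      by apply: le_esum => Q [_ le]; rewrite lee_wpmul2r// lee_fin le_ell.
    by apply: le_esum_subset => // Q _; rewrite mule_ge0.
  have lt0 : (L / t <= ell Q0)%R.
    have -> : (L / t = ((L / t) `^ delta^-1) `^ delta)%R.
      by rewrite -powRrM mulVf ?gt_eqF// powRr1// divr_ge0// ltW.
    apply: ge0_ler_powR; rewrite ?nnegrE ?powR_ge0 ?(ltW delta_gt0)//.
      exact/ltW/mesh_gt0.
    by apply: le_trans hk; rewrite lerDl.
  rewrite -lee_pdivlMl ?ell_gt0// => /le_trans; apply.
  by rewrite -EFinM lee_fin ler_pdivrMl ?ell_gt0// -ler_pdivrMr.
have [j [tj tj1]] : exists j : nat, t%:E < S (k0 + j%:Z)%R /\ S (k0 + j.+1%:Z)%R <= t%:E.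
  have ex : exists j : nat, `[< S (k0 + j%:Z)%R <= t%:E >].
    exists `|k1 - k0|%N; apply/asboolP; apply: le_trans tk1; apply: Sle; lia.
  case: (ex_minnP ex) => -[|j] /asboolP hj minj.
    by move: hj; rewrite addr0 leNgt tk0.
  exists j; split=> //; rewrite ltNge; apply/negP => /asboolP/minj.
  by rewrite ltnn.
pose Q : dyadic n := at_level (k0 + j%:Z)%R x.
have Qx : cell Q x := at_levelP _ _.
have SE : S (k0 + j.+1%:Z)%R = strict_ancestors lam Q.
  rewrite /S /strict_ancestors; congr esum; apply/seteqP; split=> P /=.
    move=> [Px le]; split; first by apply: (subI _ Qx Px); rewrite /=; lia.
    by move=> QP; move: le; rewrite -QP /=; lia.
  move=> [QP nQP]; split; first exact: (sub_cell QP).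
  by have := (sub_strict QP nQP).1; rewrite /=; lia.
exists Q => //; rewrite -SE; split=> //; apply: (lt_le_trans tj).
rewrite SE /S (@esumID _ _ [set Q])// addeC.
apply: leeD.
  apply: le_esum_subset => // P [[Px le] nQ]; split.
    by apply: (subI _ Qx Px); rewrite /=; lia.
  by move=> QP; apply: nQ.
apply: le_trans (le_esum_subset (B := [set Q]) _ _) _ => [P []//|//|].
by rewrite esum_set1.
Qed.

Let measurable_level A f (D : set R) : measurable D ->
  measurable_fun D (fun t : R => hc [set x | A x /\ t%:E < f x]).
Proof.
move=> mD; apply: nonincreasing_emeasurable => // s t st; apply: hcontent_le.
by move=> x /= [Ax tx]; split=> //; apply: le_lt_trans tx; rewrite lee_fin.
Qed.

(** Pile up the cubes: [Q] occupies the heights from [lo Q], the sum of [lam] over its strict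
    ancestors, to [hi Q = lo Q + lam Q]. The cubes whose interval contains [t] cover [{f > t}]
    almost everywhere on [A], and integrating in [t] gives exactly [total lam], so no constant is
    lost. *)
Lemma choquet_le_dnorm A f : choquet delta A f <= dnorm delta A f.
Proof.
apply/ereal_infP => _ [lam [l0 Alam] <-].
have [Lfin|] := ltP (total lam) +oo; last by rewrite leye_eq => /eqP ->; rewrite leey.
have le_tot (X : set (dyadic n)) Q : (forall P, X P -> (Q.1 <= P.1)%R) ->
    \esum_(P in X) lam P < +oo.
  move=> XQ; apply: (@le_lt_trans _ _ ((ell Q)^-1%:E * total lam)).
    rewrite lee_pdivlMl ?ell_gt0// -esumZl ?ell_ge0//.
    apply: (@le_trans _ _ (\esum_(P in X) (ell P)%:E * lam P)).
      by apply: le_esum => P XP; rewrite lee_wpmul2r// lee_fin le_ell// XQ.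
    by apply: le_esum_subset => // P _; rewrite mule_ge0.
  rewrite lte_mul_pinfty// ?lee_fin ?invr_ge0 ?ell_ge0//.
have cfin Q : strict_ancestors lam Q < +oo by apply: (le_tot _ Q) => P [[]].
have lfin Q : lam Q < +oo.
  by rewrite -(esum_set1 (l0 Q)); apply: (le_tot _ Q) => P ->.
have c0 Q : 0 <= strict_ancestors lam Q by exact: esum_ge0.
pose lo Q := fine (strict_ancestors lam Q).
pose hi Q := (lo Q + fine (lam Q))%R.
have loE Q : strict_ancestors lam Q = (lo Q)%:E by rewrite fineK// ge0_fin_numE.
have lamE Q : lam Q = (fine (lam Q))%:E by rewrite fineK// ge0_fin_numE.
have lo0 Q : (0 <= lo Q)%R by rewrite fine_ge0.
have lohi Q : (lo Q <= hi Q)%R by rewrite lerDl fine_ge0.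
have [mu intu] := integral_layers (fun Q => ell0 Q) lo0 lohi.
pose u (t : R) : \bar R := \esum_(j in [set j | (lo j <= t < hi j)%R]) (ell j)%:E.
rewrite -/u in mu intu.
rewrite /choquet -integral_itv_obnd_cbnd; last exact: measurable_level.
apply: (@le_trans _ _ (\int[@lebesgue_measure R]_(t in `]0%R, +oo[) u t)).
  apply: ge0_le_integral => //.
  - by move=> t _; exact: hcontent_ge0.
  - exact: measurable_level.
  - apply: measurable_funS mu => // t; rewrite /= !in_itv/= !andbT; exact: ltW.
  move=> t; rewrite /= in_itv/= andbT => t0; rewrite /u.
  apply: (@le_trans _ _ (dcontent delta (fun Q => (ell Q)%:E) [set x | A x /\ t%:E < f x])).
    exact: hcontent_le_dcontent.
  apply: dcontent_cover; apply: null_sub Alam => x [[Ax tf] nx]; split=> // fx; apply: nx.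
  have [Q Qx [h1 h2]] := stack_crossing l0 Lfin t0 (lt_le_trans tf fx).
  exists Q => //=; move: h1 h2; rewrite loE lamE -EFinD lee_fin lte_fin => -> ->.
  by [].
apply: (@le_trans _ _ (\int[@lebesgue_measure R]_(t in `[0%R, +oo[) u t)).
  apply: ge0_subset_integral => //.
  - by move=> t _; exact: esum_ge0.
  - by move=> t; rewrite /= !in_itv/= !andbT; exact: ltW.
rewrite intu /total; apply: le_esum => Q _.
by rewrite /hi addrC addKr -lamE.
Qed.

(** [mesh (k - 1)] is the length of [[2^(k-1), 2^k[], on which the content of the level set is at
    least its value at [2^k]. *)
Lemma dyadic_levels_le_choquet A f :
  \esum_(k in [set: int]) (mesh (k - 1))%:E * hc [set x | A x /\ (mesh k)%:E < f x]
    <= choquet delta A f.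
Proof.
pose b k := hc [set x | A x /\ (mesh k : R)%:E < f x].
have b0 k : 0 <= b k by exact: hcontent_ge0.
have lo0 k : (0 <= @mesh R (k - 1))%R by exact/ltW/mesh_gt0.
have lohi k : (@mesh R (k - 1) <= mesh k)%R by apply: le_mesh; rewrite gerBl.
have [mu intu] := integral_layers b0 lo0 lohi.
apply: (@le_trans _ _ (\esum_(k in [set: int]) b k * (mesh k - mesh (k - 1))%:E)).
  apply: le_esum => k _; rewrite -/(b k) [X in X <= _]muleC; apply: (@lee_wpmul2l _ (b k) (b0 k)).
  rewrite lee_fin [in leRHS](mesh_pred k); lra.
rewrite -intu; apply: ge0_le_integral => //.
- by move=> t _; exact: esum_ge0.
- exact: measurable_level.
move=> t; rewrite /= in_itv/= andbT => t0.
apply: (@le_trans _ _ (\esum_(k in [set k : int | (@mesh R (k - 1) <= t < mesh k)%R])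
    hc [set x | A x /\ t%:E < f x])).
  apply: le_esum => k /andP[_ h]; apply: hcontent_le => x [Ax kx]; split=> //.
  by apply: lt_trans kx; rewrite lte_fin.
apply: esum_le_single; first exact: hcontent_ge0.
have key (k k' : int) : (mesh (k - 1) <= t)%R -> (t < @mesh R k')%R -> (k <= k')%R.
  move=> h1 h2; have := le_lt_trans h1 h2; rewrite /mesh ltr_eXz2l ?ltr1n//; lia.
move=> k k' /andP[h1 h2] /andP[h3 h4]; apply/eqP.
by rewrite eq_le (key _ _ h1 h4) (key _ _ h3 h2).
Qed.

End choquet_dnorm.

(** * Dyadic level sums, Chebyshev's inequality and almost everywhere statements *)

Section norm_equivalences.
Context {R : realType} {n : nat} (delta : R).
Hypotheses (delta_gt0 : (0 < delta)%R) (delta_le : (delta <= n%:R)%R).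
Implicit Types (P Q S : dyadic n) (A B : set 'rV[R]_n) (f g v : 'rV[R]_n -> \bar R).
Local Notation hc := (@hcontent R n delta).
Local Notation null := (@null R n delta).
Local Notation ell := (@ell R n delta).
Local Notation cell := (@cell R n).
Local Notation mesh := (@mesh R).
Local Notation dnorm := (@dnorm R n delta).
Local Notation H := (dcontent delta (fun Q => (ell Q)%:E)).

Let ell0 Q : (0 <= (ell Q)%:E :> \bar R). Proof. by rewrite lee_fin ell_ge0. Qed.

(** For finite positive [y] the single level with [2^k < y <= 2^(k+1)] suffices; for [y = +oo] all
    levels occur and the sum is infinite unless [c = 0]. *)
Lemma le_levels (y c : \bar R) : 0 <= y -> 0 <= c ->
  y * c <= \esum_(k in [set k : int | (mesh k)%:E < y]) (2 * mesh k)%:E * c.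
Proof.
have m0 k : (0 < mesh k)%R := mesh_gt0 k.
have t0 k : 0 <= c -> 0 <= (2 * mesh k)%:E * c.
  by move=> c0; rewrite mule_ge0// lee_fin mulr_ge0// ltW.
case: y => [r| |] y0 c0; last by [].
  move: y0; rewrite lee_fin le_eqVlt => /orP[/eqP <-|r0].
    by rewrite mul0e; apply: esum_ge0 => k _; exact: t0.
  have [k /andP[h1 h2]] := mesh_itv r0.
  apply: (@le_trans _ _ ((2 * mesh k)%:E * c)).
    by apply: lee_wpmul2r => //; rewrite lee_fin -meshS.
  apply: (@esum_lb _ _ _ (fun k => (2 * mesh k)%:E * c)) => [|j _]; last exact: t0.
  by rewrite /= lte_fin.
have lb k : (2 * mesh k)%:E * c <=
    \esum_(k in [set k : int | (mesh k)%:E < +oo]) (2 * mesh k)%:E * c.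
  apply: (@esum_lb _ _ _ (fun k => (2 * mesh k)%:E * c)) => [|j _]; last exact: t0.
  by rewrite /= ltry.
move: c0 lb; case: c t0 => [c| |] // t0.
  rewrite lee_fin le_eqVlt => /orP[/eqP <-|c0] lb.
    by rewrite mule0; apply: esum_ge0 => k _; rewrite mule0.
  rewrite gt0_mulye ?lte_fin//.
  rewrite leye_eq; apply/eqP/eq_infty => t.
  have [t1|t1] := leP t 0%R.
    apply: (@le_trans _ _ 0); first by rewrite lee_fin.
    by apply: esum_ge0 => k _; apply: t0; rewrite lee_fin ltW.
  have [k /andP[_ h2]] := mesh_itv (divr_gt0 t1 c0).
  apply: le_trans (lb k); rewrite -EFinM lee_fin -meshS -ler_pdivrMr//.
move=> _ lb; apply: le_trans (lb 0%R).
by rewrite [leRHS]gt0_muley ?leey// lte_fin mulr_gt0.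
Qed.

Lemma dnorm_levels A f v : (forall x, 0 <= f x) -> (forall x, 0 <= v x) ->
  dnorm A (fun x => f x * v x) <=
  \esum_(k in [set: int]) (2 * mesh k)%:E * dnorm [set x | A x /\ (mesh k)%:E < f x] v.
Proof.
move=> f0 v0; have m0 k : (0 < 2 * mesh k)%R by rewrite mulr_gt0// mesh_gt0.
under eq_esum do rewrite -dnormZ//.
apply: dnorm_sub; apply: null_sub (null0 delta) => x [Ax]; apply.
apply: le_trans (le_levels (f0 x) (v0 x)) _; apply: le_esum_subset => //.
by move=> k _; rewrite mule_ge0// lee_fin ltW.
Qed.

(** The outer [2] compares [2^k] with the length [2^(k-1)] of a dyadic layer; the rest is the
    constant of [dcontent_le_hcontent]. *)
Definition level_cst : R := (2 * ((3 ^ n)%:R * 2 `^ delta))%R.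

Lemma level_cst_gt0 : (0 < level_cst)%R.
Proof. by rewrite mulr_gt0// mulr_gt0 ?powR_gt0// ltr0n expn_gt0. Qed.

Lemma levels_le_choquet A f :
  \esum_(k in [set: int]) (mesh k)%:E * H [set x | A x /\ (mesh k)%:E < f x]
    <= level_cst%:E * choquet delta A f.
Proof.
have C0 := level_cst_gt0.
have h := @lee_wpmul2l _ level_cst%:E (ltW C0) _ _ (dyadic_levels_le_choquet delta_gt0 delta_le A f).
apply: le_trans h.
rewrite -esumZl ?(ltW C0)//; last first.
  by move=> k; rewrite mule_ge0 ?hcontent_ge0// lee_fin ltW// mesh_gt0.
apply: le_esum => k _; have m0 := mesh_gt0 (R := R) k.
apply: le_trans (lee_wpmul2l _ (dcontent_le_hcontent delta_gt0 _)) _; first by rewrite lee_fin ltW.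
by rewrite !muleA -!EFinM (mesh_pred k) /level_cst (mulrC (2 * mesh _)%R) mulrCA mulrA.
Qed.

Lemma levels_le_dnorm A f :
  \esum_(k in [set: int]) (mesh k)%:E * H [set x | A x /\ (mesh k)%:E < f x]
    <= level_cst%:E * dnorm A f.
Proof.
apply: le_trans (levels_le_choquet A f) _; apply: lee_wpmul2l.
  by rewrite lee_fin ltW// level_cst_gt0.
exact: choquet_le_dnorm.
Qed.

Lemma dnorm_le_choquet A f : (forall x, 0 <= f x) ->
  dnorm A f <= (2 * level_cst)%:E * choquet delta A f.
Proof.
move=> f0; have := @dnorm_levels A f (fun=> 1) f0 (fun=> lee01).
under [X in dnorm A X]eq_fun do rewrite mule1.
move=> /le_trans; apply.
rewrite EFinM -muleA; have h := @lee_wpmul2l _ 2%:E (ltW (ltr0n _ 2)) _ _ (levels_le_choquet A f).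
apply: le_trans h.
have m0 k : 0 <= (mesh k)%:E by rewrite lee_fin ltW// mesh_gt0.
rewrite -esumZl//; last by move=> k; rewrite mule_ge0// dcontent_ge0.
apply: le_esum => k _; rewrite EFinM -muleA; apply: lee_wpmul2l; first by rewrite lee_fin.
apply: lee_wpmul2l => //; exact: dnorm1_le_dcontent.
Qed.

Lemma chebyshev A B f (s : R) : (0 < s)%R -> B `<=` A ->
  (forall x, 0 <= f x) -> (forall x, B x -> s%:E <= f x) ->
  s%:E * H B <= (2 * level_cst)%:E * dnorm A f.
Proof.
move=> s0 BA f0 Bf.
have le1 : H B <= (2 * level_cst)%:E * dnorm B (fun=> 1).
  have := levels_le_dnorm B (fun=> 1).
  (* Level [-1] because level sets are strict: [1] exceeds [2^-1] but not [2^0]. This is the factor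
     [2] of the constant. *)
  move/(le_trans (@esum_lb _ _ setT (fun k => (mesh k)%:E *
     H [set x | B x /\ (mesh k)%:E < 1]) (- 1)%R I _)).
  have -> : [set x | B x /\ (mesh (- 1) : R)%:E < 1] = B.
    apply/seteqP; split=> [x []//|x Bx]; split=> //.
    by rewrite lte_fin /mesh exprN1 invf_lt1// ltr1n.
  rewrite /mesh exprN1 lee_pdivrMl// muleA => h; rewrite EFinM; apply: h => k _.
  by rewrite mule_ge0 ?dcontent_ge0// lee_fin ltW// mesh_gt0.
apply: le_trans (lee_wpmul2l _ le1) _; first by rewrite lee_fin ltW.
rewrite muleCA; apply: lee_wpmul2l; first by rewrite lee_fin mulr_ge0// ltW// level_cst_gt0.
rewrite -dnormZ//; apply: dnorm_mono => // x Bx; rewrite mule1; exact: Bf.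
Qed.

Lemma dnorm_fin_ae A f : (forall x, 0 <= f x) -> dnorm A f < +oo ->
  null [set x | A x /\ f x = +oo].
Proof.
move=> f0 Ffin; apply: (null_dcontent (delta := delta)).
set B := [set x | _]; apply/eqP; rewrite eq_le dcontent_ge0// andbT.
have C0 : (0 < 2 * level_cst)%R by rewrite mulr_gt0// level_cst_gt0.
pose L := fine ((2 * level_cst)%:E * dnorm A f).
have L0 : 0 <= (2 * level_cst)%:E * dnorm A f.
  by rewrite mule_ge0 ?dnorm_ge0// lee_fin ltW.
have LE : (2 * level_cst)%:E * dnorm A f = L%:E.
  by rewrite fineK// ge0_fin_numE// lte_mul_pinfty// lee_fin ltW.
apply/lee_addgt0Pr => e e0; rewrite add0e.
have L0' : (0 <= L)%R by rewrite fine_ge0.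
have s0 : (0 < (L + 1) / e)%R by rewrite divr_gt0// ltr_wpDl.
have := @chebyshev A B f _ s0 _ f0 _.
rewrite LE => /(_ _ _)h.
have : H B <= ((L + 1) / e)^-1%:E * L%:E.
  rewrite lee_pdivlMl//; apply: h => [x []//|x [_ ->]]; exact: leey.
move=> /le_trans; apply; rewrite -EFinM lee_fin invf_div mulrAC ler_pdivrMr ?ltr_wpDl//.
by rewrite ler_pM2l// lerDl.
Qed.

Lemma dnorm_eq0_ae A f : (forall x, 0 <= f x) -> dnorm A f = 0 ->
  null [set x | A x /\ 0 < f x].
Proof.
move=> f0 F0; apply: (@null_sub _ _ _ _ (\bigcup_(k in [set: int])
    [set x | A x /\ (mesh k)%:E <= f x])).
  move=> x [Ax fx]; case e : (f x) => [r| |].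
  - rewrite e lte_fin in fx; have [k /andP[h _]] := mesh_itv fx.
    by exists k => //; split=> //; rewrite e lee_fin ltW.
  - by exists 0%R => //; split=> //; rewrite e leey.
  - by rewrite e in fx.
apply: null_bigcup => k _; apply: (null_dcontent (delta := delta)).
apply/eqP; rewrite eq_le dcontent_ge0// andbT.
have m0 := mesh_gt0 (R := R) k.
have : (mesh k)%:E * H [set x | A x /\ (mesh k)%:E <= f x] <= 0.
  have -> : 0 = (2 * level_cst)%:E * dnorm A f by rewrite F0 mule0.
  by apply: chebyshev => // x [].
by rewrite -lee_pdivlMl// mule0.
Qed.

End norm_equivalences.

(** * Packing a set by cubes in which it has content density at least one half *)

Section good_cubes.
Context {R : realType} {n : nat} (delta : R).
Hypotheses (delta_gt0 : (0 < delta)%R) (delta_le : (delta <= n%:R)%R).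
Implicit Types (P Q S C : dyadic n) (E : set 'rV[R]_n).
Local Notation null := (@null R n delta).
Local Notation ell := (@ell R n delta).
Local Notation cell := (@cell R n).
Local Notation sub := (@sub R n).
Local Notation up := (@up R n).
Local Notation H := (dcontent delta (fun Q => (ell Q)%:E)).

Let ell0 Q : (0 <= (ell Q)%:E :> \bar R). Proof. by rewrite lee_fin ell_ge0. Qed.
Let H0 A : 0 <= H A. Proof. exact: dcontent_ge0. Qed.

(* Below the saturation value [ell P] no near-optimal covering uses a cube larger
   than the children of [P], so the dyadic content is additive over them. *)
Lemma dcontent_children E P : H (E `&` cell P) < (ell P)%:E ->
  \esum_(C in [set C | up C = P]) H (E `&` cell C) <= H (E `&` cell P).
Proof.
move=> unsat.
have small K : covers delta (E `&` cell P) K -> \esum_(Q in K) (ell Q)%:E < (ell P)%:E ->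
    \esum_(C in [set C | up C = P]) H (E `&` cell C) <= \esum_(Q in K) (ell Q)%:E.
  move=> EK Ksmall.
  apply: (@le_trans _ _ (\esum_(C in [set C | up C = P])
      \esum_(Q in [set Q | K Q /\ sub Q C]) (ell Q)%:E)).
    apply: le_esum => C /= CP; apply: dcontent_cover.
    apply: null_sub EK => x [[Ex Cx] nx]; split.
      by split=> //; rewrite -CP; apply: (sub_cell (sub_up C)).
    move=> [Q KQ Qx]; apply: nx; exists Q => //; split=> //.
    have [CQ|//] := cell_sub_or Cx Qx.
    have [<-|CneQ] := pselect (C = Q); first exact: sub_refl.
    have PQ : sub P Q by rewrite -CP; exact: sub_strict.
    have : (ell P)%:E <= \esum_(Q in K) (ell Q)%:E.
      apply: (@le_trans _ _ (ell Q)%:E); first by rewrite lee_fin le_ell// PQ.1.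
      exact: (@esum_lb _ _ _ (fun Q => (ell Q)%:E)).
    by rewrite leNgt Ksmall.
  apply: esum_disjoint_le => [Q|C Q _ []//|C C' Q /= CP CP' [_ QC] [_ QC']].
    exact: ell0.
  rewrite (sub_ancE QC) (sub_ancE QC'); congr anc; apply: (@addIr _ 1%R).
  by have := congr1 fst CP; have := congr1 fst CP'; rewrite /= => -> ->.
have [_ [K0 EK0 <-] lt0] := ereal_inf_ltP unsat.
apply/ereal_infP => _ [K EK <-].
have [lt|ge] := ltP (\esum_(Q in K) (ell Q)%:E) (ell P)%:E; first exact: small.
exact: le_trans (small _ EK0 lt0) (ltW (lt_le_trans lt0 ge)).
Qed.

Section fixed_cube.
Variables (E : set 'rV[R]_n) (R0 : dyadic n).

Let good Q := sub Q R0 /\ (ell Q / 2)%:E <= H (E `&` cell Q).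
Let G Q := good Q /\ forall P, good P -> sub Q P -> P = Q.

Let good_in_maximal Q x : good Q -> cell Q x -> exists2 P, G P & cell P x.
Proof.
move=> gQ Qx; pose P j : dyadic n := at_level (Q.1 + j%:Z)%R x.
have ex : exists j, `[< good (P j) >].
  by exists 0%N; apply/asboolP; rewrite /P addr0 -(cell_at Qx).
have bd j : `[< good (P j) >] -> (j <= `|R0.1 - Q.1|)%N.
  by move=> /asboolP[[h _] _]; move: h; rewrite /P /=; lia.
case: (ex_maxnP ex bd) => j /asboolP gj maxj.
have Pjx : cell (P j) x := at_levelP _ _.
exists (P j) => //; split=> // S gS PS.
have Sx : cell S x := sub_cell PS Pjx.
have lev : (Q.1 + j%:Z <= S.1)%R := PS.1.
have SE : S = P `|S.1 - Q.1|%N.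
  rewrite [LHS](cell_at Sx) /P; congr at_level; lia.
have := maxj `|S.1 - Q.1|%N; rewrite -SE => /(_ (asboolT gS)) le.
by rewrite SE /P; congr at_level; lia.
Qed.

(** The substitute for a density theorem. No cube meets the rest [Z] in content above [ell Q / 2]: a
    cube inside [R0] through a point of [Z] is not good, and a larger one is compared with [R0].
    Summing over a covering gives [H Z <= H Z / 2] with [H Z] finite. *)
Let null_rest : null (E `&` cell R0 `\` \bigcup_(Q in G) cell Q).
Proof.
set Z := _ `\` _.
have Zbad x Q : Z x -> cell Q x -> sub Q R0 -> H (E `&` cell Q) < (ell Q / 2)%:E.
  move=> [_ nx] Qx QR; rewrite ltNge; apply/negP => ge.
  by have [P GP Px] := good_in_maximal (conj QR ge) Qx; apply: nx; exists P.
apply: (null_dcontent (delta := delta)).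
have half Q : H (Z `&` cell Q) <= (ell Q / 2)%:E.
  have [->|/set0P[x [Zx Qx]]] := eqVneq (Z `&` cell Q) set0.
    rewrite dcontent_null//; last exact: null0.
    by rewrite lee_fin divr_ge0// ell_ge0.
  have ZR : Z `<=` cell R0 by move=> y [[]].
  have ZE : Z `<=` E by move=> y [[]].
  have [QR|RQ] := cell_sub_or Qx (ZR _ Zx).
    apply: le_trans (ltW (Zbad _ _ Zx Qx QR)).
    by apply: dcontent_subset => // y [Zy Qy]; split=> //; exact: ZE.
  apply: (@le_trans _ _ (ell R0 / 2)%:E).
    apply: le_trans (ltW (Zbad _ _ Zx (ZR _ Zx) (sub_refl _))).
    by apply: dcontent_subset => // y [Zy _]; split; [exact: ZE|exact: ZR].
  by rewrite lee_fin ler_pM2r ?invr_gt0// le_ell// RQ.1.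
have HZ : H Z <= 2^-1%:E * H Z.
  rewrite lee_pdivlMl//; apply/ereal_infP => _ [K ZK <-].
  rewrite -lee_pdivlMl//; apply: le_trans (@dcontent_sub _ _ _ _ K (fun Q => Z `&` cell Q) _ _ _ _) _ => //.
    apply: null_sub ZK => x [Zx nx]; split=> // -[Q KQ Qx]; apply: nx.
    by exists Q.
  rewrite -esumZl//; apply: le_esum => Q _; apply: le_trans (half Q) _.
  by rewrite -EFinM lee_fin mulrC.
have Zfin : H Z \is a fin_num.
  rewrite ge0_fin_numE//; apply: (@le_lt_trans _ _ (ell R0)%:E); last exact: ltry.
  apply: (@le_trans _ _ (H (cell R0))); last exact: dcontent_cell.
  by apply: dcontent_subset => // y [[]].
move: HZ (H0 Z); rewrite -(fineK Zfin) -EFinM !lee_fin => h1 h2; congr (_%:E); lra.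
Qed.

(** Induction on the depth. If [P] is good, it is the only possible member of [G] below it;
    otherwise [P] is unsaturated and [dcontent_children] passes to its children without loss. The
    depth bound disappears later, since a sum is the supremum over its finite subfamilies. *)
Let packing_depth (m : nat) P : sub P R0 ->
  (forall Q, sub P Q -> P <> Q -> ~ good Q) ->
  \esum_(Q in [set Q | [/\ G Q, sub Q P & (P.1 <= Q.1 + m%:Z)%R]]) H (E `&` cell Q)
    <= H (E `&` cell P).
Proof.
elim: m P => [|m IH] P PR Pbad; have [gP|ngP] := pselect (good P).
- rewrite -[leRHS](@esum_set1 _ _ P (fun Q => H (E `&` cell Q)) (H0 _)); apply: le_esum_subset => // Q [[_ GQ] QP _].
  by rewrite /= (GQ P).
- rewrite esum1// => Q [GQ QP lev]; exfalso; apply: ngP.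
  suff <- : Q = P by exact: GQ.1.
  by apply: (sub_level QP); apply/eqP; rewrite eq_le QP.1; move: lev; rewrite addr0.
- rewrite -[leRHS](@esum_set1 _ _ P (fun Q => H (E `&` cell Q)) (H0 _)); apply: le_esum_subset => // Q [[_ GQ] QP _].
  by rewrite /= (GQ P).
have unsat : H (E `&` cell P) < (ell P)%:E.
  rewrite ltNge; apply/negP => ge; apply: ngP; split=> //; apply: le_trans ge.
  rewrite lee_fin ler_pdivrMr//; have := @ell_gt0 R n delta P; lra.
apply: le_trans (dcontent_children unsat).
apply: (@le_trans _ _ (\esum_(C in [set C | up C = P])
   \esum_(Q in [set Q | [/\ G Q, sub Q C & (C.1 <= Q.1 + m%:Z)%R]]) H (E `&` cell Q))).
  apply: le_trans (esum_bigcup_le _ _ _); last by [].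
  apply: le_esum_subset => // Q [GQ QP lev].
  have QneP : Q <> P by move=> e; apply: ngP; rewrite -e; exact: GQ.1.
  have QltP : (Q.1 + 1 <= P.1)%R := (sub_strict QP QneP).1.
  have le1 : (Q.1 <= P.1 - 1)%R by lia.
  pose C : dyadic n := @anc R n (P.1 - 1)%R Q.
  have QC : sub Q C := sub_anc le1.
  exists C.
    have CP : sub C P by apply: (sub_linear QC QP); rewrite /=; lia.
    rewrite /= (sub_ancE CP) /up; congr anc; by rewrite /= subrK.
  by split=> //=; lia.
apply: le_esum => C /= CP; apply: IH.
  by apply: sub_trans PR; rewrite -CP; exact: sub_up.
move=> Q CQ CneQ; have PQ : sub P Q by rewrite -CP; exact: sub_strict.
by have [<-//|PneQ] := pselect (P = Q); exact: Pbad.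
Qed.

Lemma good_cubes : exists G : set (dyadic n),
  [/\ forall Q, G Q -> sub Q R0 /\ (ell Q / 2)%:E <= H (E `&` cell Q),
    null (E `&` cell R0 `\` \bigcup_(Q in G) cell Q) &
    \esum_(Q in G) (ell Q)%:E <= 2%:E * H (E `&` cell R0)].
Proof.
exists G; split; [by move=> Q [] | exact: null_rest |].
apply: (@le_trans _ _ (\esum_(Q in G) 2%:E * H (E `&` cell Q))).
  apply: le_esum => Q [[_ gQ] _]; rewrite -lee_pdivrMl// -EFinM mulrC; exact: gQ.
rewrite esumZl//; apply: lee_wpmul2l => //.
apply: ge_ereal_sup => /= _ [X [finX XG] <-].
have [k Hk] := finite_level_lb finX.
have nogood Q : sub R0 Q -> R0 <> Q -> ~ good Q.
  move=> RQ RneQ [QR _]; apply: RneQ; apply: (sub_level RQ).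
  by apply/eqP; rewrite eq_le RQ.1 QR.1.
apply: le_trans (packing_depth `|R0.1 - k|%N (sub_refl _) nogood).
apply: ereal_sup_ubound; exists X => //; split=> // Q XQ; have GQ := XG _ XQ.
by split=> //; [exact: GQ.1.1 | have := Hk _ XQ; lia].
Qed.

End fixed_cube.
End good_cubes.

(** * Monotonicity of powers of extended reals *)

Section powers.
Context {R : realType}.
Implicit Types (x y : \bar R) (r : R).

Lemma le_poweR x y r : (0 <= r)%R -> 0 <= x -> x <= y -> x `^ r <= y `^ r.
Proof.
move=> r0 x0 xy; apply: gt0_ler_poweR => //; rewrite in_itv/= leey andbT//.
exact: le_trans xy.
Qed.

Lemma poweR_ltN x (t r : R) : (0 < r)%R -> (0 <= t)%R -> 0 <= x ->
  t%:E < x -> (t `^ r)%:E < x `^ r.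
Proof.
move=> r0 t0 x0 tx; rewrite ltNge; apply/negP => le; move: tx; apply/negP.
rewrite -leNgt.
have := le_poweR (ltW (_ : 0 < r^-1)%R) (poweR_ge0 _ _) le.
rewrite invr_gt0 => /(_ r0); rewrite -poweRrM poweR_EFin -powRrM mulfV ?gt_eqF//.
by rewrite poweRe1// powRr1.
Qed.

Lemma poweR_gtN x (t r : R) : (0 < r)%R -> (0 <= t)%R -> 0 <= x ->
  (t `^ r)%:E < x `^ r -> t%:E < x.
Proof.
move=> r0 t0 x0; rewrite !ltNge; apply: contra => xt; rewrite -poweR_EFin.
exact: le_poweR (ltW r0) x0 xt.
Qed.

End powers.

(** * Geometric series over dyadic scales *)

Section geometric_sums.
Context {R : realType}.
Local Notation mesh := (@mesh R).

Lemma esum_geometric (c r : R) : (0 <= c)%R -> (0 <= r < 1)%R ->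
  \esum_(i in [set: nat]) (c * r ^+ i)%:E <= (c / (1 - r))%:E.
Proof.
move=> c0 /andP[r0 r1]; have r1' : (0 < 1 - r)%R by rewrite subr_gt0.
rewrite -nneseries_esumT; last by move=> i; rewrite lee_fin mulr_ge0// exprn_ge0.
apply: lime_le.
  by apply: is_cvg_nneseries => i _ _; rewrite lee_fin mulr_ge0// exprn_ge0.
apply: nearW => N; rewrite sumEFin lee_fin -mulr_sumr ler_wpM2l//.
rewrite -[leRHS]div1r ler_pdivlMr// big_mkord mulrC.
have e : ((1 - r) * \sum_(i < N) r ^+ i = 1 - r ^+ N)%R.
  by rewrite -[RHS]opprB subrX1 -mulNr opprB.
by rewrite e gerBl exprn_ge0.
Qed.

Lemma esum_nat_image (f : int -> \bar R) (g : nat -> int) (A : set int) :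
  (forall k, 0 <= f k) -> injective g -> (forall k, A k -> exists i, k = g i) ->
  \esum_(k in A) f k <= \esum_(i in [set: nat]) f (g i).
Proof.
move=> f0 ginj Ag; rewrite -(@esum_image _ _ _ _ g f); last by move=> i j _ _ /ginj.
by apply: le_esum_subset => // k /Ag[i ->]; exists i.
Qed.

Definition geo_cst (b : R) : R := (1 - 2 `^ (- b))^-1%R.

Lemma pow2_lt1 b : (0 < b)%R -> (0 <= (2 : R) `^ (- b) < 1)%R.
Proof.
move=> b0; rewrite powR_ge0 powRN invf_lt1 ?powR_gt0//=.
have := @gt0_ltr_powR R b b0 1%R 2%R; rewrite powR1; apply; rewrite ?nnegrE ?ler0n ?ler01//.
by rewrite ltr1n.
Qed.

Lemma geo_cst_gt0 b : (0 < b)%R -> (0 < geo_cst b)%R.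
Proof. by move=> b0; rewrite invr_gt0 subr_gt0; have /andP[] := pow2_lt1 b0. Qed.

Lemma mesh_powE k b : (mesh k `^ b = 2 `^ (k%:~R * b))%R.
Proof. by rewrite /mesh -powR_intmul// powRrM. Qed.

Lemma pow2D (a b : R) : ((2 : R) `^ (a + b) = 2 `^ a * 2 `^ b)%R.
Proof. by rewrite powRD// pnatr_eq0 implybT. Qed.

Lemma pow2X (a : R) (i : nat) : (((2 : R) `^ a) ^+ i = 2 `^ (a * i%:R))%R.
Proof. by rewrite -powR_mulrn ?powR_ge0// powRrM. Qed.

Lemma esum_mesh_le (l : int) (b : R) : (0 < b)%R ->
  \esum_(k in [set k | (k <= l)%R]) (mesh k `^ b)%:E <= (geo_cst b * mesh l `^ b)%:E.
Proof.
move=> b0.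
apply: le_trans (@esum_nat_image (fun k => (mesh k `^ b)%:E) (fun i => l - i%:Z)%R _ _ _ _) _.
- by move=> k; rewrite lee_fin powR_ge0.
- by move=> i j /eqP; rewrite (inj_eq (addrI _)) eqr_opp => /eqP [].
- by move=> k /= kl; exists `|l - k|%N; lia.
rewrite (_ : \esum_(i in _) _ =
    \esum_(i in [set: nat]) (mesh l `^ b * (2 `^ (- b)) ^+ i)%:E); last first.
  apply: eq_esum => i _; rewrite !mesh_powE pow2X -pow2D rmorphB/=.
  by congr (_ `^ _)%:E; ring.
apply: le_trans (esum_geometric _ (pow2_lt1 b0)) _; rewrite ?powR_ge0//.
by rewrite mulrC lexx.
Qed.

Lemma esum_mesh_ge (l : int) (b : R) : (0 < b)%R ->
  \esum_(k in [set k | (l <= k)%R]) (mesh k `^ (- b))%:E <= (geo_cst b * mesh l `^ (- b))%:E.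
Proof.
move=> b0; apply: le_trans
  (@esum_nat_image (fun k => (mesh k `^ (- b))%:E) (fun i => l + i%:Z)%R _ _ _ _) _.
- by move=> k; rewrite lee_fin powR_ge0.
- by move=> i j /eqP; rewrite (inj_eq (addrI _)) => /eqP [].
- by move=> k /= kl; exists `|k - l|%N; lia.
rewrite (_ : \esum_(i in _) _ =
    \esum_(i in [set: nat]) (mesh l `^ (- b) * (2 `^ (- b)) ^+ i)%:E); last first.
  apply: eq_esum => i _; rewrite !mesh_powE pow2X -pow2D rmorphD/=.
  by congr (_ `^ _)%:E; ring.
apply: le_trans (esum_geometric _ (pow2_lt1 b0)) _; rewrite ?powR_ge0//.
by rewrite mulrC lexx.
Qed.

End geometric_sums.

(** * Weighted maximal functions *)

Section weights.
Context {R : realType} {n : nat} (delta : R).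
Hypotheses (delta_gt0 : (0 < delta)%R) (delta_le : (delta <= n%:R)%R).
Implicit Types (P Q S C : dyadic n) (A B E : set 'rV[R]_n) (f g : 'rV[R]_n -> \bar R).
Local Notation null := (@null R n delta).
Local Notation ell := (@ell R n delta).
Local Notation cell := (@cell R n).
Local Notation star := (@star R n).
Local Notation mesh := (@mesh R).
Local Notation sub := (@sub R n).
Local Notation up := (@up R n).
Local Notation dnorm := (@dnorm R n delta).
Local Notation H := (dcontent delta (fun Q => (ell Q)%:E)).
Local Notation L := (2 * @level_cst R n delta)%R.

Let ell0 Q : (0 <= (ell Q)%:E :> \bar R). Proof. by rewrite lee_fin ell_ge0. Qed.
Let H0 A : 0 <= H A. Proof. exact: dcontent_ge0. Qed.
Let L_gt0 : (0 < L)%R. Proof. by rewrite mulr_gt0// level_cst_gt0. Qed.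
Lemma dnormD A f g : (forall x, 0 <= f x) -> (forall x, 0 <= g x) ->
  dnorm A (fun x => f x + g x) <= dnorm A f + dnorm A g.
Proof.
move=> f0 g0.
apply: le_trans (@dnorm_sub _ _ delta bool setT (fun=> A) (fun b => if b then f else g) _ _ _) _.
  apply: null_sub (null0 delta) => x [Ax]; apply.
  have -> : [set j : bool | [set: bool] j /\ A x] = setT by apply/seteqP; split.
  by rewrite esum_finType ?big_bool// => -[].
by rewrite esum_finType ?big_bool// => -[]; exact: dnorm_ge0.
Qed.

Variables (c0 : R).
Hypotheses (c0_gt0 : (0 < c0)%R) (cell_content : forall P, (c0 * ell P)%:E <= hcontent delta (cell P)).

Lemma cell_dcontent P : (c0 * ell P)%:E <= H (cell P).
Proof. by apply: le_trans (cell_content P) _; exact: hcontent_le_dcontent. Qed.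

Lemma cell_not_null P : ~ null (cell P).
Proof.
move=> P0; have := cell_content P; rewrite P0 lee_fin; apply/negP.
by rewrite -ltNge mulr_gt0// ell_gt0.
Qed.

Definition unit_cst : R := (c0 / L)%R.

Lemma unit_cst_gt0 : (0 < unit_cst)%R. Proof. by rewrite divr_gt0. Qed.

Lemma dnorm_cell1_ge P : (unit_cst * ell P)%:E <= dnorm (cell P) (fun=> 1).
Proof.
have := @chebyshev R n delta delta_gt0 delta_le (cell P) (cell P) (fun=> 1) 1 ltr01
  (fun x => id) (fun=> lee01) (fun _ _ => lexx _).
rewrite mul1e => /(le_trans (cell_dcontent P)).
by rewrite -lee_pdivrMl// -EFinM /unit_cst => h; rewrite mulrAC mulrC.
Qed.

Variables (v : 'rV[R]_n -> R) (a K : R).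
Let V x := (v x)%:E.
Let Va x := (v x `^ (- a))%:E.

(** The Muckenhoupt condition with [a = 1/(p-1)], raised to the power [1/(p-1)]; [a = p-1] gives the
    condition for the dual weight, so both are treated at once. Averaging [v] over the star but
    [v^-a] over the cell only is what yields doubling. *)
Definition avg_pair_le :=
  [/\ forall x, (0 < v x)%R, (0 < a)%R,
   (forall Q, dnorm (star Q) V < +oo), (forall Q, dnorm (cell Q) Va < +oo) &
   forall Q, ((fine (dnorm (star Q) V) / ell Q) `^ a * (fine (dnorm (cell Q) Va) / ell Q) <= K)%R].

Hypothesis vK : avg_pair_le.

Let v_gt0 x : (0 < v x)%R. Proof. by case: vK. Qed.
Let a_gt0 : (0 < a)%R. Proof. by case: vK. Qed.
Let V0 x : 0 <= V x. Proof. by rewrite lee_fin ltW. Qed.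
Let Va0 x : 0 <= Va x. Proof. by rewrite lee_fin powR_ge0. Qed.

Definition wt Q : R := fine (dnorm (cell Q) V).
Let wt3 Q : R := fine (dnorm (star Q) V).
Let dual Q : R := fine (dnorm (cell Q) Va).

Lemma wt3E Q : dnorm (star Q) V = (wt3 Q)%:E.
Proof. by case: vK => _ _ h _ _; rewrite fineK// ge0_fin_numE ?dnorm_ge0. Qed.

Lemma dualE Q : dnorm (cell Q) Va = (dual Q)%:E.
Proof. by case: vK => _ _ _ h _; rewrite fineK// ge0_fin_numE ?dnorm_ge0. Qed.

Lemma wt_le_wt3 P Q : cell P `<=` star Q -> dnorm (cell P) V <= (wt3 Q)%:E.
Proof. by move=> PQ; rewrite -wt3E; exact: dnorm_mono. Qed.

Lemma wtE Q : dnorm (cell Q) V = (wt Q)%:E.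
Proof.
rewrite fineK// ge0_fin_numE ?dnorm_ge0//.
by apply: le_lt_trans (wt_le_wt3 (@sub_star R n Q)) _; exact: ltry.
Qed.

Lemma dnorm_gt0 f P : (forall x, 0 < f x) -> 0 < dnorm (cell P) f.
Proof.
move=> f0; rewrite lt_neqAle dnorm_ge0 andbT eq_sym; apply/eqP => P0.
apply: (@cell_not_null P).
apply: null_sub (dnorm_eq0_ae delta_gt0 delta_le (fun x => ltW (f0 x)) P0).
by move=> x Px; split.
Qed.

Lemma wt_gt0 Q : (0 < wt Q)%R.
Proof. by rewrite -lte_fin -wtE; apply: dnorm_gt0 => x; rewrite lte_fin. Qed.

Lemma dual_gt0 Q : (0 < dual Q)%R.
Proof. by rewrite -lte_fin -dualE; apply: dnorm_gt0 => x; rewrite lte_fin powR_gt0. Qed.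

Let eg Q : (0 < ell Q)%R. Proof. exact: ell_gt0. Qed.

Lemma avg_le Q : ((wt3 Q / ell Q) `^ a * (dual Q / ell Q) <= K)%R.
Proof. by case: vK => _ _ _ _; exact. Qed.

Lemma wt_wt3 Q : (wt Q <= wt3 Q)%R.
Proof. by rewrite -lee_fin -wtE; exact: wt_le_wt3 (@sub_star R n Q). Qed.

Lemma K_gt0 : (0 < K)%R.
Proof.
pose Q : dyadic n := (0%R, [ffun=> 0%R]).
apply: (lt_le_trans _ (avg_le Q)); rewrite mulr_gt0 ?powR_gt0// divr_gt0// ?dual_gt0//.
exact: lt_le_trans (wt_gt0 Q) (wt_wt3 Q).
Qed.

Let avg_le1 Q : ((wt Q / ell Q) `^ a * (dual Q / ell Q) <= K)%R.
Proof.
apply: le_trans (avg_le Q); apply: ler_wpM2r.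
  exact: divr_ge0 (ltW (dual_gt0 _)) (ltW (eg _)).
apply: ge0_ler_powR; rewrite ?nnegrE ?(ltW a_gt0)//.
- exact: divr_ge0 (ltW (wt_gt0 _)) (ltW (eg _)).
- exact: divr_ge0 (le_trans (ltW (wt_gt0 _)) (wt_wt3 Q)) (ltW (eg _)).
- by rewrite ler_pM2r ?invr_gt0// wt_wt3.
Qed.

(* Holder's inequality, from [1 <= e v + e^-a v^-a] with the optimal [e]. *)
Lemma avg_ge Q :
  ((unit_cst / 2) `^ (1 + a) <= (wt Q / ell Q) `^ a * (dual Q / ell Q))%R.
Proof.
have u0 := unit_cst_gt0; have w0 := wt_gt0 Q; have d0 := dual_gt0 Q.
have u2 : (0 < unit_cst / 2)%R by rewrite divr_gt0.
pose t := (wt Q / ell Q)%R; have t0 : (0 < t)%R by rewrite divr_gt0.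
(* Makes the term with [v] equal to half of the lower bound, leaving the other half to the dual
   term. *)
pose e := (unit_cst / 2 / t)%R.
have e0 : (0 < e)%R by rewrite !divr_gt0.
have ea0 : (0 < e `^ (- a))%R by rewrite powR_gt0.
have h : (unit_cst * ell Q)%:E <= e%:E * (wt Q)%:E + (e `^ (- a))%:E * (dual Q)%:E.
  apply: le_trans (dnorm_cell1_ge Q) _; rewrite -wtE -dualE -!dnormZ//.
  apply: le_trans (dnormD _ _ _); last 2 first.
  - by move=> x; rewrite mule_ge0// lee_fin ltW.
  - by move=> x; rewrite mule_ge0// lee_fin ltW.
  apply: dnorm_mono => // x; last first.
    by apply: adde_ge0; apply: mule_ge0 => //; rewrite lee_fin ltW.
  move=> _; rewrite -!EFinM -EFinD lee_fin -powRM ?(ltW e0) ?(ltW (v_gt0 x))//.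
  have [h|h] := leP 1%R (e * v x)%R; first by rewrite ler_wpDr// powR_ge0.
  have ev0 : (0 < e * v x)%R by rewrite mulr_gt0.
  rewrite ler_wpDl ?(ltW ev0)// powRN invf_ge1 ?powR_gt0//.
  have e1 : (1 `^ a = 1 :> R)%R by rewrite powR1.
  by rewrite -[leRHS]e1; apply: ge0_ler_powR; rewrite ?nnegrE ?ler01 ?(ltW a_gt0) ?(ltW h) ?(ltW ev0).
move: h; rewrite -!EFinM -EFinD lee_fin.
have -> : (e * wt Q = unit_cst / 2 * ell Q)%R.
  rewrite /e /t; field; apply/andP; split; rewrite gt_eqF//.
rewrite -lerBlDl.
have -> : (unit_cst * ell Q - unit_cst / 2 * ell Q = unit_cst / 2 * ell Q)%R by field.
have -> : (e `^ (- a) = t `^ a / (unit_cst / 2) `^ a)%R.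
  have tV : (t^-1 `^ a = (t `^ a)^-1)%R.
    by rewrite -(powR_inv1 (ltW t0)) -powRrM mulN1r powRN.
  rewrite powRN /e powRM ?invr_ge0 ?(ltW t0) ?(ltW u2)//.
  by rewrite tV invfM invrK mulrC.
move=> h.
rewrite powRD ?(gt_eqF u2) ?implybT// powRr1 ?(ltW u2)// -/t.
rewrite -ler_pdivlMr ?powR_gt0//.
rewrite -(@ler_pM2r _ (ell Q))//; apply: (le_trans h).
rewrite le_eqVlt; apply/orP; left; apply/eqP; field.
by rewrite !gt_eqF// powR_gt0.
Qed.

Definition doubling_cst : R := (K / (unit_cst / 2) `^ (1 + a))%R `^ a^-1.

Lemma doubling_cst_gt0 : (0 < doubling_cst)%R.
Proof. by rewrite powR_gt0// divr_gt0 ?K_gt0// powR_gt0// divr_gt0// unit_cst_gt0. Qed.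

Lemma powR_le_pow (x y c : R) : (0 < x)%R -> (0 < y)%R -> (0 < c)%R ->
  (x `^ a <= c * y `^ a)%R -> (x <= c `^ a^-1 * y)%R.
Proof.
move=> x0 y0 c_gt0 h.
have an0 : a != 0%R by rewrite gt_eqF.
have -> : x = ((x `^ a) `^ a^-1)%R by rewrite -powRrM mulfV// powRr1// ltW.
have -> : (y = (y `^ a) `^ a^-1)%R by rewrite -powRrM mulfV// powRr1// ltW.
rewrite -powRM ?powR_ge0 ?(ltW c_gt0)//.
apply: ge0_ler_powR; rewrite ?nnegrE ?powR_ge0 ?invr_ge0 ?(ltW a_gt0)//.
by rewrite mulr_ge0 ?powR_ge0// ltW.
Qed.

(** The pair condition has [v] on the star, the lower bound [avg_ge] has it on the cell, and both
    contain the same dual average, which cancels. *)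
Lemma wt_doubling Q : (wt3 Q <= doubling_cst * wt Q)%R.
Proof.
have e0 := eg Q; have d0 := dual_gt0 Q; have w0 := wt_gt0 Q.
have w30 : (0 < wt3 Q)%R := lt_le_trans w0 (wt_wt3 Q).
have u2 : (0 < (unit_cst / 2) `^ (1 + a))%R by rewrite powR_gt0// divr_gt0// unit_cst_gt0.
have := @powR_le_pow (wt3 Q / ell Q) (wt Q / ell Q) (K / (unit_cst / 2) `^ (1 + a)).
rewrite -/doubling_cst mulrA ler_pM2r ?invr_gt0//; apply; rewrite ?divr_gt0 ?K_gt0//.
have de : (0 < dual Q / ell Q)%R by rewrite divr_gt0.
rewrite -(ler_pM2r de); apply: le_trans (avg_le Q) _.
rewrite -(mulrA (K / _)%R) -mulrA ler_peMr ?(ltW K_gt0)// ler_pdivlMl// mulr1.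
exact: avg_ge.
Qed.

Lemma wt_star P Q : cell P `<=` star Q -> (wt P <= doubling_cst * wt Q)%R.
Proof.
move=> PQ; apply: le_trans (wt_doubling Q).
by rewrite -lee_fin -wtE; exact: wt_le_wt3.
Qed.

(** Plays the role of the weighted measure [v(A)]. *)
Definition Hw A := dcontent delta (fun Q => (wt Q)%:E) A.

Let wt0 Q : 0 <= (wt Q)%:E. Proof. by rewrite lee_fin ltW// wt_gt0. Qed.

Lemma Hw_ge0 A : 0 <= Hw A. Proof. exact: dcontent_ge0. Qed.

Definition star_wt_cst : R := ((3 ^ n)%:R * doubling_cst)%R.

Lemma star_wt_cst_gt0 : (0 < star_wt_cst)%R.
Proof. by rewrite mulr_gt0 ?doubling_cst_gt0// ltr0n expn_gt0. Qed.

Lemma Hw_star Q : Hw (star Q) <= (star_wt_cst * wt Q)%:E.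
Proof.
apply: le_trans (@dcontent_sub _ _ _ _ setT (fun e => cell (nbr Q e)) _ _ _ _) _ => //.
  apply: null_sub (null0 delta) => x [/star_nbr[e ex]]; apply.
  by exists e.
rewrite /star_wt_cst -mulrA.
apply: (@star_sum _ _ (fun P => Hw (cell P)) (doubling_cst * wt Q)%R).
  by rewrite mulr_ge0 ?ltW ?doubling_cst_gt0 ?wt_gt0.
move=> e; apply: (le_trans (dcontent_cell _ _ _)) => //.
by rewrite lee_fin; apply: wt_star; exact: sub_star_nbr.
Qed.

(* The average of [v^-a] is at least of order [t^-a], so [vK] bounds that of [v]. *)
Lemma wt_le_of_good E Q (t : R) : (0 < t)%R ->
  (forall x, E x -> (v x <= t)%R) -> (ell Q / 2)%:E <= H (E `&` cell Q) ->
  (wt Q <= (2 * L * K) `^ a^-1 * t * ell Q)%R.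
Proof.
move=> t0 Et Egood; have e0 := eg Q; have w0 := wt_gt0 Q.
have ta0 : (0 < t `^ (- a))%R by rewrite powR_gt0.
have := chebyshev delta_gt0 delta_le ta0 (@subIsetr _ E (cell Q)) Va0.
move=> /(_ _)h.
have {}h : (t `^ (- a))%:E * H (E `&` cell Q) <= L%:E * dnorm (cell Q) Va.
  apply: h => x [Ex _]; rewrite lee_fin !powRN lef_pV2 ?posrE ?powR_gt0//.
  apply: ge0_ler_powR; rewrite ?nnegrE ?(ltW a_gt0) ?(ltW t0) ?(ltW (v_gt0 x))//.
  exact: Et.
have {h} : (t `^ (- a) * (ell Q / 2) <= L * dual Q)%R.
  rewrite -lee_fin !EFinM -dualE; apply: le_trans h.
  by apply: lee_wpmul2l; rewrite ?lee_fin ?powR_ge0// -EFinM.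
rewrite powRN mulrC ler_pdivrMr ?powR_gt0// => h.
rewrite -ler_pdivrMr//.
apply: powR_le_pow; rewrite ?divr_gt0 ?mulr_gt0 ?K_gt0//.
have d0 := dual_gt0 Q; have de : (0 < dual Q / ell Q)%R by rewrite divr_gt0.
rewrite -(ler_pM2r de); apply: le_trans (avg_le1 Q) _.
have -> : (2 * L * K * t `^ a * (dual Q / ell Q) = K * (2 * (L * dual Q * t `^ a) / ell Q))%R.
  by field; rewrite gt_eqF.
rewrite ler_peMr ?(ltW K_gt0)// ler_pdivlMr// mul1r -ler_pdivrMl// mulrC.
exact: h.
Qed.

Let band j P : set 'rV[R]_n := [set x | cell P x /\ (mesh j < v x <= mesh (j + 1))%R].

Definition band_cst : R := (2 * L * geo_cst 1 + L * K * 2 `^ a * geo_cst a)%R.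

Lemma band_cst_gt0 : (0 < band_cst)%R.
Proof.
by rewrite addr_gt0// !mulr_gt0 ?geo_cst_gt0 ?K_gt0 ?powR_gt0 ?level_cst_gt0.
Qed.

(** The replacement for additivity over the disjoint bands. With [2^j0] the size of the average of
    [v] on [P], Chebyshev for [v] gives decay [2^(j0-j)] above [j0]. Chebyshev for [v^-a] and the
    pair condition give decay [2^(a(j-j0))] below it. *)
Lemma band_sum P : \esum_(j in [set: int]) H (band j P) <= (band_cst * ell P)%:E.
Proof.
have e0 := eg P; have w0 := wt_gt0 P.
pose t := (wt P / ell P)%R; have t0 : (0 < t)%R by rewrite divr_gt0.
have tE : wt P = (t * ell P)%R by rewrite /t divfK// gt_eqF.
have [j0 /andP[tlo thi]] := mesh_itv t0.
have m0 j : (0 < mesh j)%R := mesh_gt0 j.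
have high j : H (band j P) <= (L * mesh (j0 + 1) * ell P)%:E * (mesh j `^ (- 1))%:E.
  rewrite powR_inv1 ?(ltW (m0 _))// muleC lee_pdivlMl//.
  have h := @chebyshev R n delta delta_gt0 delta_le (cell P) (band j P) V _ (m0 j) _ V0 _.
  apply: (le_trans (h _ _)); first by move=> x [].
    by move=> x [_ /andP[hx _]]; rewrite lee_fin ltW.
  rewrite wtE -EFinM lee_fin tE -[leRHS]mulrA; apply: ler_wpM2l; first exact: ltW.
  by rewrite ler_pM2r.
have low j : H (band j P) <= (L * K * 2 `^ a * mesh j0 `^ (- a) * ell P)%:E * (mesh j `^ a)%:E.
  have ma0 : (0 < mesh (j + 1) `^ (- a))%R by rewrite powR_gt0.
  have h := @chebyshev R n delta delta_gt0 delta_le (cell P) (band j P) Va _ ma0 _ Va0 _.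
  have {h} : (mesh (j + 1) `^ (- a))%:E * H (band j P) <= (L * dual P)%:E.
    rewrite EFinM -dualE; apply: h; first by move=> x [].
    move=> x [_ /andP[_ hx]]; rewrite lee_fin !powRN lef_pV2 ?posrE ?powR_gt0//.
    by apply: ge0_ler_powR; rewrite ?nnegrE ?(ltW a_gt0) ?(ltW (m0 _)) ?(ltW (v_gt0 x)).
  rewrite -lee_pdivlMl// => /le_trans; apply; rewrite -!EFinM lee_fin.
  rewrite powRN invrK meshS powRM ?(ltW (m0 _))//.
  have dle : (dual P <= K * mesh j0 `^ (- a) * ell P)%R.
    rewrite -ler_pdivrMr//; rewrite powRN -/(_ / _)%R ler_pdivlMr ?powR_gt0// mulrC.
    apply: le_trans (avg_le1 P); rewrite ler_pM2r ?divr_gt0 ?dual_gt0//.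
    by apply: ge0_ler_powR; rewrite ?nnegrE ?(ltW a_gt0) ?(ltW (m0 _)) ?(ltW t0) ?(ltW tlo).
  have -> : (L * K * 2 `^ a * mesh j0 `^ (- a) * ell P * mesh j `^ a =
    2 `^ a * mesh j `^ a * (L * (K * mesh j0 `^ (- a) * ell P)))%R by ring.
  apply: ler_wpM2l; first by rewrite mulr_ge0 ?powR_ge0.
  by apply: ler_wpM2l => //; exact: ltW.
rewrite (@esumID _ _ [set j | (j0 <= j)%R])// !setTI.
rewrite /band_cst mulrDl EFinD; apply: leeD.
  apply: (@le_trans _ _ (\esum_(j in [set j | (j0 <= j)%R])
      (L * mesh (j0 + 1) * ell P)%:E * (mesh j `^ (- 1))%:E)).
    by apply: le_esum => j _; exact: high.
  rewrite esumZl; last 2 first.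
  - by rewrite !mulr_ge0 ?(ltW (m0 _)) ?(ltW e0) ?(ltW (level_cst_gt0 _)).
  - by move=> j; rewrite lee_fin powR_ge0.
  apply: le_trans (lee_wpmul2l _ (esum_mesh_ge j0 ltr01)) _.
    by rewrite lee_fin !mulr_ge0 ?(ltW (m0 _)) ?(ltW e0) ?(ltW (level_cst_gt0 _)).
  rewrite -EFinM lee_fin powR_inv1 ?(ltW (m0 _))// meshS le_eqVlt; apply/orP; left.
  by apply/eqP; field; rewrite gt_eqF.
apply: (@le_trans _ _ (\esum_(j in [set j | (j <= j0)%R])
    (L * K * 2 `^ a * mesh j0 `^ (- a) * ell P)%:E * (mesh j `^ a)%:E)).
  apply: (@le_trans _ _ (\esum_(j in [set j | (j <= j0)%R]) H (band j P))).
    by apply: le_esum_subset => // j /= /negP; rewrite -ltNge => /ltW.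
  by apply: le_esum => j _; exact: low.
have c1 : (0 <= L * K * 2 `^ a * mesh j0 `^ (- a) * ell P)%R.
  by rewrite !mulr_ge0 ?powR_ge0 ?(ltW e0) ?(ltW K_gt0) ?(ltW (level_cst_gt0 _)).
rewrite esumZl//; last by move=> j; rewrite lee_fin powR_ge0.
apply: le_trans (lee_wpmul2l _ (esum_mesh_le j0 a_gt0)) _; first by rewrite lee_fin.
rewrite -EFinM lee_fin powRN le_eqVlt; apply/orP; left.
by apply/eqP; field; rewrite gt_eqF// powR_gt0.
Qed.

Let good_cst : R := ((2 * L * K) `^ a^-1)%R.

(** On each cube of a packing of the band, [wt_le_of_good] bounds the weight by a multiple of
    [2^(j+1) ell], and the packing has total [ell] at most twice the content of the band. *)
Lemma Hw_band j P : Hw (band j P) <= (2 * good_cst * mesh (j + 1))%:E * H (band j P).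
Proof.
have m0 := mesh_gt0 (R := R) (j + 1).
have [G [Ggood Gnull Gsum]] := good_cubes delta_gt0 delta_le (band j P) P.
have bE : band j P `&` cell P = band j P by apply/setIidPl => x [].
rewrite bE in Gnull Gsum.
apply: le_trans (dcontent_cover _ Gnull) _.
apply: (@le_trans _ _ (\esum_(Q in G) (good_cst * mesh (j + 1))%:E * (ell Q)%:E)).
  apply: le_esum => Q GQ; rewrite -EFinM lee_fin.
  apply: (wt_le_of_good (E := band j P)) => //; last exact: (Ggood _ GQ).2.
  by move=> x [_ /andP[]].
have g0 : (0 <= good_cst * mesh (j + 1))%R by rewrite mulr_ge0 ?powR_ge0// ltW.
rewrite esumZl//.
apply: le_trans (lee_wpmul2l _ Gsum) _; first by rewrite lee_fin.
by rewrite muleA -EFinM; have -> : (good_cst * mesh (j + 1) * 2 = 2 * good_cst * mesh (j + 1))%R by ring.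
Qed.

Definition low_cst : R := (geo_cst 1 * (2 * good_cst) * band_cst)%R.

Lemma low_cst_gt0 : (0 < low_cst)%R.
Proof.
by rewrite !mulr_gt0 ?geo_cst_gt0 ?band_cst_gt0 ?powR_gt0// !mulr_gt0 ?K_gt0 ?level_cst_gt0.
Qed.

(** Split [{v <= 2^(p-l)}] into the bands [j < p - l]. For fixed [j] the factors [2^l] sum to order
    [2^(p-j)], which cancels the [2^j] of [Hw_band], and [band_sum] handles the sum over [j]. *)
Lemma low_levels_cell (p : int) P :
  \esum_(l in [set: int]) (mesh l)%:E * Hw [set x | cell P x /\ (v x <= mesh (p - l))%R]
    <= (low_cst * mesh p * ell P)%:E.
Proof.
have m0 j : (0 < mesh j)%R := mesh_gt0 j.
have g1 : (0 < geo_cst 1 :> R)%R by rewrite geo_cst_gt0.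
have gc0 : (0 < good_cst)%R by rewrite powR_gt0// !mulr_gt0 ?K_gt0 ?level_cst_gt0.
apply: (@le_trans _ _ (\esum_(l in [set: int]) \esum_(j in [set j | (j < p - l)%R])
    (mesh l)%:E * Hw (band j P))).
  apply: le_esum => l _; rewrite esumZl ?(ltW (m0 _))//; last by move=> j; exact: Hw_ge0.
  apply: lee_wpmul2l; first by rewrite lee_fin ltW.
  apply: dcontent_sub => //; apply: null_sub (null0 delta) => x [[Px vx]]; apply.
  have [j /andP[h1 h2]] := mesh_itv (v_gt0 x); exists j => /=; last by split=> //; rewrite h1.
  by have := lt_le_trans h1 vx; rewrite /mesh ltr_eXz2l ?ltr1n.
rewrite (@esum_exchange _ _ _ _ _ setT (fun j => [set l | (l <= p - j - 1)%R])); last 2 first.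
- by move=> l j /=; split=> -[_ h]; split=> //; lia.
- by move=> l j _ _; rewrite mule_ge0 ?Hw_ge0// lee_fin ltW.
apply: (@le_trans _ _ (\esum_(j in [set: int])
    (geo_cst 1 * (2 * good_cst) * mesh p)%:E * H (band j P))).
  apply: le_esum => j _.
  apply: le_trans (esumZr _ _ _) _ => [|l|]; [exact: Hw_ge0|exact: ltW|].
  apply: (@le_trans _ _ ((geo_cst 1 * mesh (p - j - 1))%:E * Hw (band j P))).
    apply: lee_wpmul2r; first exact: Hw_ge0.
    have := @esum_mesh_le R (p - j - 1)%R 1%R ltr01; rewrite powRr1 ?(ltW (m0 _))//.
    by under eq_esum do rewrite powRr1 ?(ltW (m0 _))//.
  apply: le_trans (lee_wpmul2l _ (Hw_band j P)) _.
    by rewrite lee_fin mulr_ge0// ltW.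
  rewrite muleA -EFinM; apply: lee_wpmul2r => //; rewrite lee_fin.
  have -> : mesh p = (mesh (p - j - 1) * mesh (j + 1))%R.
    by rewrite /mesh -expfzDr ?pnatr_eq0//; congr (_ ^ _)%R; ring.
  by rewrite le_eqVlt; apply/orP; left; apply/eqP; ring.
rewrite esumZl//; last by rewrite !mulr_ge0 ?(ltW g1) ?(ltW gc0) ?(ltW (m0 _)).
apply: le_trans (lee_wpmul2l _ (band_sum P)) _.
  by rewrite lee_fin !mulr_ge0 ?(ltW g1) ?(ltW gc0) ?(ltW (m0 _)).
by rewrite -EFinM lee_fin /low_cst le_eqVlt; apply/orP; left; apply/eqP; ring.
Qed.

Lemma low_levels (p : int) A :
  \esum_(l in [set: int]) (mesh l)%:E * Hw [set x | A x /\ (v x <= mesh (p - l))%R]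
    <= (low_cst * mesh p)%:E * H A.
Proof.
have m0 j : (0 < mesh j)%R := mesh_gt0 j.
have c1 : (0 < low_cst * mesh p)%R by rewrite mulr_gt0 ?low_cst_gt0.
rewrite -lee_pdivrMl//; apply/ereal_infP => _ [C AC' <-]; rewrite lee_pdivrMl//.
apply: (@le_trans _ _ (\esum_(l in [set: int]) \esum_(P in C)
   (mesh l)%:E * Hw [set x | cell P x /\ (v x <= mesh (p - l))%R])).
  apply: le_esum => l _; rewrite esumZl ?(ltW (m0 _))//; last by move=> P; exact: Hw_ge0.
  apply: lee_wpmul2l; first by rewrite lee_fin ltW.
  apply: dcontent_sub => //; apply: null_sub AC' => x [[Ax vx] nx]; split=> // -[P CP Px].
  by apply: nx; exists P.
rewrite (@esum_exchange _ _ _ _ _ C (fun=> setT)); last 2 first.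
- by move=> l P; split=> -[].
- by move=> l P _ _; rewrite mule_ge0 ?Hw_ge0// lee_fin ltW.
rewrite -esumZl ?(ltW c1)//; apply: le_esum => P _; rewrite -EFinM.
exact: low_levels_cell.
Qed.

(* Where [u > 2^l] and [u v] is of order [2^m], the weight is at most [2^(m+1-l)]. *)
Lemma wt_levels_le_dnorm (u : 'rV[R]_n -> \bar R) : (forall x, 0 <= u x) ->
  \esum_(l in [set: int]) (mesh l)%:E * Hw [set x | (mesh l)%:E < u x]
    <= (2 * low_cst * @level_cst R n delta)%:E * dnorm setT (fun x => u x * V x).
Proof.
move=> u0; have m0 j : (0 < mesh j)%R := mesh_gt0 j.
pose f x := u x * V x; have f0 x : 0 <= f x by rewrite mule_ge0.
have l0 := low_cst_gt0; have lv0 := @level_cst_gt0 R n delta.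
have cst0 : (0 < 2 * low_cst * @level_cst R n delta)%R := mulr_gt0 (mulr_gt0 (ltr0n _ 2) l0) lv0.
have [Ffin|] := ltP (dnorm setT f) +oo; last first.
  by rewrite leye_eq => /eqP ->; rewrite gt0_muley ?leey// lte_fin.
pose A m : set 'rV[R]_n := [set x | setT x /\ (mesh m)%:E < f x].
apply: (@le_trans _ _ (\esum_(l in [set: int]) \esum_(m in [set: int])
    (mesh l)%:E * Hw [set x | A m x /\ (v x <= mesh (m + 1 - l))%R])).
  apply: le_esum => l _; rewrite esumZl ?(ltW (m0 _))//; last by move=> m; exact: Hw_ge0.
  apply: lee_wpmul2l; first by rewrite lee_fin ltW.
  apply: dcontent_sub => //; apply: null_sub (dnorm_fin_ae delta_gt0 delta_le f0 Ffin).
  move=> x [/= lx nx]; split=> //; apply: contrapT => fx; apply: nx.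
  case uE : (u x) lx => [r| |] //= lx; last first.
    by exfalso; apply: fx; rewrite /f uE gt0_mulye// lte_fin.
  rewrite lte_fin in lx; have r0 : (0 < r)%R := lt_trans (m0 l) lx.
  have [m /andP[h1 h2]] := mesh_itv (mulr_gt0 r0 (v_gt0 x)).
  exists m => //; split.
    by split=> //; rewrite /f uE -EFinM lte_fin.
  have -> : (mesh (m + 1 - l) = mesh (m + 1) / mesh l)%R.
    by rewrite /mesh expfzDr ?pnatr_eq0// invr_expz.
  rewrite ler_pdivlMr//; apply: le_trans h2; rewrite mulrC ler_pM2r//.
  exact: ltW.
rewrite esum_exchangeT; last by move=> l m; rewrite mule_ge0 ?Hw_ge0// lee_fin ltW.
apply: (@le_trans _ _ (\esum_(m in [set: int]) (2 * low_cst)%:E * ((mesh m)%:E * H (A m)))).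
  apply: le_esum => m _; apply: le_trans (low_levels _ _) _.
  rewrite muleA -EFinM meshS; have -> : (low_cst * (2 * mesh m) = 2 * low_cst * mesh m)%R by ring.
  by [].
have tl0 : (0 <= 2 * low_cst)%R := mulr_ge0 (ler0n _ 2) (ltW l0).
rewrite (esumZl _ tl0); last by move=> m; rewrite mule_ge0// lee_fin ltW.
rewrite [in leRHS]EFinM -[leRHS]muleA; apply: lee_wpmul2l; first by rewrite lee_fin.
exact: levels_le_dnorm.
Qed.

(** With [wt_levels_le_dnorm] this identifies the norm of [u v], up to constants, with a layer-cake
    sum of [u] for [Hw], so maximal estimates become estimates of level sets. *)
Lemma dnorm_le_wt_levels (u : 'rV[R]_n -> \bar R) : (forall x, 0 <= u x) ->
  dnorm setT (fun x => u x * V x) <=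
  2%:E * \esum_(l in [set: int]) (mesh l)%:E * Hw [set x | (mesh l)%:E < u x].
Proof.
move=> u0; have m0 j : (0 < mesh j)%R := mesh_gt0 j.
apply: le_trans; first exact: (@dnorm_levels R n delta setT u V u0 V0).
rewrite -esumZl//; last by move=> m; rewrite mule_ge0 ?Hw_ge0// lee_fin ltW.
apply: le_esum => k _; rewrite EFinM -muleA; apply: lee_wpmul2l => //.
apply: lee_wpmul2l; first by rewrite lee_fin ltW.
apply: le_trans (dnorm_le_dcontent _ _ V0) _.
rewrite /Hw (_ : (fun Q => dnorm (cell Q) V) = (fun Q => (wt Q)%:E)); last first.
  by apply/funext => Q; rewrite wtE.
by apply: dcontent_subset => // x [].
Qed.

End weights.

(** * Strong type bound for the maximal function relative to a weight *)

Section weighted_maximal_function.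
Context {R : realType} {n : nat} (delta : R).
Hypotheses (delta_gt0 : (0 < delta)%R) (delta_le : (delta <= n%:R)%R).
Implicit Types (P Q S : dyadic n) (A B E : set 'rV[R]_n) (f g h : 'rV[R]_n -> \bar R).
Local Notation null := (@null R n delta).
Local Notation ell := (@ell R n delta).
Local Notation cell := (@cell R n).
Local Notation star := (@star R n).
Local Notation mesh := (@mesh R).
Local Notation sub := (@sub R n).
Local Notation up := (@up R n).
Local Notation anc := (@anc R n).
Local Notation dnorm := (@dnorm R n delta).

Variables (c0 : R).
Hypotheses (c0_gt0 : (0 < c0)%R) (cell_content : forall P, (c0 * ell P)%:E <= hcontent delta (cell P)).
Variables (v : 'rV[R]_n -> R) (a K : R).
Hypothesis vK : avg_pair_le delta v a K.
Let V x := (v x)%:E.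
Local Notation wt := (@wt R n delta v).
Local Notation Hw := (@Hw R n delta v).

Let v_gt0 x : (0 < v x)%R. Proof. by case: vK. Qed.
Let V0 x : 0 <= V x. Proof. by rewrite lee_fin ltW. Qed.
Let wtE Q : dnorm (cell Q) V = (wt Q)%:E. Proof. exact: (wtE vK Q). Qed.
Let wt_gt0 Q : (0 < wt Q)%R. Proof. exact: (wt_gt0 delta_gt0 delta_le c0_gt0 cell_content vK Q). Qed.
Let Hw_ge0 A : 0 <= Hw A. Proof. exact: (Hw_ge0 delta_gt0 delta_le c0_gt0 cell_content vK A). Qed.
Let wt0 Q : 0 <= (wt Q)%:E. Proof. by rewrite lee_fin ltW. Qed.
Let m0 k : (0 < mesh k)%R. Proof. exact: mesh_gt0. Qed.
Let D : R := @doubling_cst R n delta c0 a K.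
Let D_gt0 : (0 < D)%R.
Proof. exact: (doubling_cst_gt0 delta_gt0 delta_le c0_gt0 cell_content vK). Qed.

Let n_gt0 : (0 < n)%N.
Proof. by rewrite lt0n; apply/eqP => n0; have := lt_le_trans delta_gt0 delta_le; rewrite n0 ltxx. Qed.

Lemma wt_mono P Q : sub P Q -> (wt P <= wt Q)%R.
Proof.
by move=> PQ; rewrite -lee_fin -!wtE; apply: dnorm_mono => //; exact: sub_cell.
Qed.

Section growth.
Variables (P : dyadic n) (S : nat -> dyadic n).
Let T (j : nat) : dyadic n := anc (P.1 + j%:Z)%R P.
Hypothesis HS : forall j, [/\ (S j).1 = (T j).1, S j <> T j & sub (S j) (up (T j))].

Let PT j : sub P (T j). Proof. by apply: sub_anc; rewrite lerDl. Qed.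

Let upT j : up (T j) = T j.+1.
Proof.
rewrite (sub_ancE (sub_trans (PT j) (sub_up (T j)))) /T /=; congr anc.
by rewrite -addrA -PoszD addn1.
Qed.

Let TT i j : (i <= j)%N -> sub (T i) (T j).
Proof. by move=> ij; apply: (sub_linear (PT i) (PT j)); rewrite /= lerD2l lez_nat. Qed.

Let S_disjoint Q i j : sub Q (S i) -> sub Q (S j) -> i = j.
Proof.
wlog ij : i j / (i < j)%N.
  move=> wl Qi Qj; case: (ltngtP i j) => // ij; first exact: wl.
  by apply/esym; exact: wl.
move=> Qi Qj; have [_ _ Si] := HS i; have [lev ne _] := HS j; exfalso; apply: ne.
rewrite upT in Si; have QT := sub_trans Qi (sub_trans Si (TT ij)).
by rewrite (sub_ancE Qj) (sub_ancE QT) lev.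
Qed.

Let wt_S j : (wt P <= D * wt (S j))%R.
Proof.
apply: (wt_star delta_gt0 delta_le c0_gt0 cell_content vK).
apply: subset_trans (@star_up R n (S j)).
have [lev _ Sj] := HS j; have -> : up (S j) = T j.+1.
  by rewrite -upT (sub_ancE Sj) /up/= lev.
exact: sub_cell.
Qed.

(** The disjoint siblings [S j] each have weight at least [wt P / D], but norms do not add over
    them. One stack on [T k] is charged for all: a cube inside [S j] pays its own [ell], a cube
    containing [S j] pays [ell (S j)]. Since [Q] lies in at most one sibling, and the siblings
    inside it have distinct levels, it pays at most [(1 + geo_cst delta) ell Q] in total. *)
Let growth_bound (k : nat) lam : dominates delta (cell (T k)) V lam ->
  (k%:R * (wt P / D))%:E <= (1 + geo_cst delta)%:E * total delta lam.
Proof.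
move=> [l0 lamV].
have gd0 : (0 < geo_cst delta)%R by exact: geo_cst_gt0.
pose I j : set (dyadic n) := [set Q | sub Q (S j) \/ sub (S j) Q].
pose e j Q : R := if `[< sub Q (S j) >] then ell Q else ell (S j).
have e0 j Q : (0 <= e j Q)%R by rewrite /e; case: ifP => _; exact: ell_ge0.
have one (j : 'I_k) : (wt P / D)%:E <= \esum_(Q in I j) (e j Q)%:E * lam Q.
  apply: (@le_trans _ _ (wt (S j))%:E); first by rewrite lee_fin ler_pdivrMr// mulrC.
  rewrite -wtE; apply: (@le_trans _ _ (\esum_(Q in I j)
      dnorm (cell (if `[< sub Q (S j) >] then Q else S j)) (fun=> lam Q))).
    apply: dnorm_sub; apply: null_sub lamV => x [Sx nx]; split.
      have [_ _ Sj] := HS j; apply: (sub_cell (TT (ltn_ord j))).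
      by rewrite -upT; exact: (sub_cell Sj).
    move=> Vx; apply: nx; apply: (le_trans Vx); apply: le_esum_subset => // Q Qx.
    split; first exact: cell_sub_or Qx Sx.
    by case: ifP.
  apply: le_esum => Q _; apply: le_trans (dnorm_cell_cst delta _ (l0 Q)) _.
  by rewrite /e; case: ifP.
apply: (@le_trans _ _ (\esum_(j in [set: 'I_k]) \esum_(Q in I j) (e j Q)%:E * lam Q)).
  rewrite -[X in (X%:R * _)%R](card_ord k) -esum_finType_cst; last first.
    by rewrite divr_ge0 ?(ltW (wt_gt0 _)) ?(ltW D_gt0).
  by apply: le_esum => j _; exact: one.
rewrite (@esum_exchange _ _ _ _ _ setT (fun Q => [set j : 'I_k | I j Q])); last 2 first.
- by move=> j Q; split=> -[].
- by move=> j Q _ _; rewrite mule_ge0// lee_fin.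
rewrite -esumZl ?addr_ge0 ?(ltW gd0)//; last by move=> Q; rewrite mule_ge0// lee_fin ell_ge0.
apply: le_esum => Q _; apply: le_trans (esumZr _ (l0 Q) (fun j => e0 _ Q)) _.
rewrite muleA; apply: lee_wpmul2r => //.
rewrite (@esumID _ _ [set j : 'I_k | sub Q (S j)]); last by move=> j _; rewrite lee_fin.
rewrite -EFinM mulrDl mul1r EFinD; apply: leeD.
  apply: (@le_trans _ _ (\esum_(j in [set j : 'I_k | sub Q (S j)]) (ell Q)%:E)).
    apply: (@le_trans _ _ (\esum_(j in [set j : 'I_k | sub Q (S j)]) (e j Q)%:E)).
      by apply: le_esum_subset => [j []//|j _]; rewrite lee_fin.
    by apply: le_esum => j Qj; rewrite /e asboolT.
  apply: esum_le_single; first by rewrite lee_fin ell_ge0.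
  by move=> i j Qi Qj; apply/val_inj; exact: S_disjoint Qi Qj.
apply: (@le_trans _ _ (\esum_(j in [set j : 'I_k | (P.1 + (j : nat)%:Z <= Q.1)%R])
    (mesh (P.1 + (j : nat)%:Z) `^ delta)%:E)).
  apply: (@le_trans _ _ (\esum_(j in [set j : 'I_k | (P.1 + (j : nat)%:Z <= Q.1)%R]) (e j Q)%:E)).
    apply: le_esum_subset => [j [[Qj|Sj] nQ]|j _]; [by []| |by rewrite lee_fin].
    by have [lev _ _] := HS j; have := Sj.1; rewrite lev.
  apply: le_esum => j le; rewrite lee_fin /e; case: ifP => [/asboolP Qj|_]; last first.
    by rewrite /ell; have [-> _ _] := HS j.
  by apply: le_trans (le_ell delta_gt0 Qj.1) _; rewrite /ell; have [-> _ _] := HS j.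
rewrite -(@esum_image _ _ _ _ (fun j : 'I_k => (P.1 + (j : nat)%:Z)%R)
  (fun k => (mesh k `^ delta)%:E)); last first.
  by move=> i j _ _ /addrI [] /val_inj.
apply: le_trans (esum_mesh_le Q.1 delta_gt0).
by apply: le_esum_subset => [_ [j jQ <-]//|j _]; rewrite lee_fin powR_ge0.
Qed.

Lemma wt_growth_aux (B : R) : exists k, (B < wt (T k))%R.
Proof.
apply: contrapT => /forallNP bd.
have wB k : (wt (T k) <= B)%R by rewrite leNgt; apply/negP; exact: bd.
have gd0 : (0 < 1 + geo_cst delta)%R by rewrite addr_gt0// geo_cst_gt0.
have wD : (0 < wt P / D)%R by rewrite divr_gt0.
have lin k : (k%:R * (wt P / D) <= (1 + geo_cst delta) * (B + 1))%R.
  have [_ [lam lamV <-] lamB] : exists2 y, [set total delta lam | lam in dominates delta (cell (T k)) V] y & y <= dnorm (cell (T k)) V + 1%:E.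
    apply: ereal_inf_adherent_eps => //.
      by move=> y [lam [l0 _] <-]; exact: total_ge0.
    by rewrite -/(dnorm _ _) wtE ltry.
  rewrite -lee_fin; apply: (le_trans (growth_bound lamV)).
  rewrite EFinM; apply: lee_wpmul2l; first by rewrite lee_fin ltW.
  by apply: (le_trans lamB); rewrite wtE -EFinD lee_fin lerD2r.
have := lin (Num.bound ((1 + geo_cst delta) * (B + 1) / (wt P / D)))%R.
rewrite -ler_pdivlMr// leNgt => /negP; apply.
have := @archi_boundP _ ((1 + geo_cst delta) * (B + 1) / (wt P / D))%R.
by apply; rewrite divr_ge0 ?(ltW wD)// mulr_ge0 ?(ltW gd0)// addr_ge0// (le_trans (ltW (wt_gt0 P)))// (le_trans _ (wB 0%N))// wt_mono.
Qed.

End growth.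

(** Needed to find maximal cubes: a family of cubes with bounded weights cannot contain arbitrarily
    large ancestors of [P]. *)
Lemma wt_growth P (B : R) : exists k : nat, (B < wt (anc (P.1 + k%:Z)%R P))%R.
Proof.
have /choice[S HS] : forall j : nat, exists S, [/\ S.1 = (anc (P.1 + j%:Z)%R P).1,
    S <> anc (P.1 + j%:Z)%R P & sub S (up (anc (P.1 + j%:Z)%R P))].
  by move=> j; exact: sibling.
exact: (wt_growth_aux HS B).
Qed.

(** Averages over the cell, relative to the weight, but the point may lie anywhere in the star;
    doubling pays for the enlargement. *)
Definition wmax h (x : 'rV[R]_n) : \bar R :=
  ereal_sup [set (wt P)^-1%:E * dnorm (cell P) (fun y => h y * V y) |
             P in [set P | star P x]].

Lemma wmax_ge h P x : star P x ->
  (wt P)^-1%:E * dnorm (cell P) (fun y => h y * V y) <= wmax h x.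
Proof. by move=> Px; apply: ereal_sup_ubound; exists P. Qed.

Lemma wmax_ge0 h x : 0 <= wmax h x.
Proof.
apply: le_trans (wmax_ge h (sub_star (at_levelP 0%R x))).
by rewrite mule_ge0 ?dnorm_ge0// lee_fin invr_ge0 ltW.
Qed.

Variables (q : R).
Hypothesis q_gt1 : (1 < q)%R.
Let q_gt0 : (0 < q)%R. Proof. exact: lt_trans q_gt1. Qed.

(* The levels of [h] corresponding to the dyadic levels of [h ^ q]. *)
Let tau k : R := (mesh k `^ q^-1)%R.
Let tau_gt0 k : (0 < tau k)%R. Proof. by rewrite powR_gt0. Qed.

Let tauS k : tau (k + 1) = (2 `^ q^-1 * tau k)%R.
Proof. by rewrite /tau meshS powRM// ltW. Qed.

Let le_tau k l : (k <= l)%R -> (tau k <= tau l)%R.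
Proof.
by move=> kl; apply: ge0_ler_powR; rewrite ?nnegrE ?invr_ge0 ?(ltW q_gt0) ?(ltW (m0 _)) ?le_mesh.
Qed.

Let tau_itv (r : R) : (0 < r)%R -> exists k, (tau k < r <= tau (k + 1))%R.
Proof.
move=> r0; have rq0 : (0 < r `^ q)%R by rewrite powR_gt0.
have rE : r = ((r `^ q) `^ q^-1)%R by rewrite -powRrM mulfV ?gt_eqF// powRr1// ltW.
have [k /andP[h1 h2]] := mesh_itv rq0; exists k; rewrite rE; apply/andP; split.
  by apply: gt0_ltr_powR; rewrite ?nnegrE ?invr_gt0 ?(ltW (m0 _)) ?(ltW rq0).
by apply: ge0_ler_powR; rewrite ?nnegrE ?invr_ge0 ?(ltW q_gt0) ?(ltW (m0 _)) ?(ltW rq0).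
Qed.

Section level_covers.
Variables (h : 'rV[R]_n -> \bar R) (C : int -> set (dyadic n)).
Hypothesis h0 : forall x, 0 <= h x.
Hypothesis hC : forall l, covers delta [set x | (tau l)%:E < h x] (C l).
Let Ch l := \esum_(Q in C l) (wt Q)%:E.

Section fixed_level.
Variable k : int.

Let tail := \esum_(l in [set l | (k <= l)%R]) (tau (l + 1))%:E * Ch l.
Let part P := \esum_(l in [set l | (k <= l)%R])
  (tau (l + 1))%:E * \esum_(Q in [set Q | C l Q /\ sub Q P]) (wt Q)%:E.
Let bad P := (tau k * wt P)%:E < part P.
Let maxbad P := bad P /\ forall S, bad S -> sub P S -> S = P.

Let tau0 l : 0 <= (tau l)%:E. Proof. by rewrite lee_fin ltW. Qed.
Let Ch0 l : 0 <= Ch l. Proof. exact: esum_ge0. Qed.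

(** Almost everywhere on [P], [h] is at most [tau k] plus the sum of [tau (l + 1)] over the covering
    cubes of index [l >= k] through the point, all of which lie inside [P]. The first part
    contributes [tau k * wt P], so the second must exceed this amount. *)
Let not_covered_bad P :
  (2 * tau k * wt P)%:E < dnorm (cell P) (fun y => h y * V y) ->
  (forall l Q, (k <= l)%R -> C l Q -> ~ sub P Q) -> bad P.
Proof.
move=> big ncov; rewrite /bad ltNge; apply/negP => small; move: big; apply/negP.
rewrite -leNgt.
pose I := [set l : int | (k <= l)%R] `*`` (fun l => [set Q | C l Q /\ sub Q P]).
pose G y := \esum_(j in [set j | I j /\ cell j.2 y]) (tau (j.1 + 1))%:E * V y.
have G0 y : 0 <= G y by apply: esum_ge0 => j _; rewrite mule_ge0.
have tV y : 0 <= (tau k)%:E * V y by rewrite mule_ge0.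
have hG : dnorm (cell P) (fun y => h y * V y) <=
    dnorm (cell P) (fun y => (tau k)%:E * V y + G y).
  apply: dnorm_le => [|y]; last exact: adde_ge0.
  apply: null_sub (null_bigcup (P := setT) (fun l _ => hC l)) => y [Py nle].
  apply: contrapT => nnull; apply: nle; split=> //.
  have [le|gt] := leP (h y) (tau k)%:E.
    by rewrite (le_trans (lee_wpmul2r (V0 y) le))// leeDl.
  rewrite (@le_trans _ _ (G y))// ?leeDr//.
  have lb l : (k <= l)%R -> (tau l)%:E < h y -> (tau (l + 1))%:E * V y <= G y.
    move=> kl ly; have [Q CQ Qy] : exists2 Q, C l Q & cell Q y.
      apply: contrapT => nQ; apply: nnull; by exists l.
    have QP : sub Q P.
      by have [PQ|//] := cell_sub_or Py Qy; exfalso; exact: ncov kl CQ PQ.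
    apply: (@esum_lb _ _ _ (fun j : int * dyadic n => (tau (j.1 + 1))%:E * V y) (l, Q)) => //.
    by move=> j _; rewrite mule_ge0.
  move: gt lb (h0 y); case: (h y) => [r| |] // gt lb hy0.
    rewrite lte_fin in gt; have r0 := lt_trans (tau_gt0 k) gt.
    have [l /andP[l1 l2]] := tau_itv r0.
    apply: le_trans (lb l _ _); last by rewrite lte_fin.
      by apply: lee_wpmul2r => //; rewrite lee_fin.
    rewrite leNgt; apply/negP => lk.
    have : (tau (l + 1) <= tau k)%R by apply: le_tau; lia.
    by move=> /(le_trans l2); rewrite leNgt gt.
  rewrite gt0_mulye ?lte_fin// leye_eq; apply/eqP/eq_infty => t.
  have [t1|t1] := leP t 0%R; first by apply: (le_trans _ (G0 y)); rewrite lee_fin.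
  have [l /andP[_ h2]] := tau_itv (divr_gt0 t1 (v_gt0 y)).
  pose l' := Num.max k l.
  apply: le_trans (lb l' _ _); rewrite ?ltry ?le_max ?lexx//.
  rewrite -EFinM lee_fin -ler_pdivrMr//; apply: (le_trans h2); apply: le_tau.
  by rewrite lerD2r le_max lexx orbT.
apply: (le_trans hG); apply: (le_trans (dnormD _ _ tV G0)).
have -> : (2 * tau k * wt P = tau k * wt P + tau k * wt P)%R by ring.
rewrite EFinD dnormZ// wtE -EFinM; apply: leeD2l; apply: le_trans small.
apply: (@le_trans _ _ (\esum_(j in I) dnorm (cell j.2) (fun y => (tau (j.1 + 1))%:E * V y))).
  apply: dnorm_sub; apply: null_sub (null0 delta) => x [_]; apply.
  exact: lexx.
have jE (j : int * dyadic n) : dnorm (cell j.2) (fun y => (tau (j.1 + 1))%:E * V y) =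
    (tau (j.1 + 1))%:E * (wt j.2)%:E by rewrite dnormZ// wtE.
under eq_esum do rewrite jE.
rewrite -(@esum_esum _ _ _ _ _ (fun l Q => (tau (l + 1))%:E * (wt Q)%:E)); last first.
  by move=> l Q _ _; rewrite mule_ge0.
by apply: le_esum => l _; rewrite esumZl ?(ltW (tau_gt0 _)).
Qed.

Let part_le_tail P : part P <= tail.
Proof.
apply: le_esum => l _; apply: lee_wpmul2l => //; apply: le_esum_subset => //.
by move=> Q [].
Qed.

(** A bad cube has weight at most [tail / tau k], so [wt_growth] bounds the levels of bad cubes
    above [P]. *)
Let bad_in_maximal P : tail < +oo -> bad P -> exists2 S, maxbad S & sub P S.
Proof.
move=> Tfin badP; have T0 : 0 <= tail by apply: esum_ge0 => l _; rewrite mule_ge0.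
pose B := (fine tail / tau k)%R.
have wtB S : bad S -> (wt S <= B)%R.
  move=> /lt_le_trans/(_ (part_le_tail S)).
  rewrite -[tail]fineK ?ge0_fin_numE// lte_fin => h1.
  by rewrite /B ler_pdivlMr// mulrC ltW.
have [k1 hk1] := wt_growth P B.
have lev S : bad S -> sub P S -> (S.1 <= P.1 + k1%:Z)%R.
  move=> bS PS; rewrite leNgt; apply/negP => lt.
  have TS : sub (anc (P.1 + k1%:Z)%R P) S.
    by apply: (@sub_linear R n _ _ P _ PS); [apply: sub_anc; rewrite lerDl|exact: ltW].
  by have := lt_le_trans hk1 (wt_mono TS); rewrite ltNge wtB.
pose T j : dyadic n := anc (P.1 + j%:Z)%R P.
have PT j : sub P (T j) by apply: sub_anc; rewrite lerDl.
have ex : exists j, `[< bad (T j) >].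
  by exists 0%N; apply/asboolP; rewrite /T addr0 -(sub_ancE (sub_refl P)).
have bd j : `[< bad (T j) >] -> (j <= k1)%N.
  by move=> /asboolP bT; have := lev _ bT (PT j); rewrite /= lerD2l lez_nat.
case: (ex_maxnP ex bd) => j /asboolP bj maxj; exists (T j) => //; split=> // S bS TS.
have PS : sub P S := sub_trans (PT j) TS.
have SE : S = T `|S.1 - P.1|%N.
  by rewrite [LHS](sub_ancE PS) /T; congr anc; have := PS.1; lia.
have := maxj `|S.1 - P.1|%N; rewrite -SE => /(_ (asboolT bS)) le.
by rewrite SE /T; congr anc; have := TS.1; have := PS.1; rewrite /=; lia.
Qed.

Let s : R := @star_wt_cst R n delta c0 a K.
Let s_gt0 : (0 < s)%R.
Proof. exact: (star_wt_cst_gt0 delta_gt0 delta_le c0_gt0 cell_content vK). Qed.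
Let Hw_star Q : Hw (star Q) <= s%:E * (wt Q)%:E.
Proof. by rewrite -EFinM; exact: (Hw_star delta_gt0 delta_le c0_gt0 cell_content vK). Qed.

(** A weak type estimate. A cube with large average lies in a covering cube or in a maximal bad
    cube, and passing to stars costs [s]. Badness replaces [wt P] by [part P / tau k]; maximal bad
    cubes are disjoint, so each covering cube enters at most one [part]. *)
Lemma wmax_level : Hw [set x | (2 * tau k)%:E < wmax h x] <= (2 * s / tau k)%:E * tail.
Proof.
have T0 : 0 <= tail by apply: esum_ge0 => l _; rewrite mule_ge0.
have st0 : (0 < s / tau k)%R by rewrite divr_gt0.
have [Tfin|] := ltP tail +oo; last first.
  rewrite leye_eq => /eqP ->; rewrite gt0_muley ?leey// lte_fin -mulrA mulr_gt0//.
pose U1 := \bigcup_(l in [set l | (k <= l)%R]) \bigcup_(Q in C l) star Q.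
pose U2 := \bigcup_(Q in maxbad) star Q.
apply: (@le_trans _ _ (Hw (U1 `|` U2))).
  apply: dcontent_subset => // x /ereal_sup_gt[_ [P Px <-] big].
  have {}big : (2 * tau k * wt P)%:E < dnorm (cell P) (fun y => h y * V y).
    by move: big; rewrite lte_pdivlMl// -EFinM mulrC.
  have [[l [Q [kl CQ PQ]]]|ncov] := pselect (exists l Q, [/\ (k <= l)%R, C l Q & sub P Q]).
    by left; exists l => //; exists Q => //; exact: (star_mono PQ).
  right; have badP : bad P.
    by apply: (not_covered_bad big) => l Q kl CQ PQ; apply: ncov; exists l, Q.
  by have [S mS PS] := bad_in_maximal Tfin badP; exists S => //; exact: (star_mono PS).
have -> : (2 * s / tau k = s / tau k + s / tau k)%R by field; rewrite gt_eqF.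
rewrite EFinD ge0_muleDl ?lee_fin ?(ltW st0)//.
apply: le_trans (dcontentU delta _ _ wt0) _; apply: leeD.
  apply: (@le_trans _ _ (\esum_(l in [set l | (k <= l)%R]) (s / tau k)%:E * ((tau (l + 1))%:E * Ch l))).
    apply: le_trans (@dcontent_sub _ _ delta _ [set l | (k <= l)%R] (fun l => \bigcup_(Q in C l) star Q) _ _ wt0 _) _.
      by apply: null_sub (null0 delta) => x [].
    apply: le_esum => l kl; apply: (@le_trans _ _ (s%:E * Ch l)).
      rewrite -esumZl ?(ltW s_gt0)//.
      apply: le_trans (@dcontent_sub _ _ delta _ (C l) star _ _ wt0 _) _.
        by apply: null_sub (null0 delta) => x [].
      by apply: le_esum => Q _; exact: Hw_star.
    rewrite muleA -EFinM; apply: lee_wpmul2r => //; rewrite lee_fin mulrAC ler_pdivlMr//.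
    apply: ler_wpM2l; first exact: ltW.
    by apply: (le_trans (le_tau kl)); apply: le_tau; rewrite lerDl.
  by rewrite esumZl ?(ltW st0)// => l; rewrite mule_ge0.
apply: le_trans (@dcontent_sub _ _ delta _ maxbad star _ _ wt0 _) _.
  by apply: null_sub (null0 delta) => x [].
apply: (@le_trans _ _ (\esum_(P in maxbad) (s / tau k)%:E * part P)).
  apply: le_esum => P [bP _]; apply: (le_trans (Hw_star P)).
  apply: (@le_trans _ _ (s%:E * ((tau k)^-1%:E * part P))); last by rewrite muleA -EFinM.
  apply: lee_wpmul2l; first by rewrite lee_fin ltW.
  by rewrite lee_pdivlMl// -EFinM ltW.
have part0 P : 0 <= part P.
  by apply: esum_ge0 => l _; rewrite mule_ge0// esum_ge0.
rewrite (esumZl _ (ltW st0) part0); apply: lee_wpmul2l; first by rewrite lee_fin ltW.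
rewrite (@esum_exchange _ _ _ _ _ [set l | (k <= l)%R] (fun=> maxbad)); last 2 first.
- by move=> P l; split=> -[].
- by move=> P l _ _; rewrite mule_ge0// esum_ge0.
apply: le_esum => l _; rewrite esumZl ?(ltW (tau_gt0 _))//; last first.
  by move=> P; exact: esum_ge0.
apply: lee_wpmul2l => //; apply: esum_disjoint_le => // [P Q _ [] //|].
move=> P P' Q [bP mP] [bP' mP'] [_ QP] [_ QP'].
have [PP'|PP'] := cell_sub_or QP.2 QP'.2; first by rewrite (mP _ bP' PP').
by rewrite (mP' _ bP PP').
Qed.

End fixed_level.

Let s : R := @star_wt_cst R n delta c0 a K.
Let b : R := (1 - q^-1)%R.
Let b_gt0 : (0 < b)%R. Proof. by rewrite subr_gt0 invf_lt1. Qed.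

(** Marcinkiewicz summation. After exchanging the sums, the levels [k <= l] contribute the sum of
    [2^k / tau k = 2^(k(1-1/q))], comparable to its last term because [q > 1]. *)
Lemma wmax_levels_cover :
  \esum_(k in [set: int]) (mesh k)%:E * Hw [set x | (2 * tau k)%:E < wmax h x] <=
  (2 * s * geo_cst b * 2 `^ q^-1)%:E * \esum_(l in [set: int]) (mesh l)%:E * Ch l.
Proof.
have s_gt0 : (0 < s)%R by exact: (star_wt_cst_gt0 delta_gt0 delta_le c0_gt0 cell_content vK).
have g_gt0 := geo_cst_gt0 b_gt0.
have p_gt0 : (0 < 2 `^ q^-1 :> R)%R by rewrite powR_gt0.
have tau0 l : 0 <= (tau l)%:E by rewrite lee_fin ltW.
have Ch0 l : 0 <= Ch l by exact: esum_ge0.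
have mtau k : (mesh k / tau k = mesh k `^ b)%R.
  by rewrite /b powRB ?(gt_eqF (m0 _)) ?implybT// powRr1// ltW.
have cst0 k : (0 <= 2 * s * mesh k `^ b)%R.
  exact: mulr_ge0 (mulr_ge0 (ler0n _ 2) (ltW s_gt0)) (powR_ge0 _ _).
apply: (@le_trans _ _ (\esum_(k in [set: int]) \esum_(l in [set l | (k <= l)%R])
    (2 * s * mesh k `^ b)%:E * ((tau (l + 1))%:E * Ch l))).
  apply: le_esum => k _; rewrite esumZl//; last by move=> l; rewrite mule_ge0.
  apply: le_trans (lee_wpmul2l _ (wmax_level k)) _; first by rewrite lee_fin ltW.
  by rewrite muleA -EFinM -mtau; have -> : (mesh k * (2 * s / tau k) = 2 * s * (mesh k / tau k))%R by ring.
rewrite (@esum_exchange _ _ _ _ _ setT (fun l => [set k | (k <= l)%R])); last 2 first.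
- by move=> k l /=; split=> -[].
- by move=> k l _ _; apply: mule_ge0; rewrite ?lee_fin// mule_ge0.
have C0 : (0 <= 2 * s * geo_cst b * 2 `^ q^-1)%R.
  exact: mulr_ge0 (mulr_ge0 (mulr_ge0 (ler0n _ 2) (ltW s_gt0)) (ltW g_gt0)) (ltW p_gt0).
rewrite -(esumZl _ C0); last by move=> l; rewrite mule_ge0// lee_fin ltW.
apply: le_esum => l _.
apply: le_trans (esumZr _ _ _) _ => //; first by rewrite mule_ge0.
under eq_esum do rewrite EFinM.
rewrite (esumZl _ (mulr_ge0 (ler0n _ 2) (ltW s_gt0))); last by move=> k; rewrite lee_fin powR_ge0.
apply: le_trans (lee_wpmul2r _ (lee_wpmul2l _ (esum_mesh_le l b_gt0))) _.
- by rewrite mule_ge0.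
- by rewrite lee_fin; exact: mulr_ge0 (ler0n _ 2) (ltW s_gt0).
rewrite !muleA -!EFinM; apply: lee_wpmul2r => //.
rewrite lee_fin tauS -mtau le_eqVlt; apply/orP; left; apply/eqP.
by field; rewrite gt_eqF.
Qed.

End level_covers.

Let s : R := @star_wt_cst R n delta c0 a K.
Let s_gt0 : (0 < s)%R.
Proof. exact: (star_wt_cst_gt0 delta_gt0 delta_le c0_gt0 cell_content vK). Qed.

(** The coverings were arbitrary, chosen independently at each level; the infimum over them turns
    the covering sums into [Hw]. *)
Lemma wmax_levels h : (forall x, 0 <= h x) ->
  \esum_(k in [set: int]) (mesh k)%:E * Hw [set x | (2 * tau k)%:E < wmax h x] <=
  (2 * s * geo_cst (1 - q^-1) * 2 `^ q^-1)%:E *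
    \esum_(l in [set: int]) (mesh l)%:E * Hw [set x | (tau l)%:E < h x].
Proof.
move=> h0.
have g_gt0 : (0 < geo_cst (1 - q^-1))%R by rewrite geo_cst_gt0// subr_gt0 invf_lt1.
have C0 : (0 < 2 * s * geo_cst (1 - q^-1) * 2 `^ q^-1)%R.
  exact: mulr_gt0 (mulr_gt0 (mulr_gt0 (ltr0n _ 2) s_gt0) g_gt0) (powR_gt0 _ (ltr0n _ 2)).
rewrite -lee_pdivrMl//.
pose X l := [set \esum_(Q in C) (wt Q)%:E | C in covers delta [set x | (tau l)%:E < h x]].
have infX l : (mesh l)%:E * Hw [set x | (tau l)%:E < h x] =
    ereal_inf [set (mesh l)%:E * y | y in X l] by rewrite ereal_inf_pZl.
rewrite [leRHS](eq_esum (fun l _ => infX l)).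
apply: ereal_inf_esum_le.
  by move=> l _ [_ [C _ <-] <-]; rewrite mule_ge0 ?esum_ge0// lee_fin ltW.
move=> y Hy; have /choice[C HC] : forall l, exists C,
    covers delta [set x | (tau l)%:E < h x] C /\ y l = (mesh l)%:E * \esum_(Q in C) (wt Q)%:E.
  by move=> l; have [_ [C hC <-] <-] := Hy l I; exists C.
rewrite lee_pdivrMl//; apply: le_trans (wmax_levels_cover h0 (fun l => (HC l).1)) _.
apply: lee_wpmul2l; first by rewrite lee_fin ltW.
by apply: le_esum => l _; rewrite (HC l).2.
Qed.

Lemma wmax_bound : exists2 M : R, (0 < M)%R & forall h, (forall x, 0 <= h x) ->
  dnorm setT (fun x => wmax h x `^ q * V x) <= M%:E * dnorm setT (fun x => h x `^ q * V x).
Proof.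
have g_gt0 : (0 < geo_cst (1 - q^-1))%R by rewrite geo_cst_gt0// subr_gt0 invf_lt1.
pose C := (2 * s * geo_cst (1 - q^-1) * 2 `^ q^-1)%R.
have C0 : (0 < C)%R.
  exact: mulr_gt0 (mulr_gt0 (mulr_gt0 (ltr0n _ 2) s_gt0) g_gt0) (powR_gt0 _ (ltr0n _ 2)).
pose C' := (2 * @low_cst R n delta a K * @level_cst R n delta)%R.
have C'0 : (0 < C')%R.
  by rewrite mulr_gt0 ?level_cst_gt0// mulr_gt0// (low_cst_gt0 delta_gt0 delta_le c0_gt0 cell_content vK).
have q2 : (0 < (2 : R) `^ q)%R by rewrite powR_gt0.
exists (2 `^ q * (2 * (C * C')))%R.
  exact: mulr_gt0 q2 (mulr_gt0 (ltr0n _ 2) (mulr_gt0 C0 C'0)).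
move=> h h0.
(* Halving absorbs the factor [2] in the level sets [{wmax h > 2 tau k}]. *)
pose u x := (2^-1%:E * wmax h x) `^ q.
have half0 x : 0 <= 2^-1%:E * wmax h x by rewrite mule_ge0 ?wmax_ge0.
have uE x : wmax h x `^ q * V x = (2 `^ q)%:E * (u x * V x).
  rewrite muleA -poweR_EFin /u -poweRM// muleA -EFinM mulfV// mul1e//.
under [X in dnorm _ X]eq_fun do rewrite uE.
rewrite dnormZ// [leRHS](_ : _ = (2 `^ q)%:E * (2%:E * (C%:E * (C'%:E *
  dnorm setT (fun x => h x `^ q * V x))))); last by rewrite !muleA -!EFinM !mulrA.
apply: lee_wpmul2l; first by rewrite lee_fin powR_ge0.
have u0 x : 0 <= u x by exact: poweR_ge0.
apply: le_trans (dnorm_le_wt_levels delta_gt0 delta_le c0_gt0 cell_content vK u0) _.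
apply: lee_wpmul2l => //.
have tauq l : (tau l `^ q = mesh l)%R.
  by rewrite /tau -powRrM mulVf ?gt_eqF// powRr1// ltW.
have taun0 l : (0 <= tau l)%R by rewrite ltW.
apply: (@le_trans _ _ (\esum_(k in [set: int]) (mesh k)%:E * Hw [set x | (2 * tau k)%:E < wmax h x])).
  apply: le_esum => k _; apply: lee_wpmul2l; first by rewrite lee_fin ltW.
  apply: dcontent_subset => // x /=; rewrite -tauq => /(poweR_gtN q_gt0 (taun0 k) (half0 x)).
  by rewrite lte_pdivlMl// -EFinM.
apply: le_trans (wmax_levels h0) _; apply: lee_wpmul2l; first by rewrite lee_fin ltW.
have hq0 x : 0 <= h x `^ q by exact: poweR_ge0.
apply: le_trans (wt_levels_le_dnorm delta_gt0 delta_le c0_gt0 cell_content vK hq0).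
apply: le_esum => k _; apply: lee_wpmul2l; first by rewrite lee_fin ltW.
apply: dcontent_subset => // x /=; rewrite -tauq; exact: poweR_ltN.
Qed.

End weighted_maximal_function.

(** * The maximal theorem for Muckenhoupt weights *)

Section maximal_theorem.
Context {R : realType} {n : nat} (delta : R).
Hypotheses (delta_gt0 : (0 < delta)%R) (delta_le : (delta <= n%:R)%R).
Implicit Types (P Q S : dyadic n) (A B E : set 'rV[R]_n) (f g h : 'rV[R]_n -> \bar R).
Local Notation ell := (@ell R n delta).
Local Notation cell := (@cell R n).
Local Notation star := (@star R n).
Local Notation dnorm := (@dnorm R n delta).

Definition dmax f (x : 'rV[R]_n) : \bar R :=
  ereal_sup [set (ell P)^-1%:E * dnorm (cell P) f | P in [set P | star P x]].

Lemma dmax_ge f P x : star P x -> (ell P)^-1%:E * dnorm (cell P) f <= dmax f x.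
Proof. by move=> Px; apply: ereal_sup_ubound; exists P. Qed.

Lemma dmax_ge0 f x : 0 <= dmax f x.
Proof.
apply: le_trans (dmax_ge f (sub_star (at_levelP 0%R x))).
by rewrite mule_ge0 ?dnorm_ge0// lee_fin invr_ge0 ell_ge0.
Qed.

Variables (c0 : R).
Hypotheses (c0_gt0 : (0 < c0)%R) (cell_content : forall P, (c0 * ell P)%:E <= hcontent delta (cell P)).

Let u : R := @unit_cst R n delta c0.
Let u_gt0 : (0 < u)%R. Proof. exact: unit_cst_gt0. Qed.
Let e_gt0 Q : (0 < ell Q)%R. Proof. exact: ell_gt0. Qed.

Lemma dnorm_cell_cst_ge P c : 0 <= c -> (u * ell P)%:E * c <= dnorm (cell P) (fun=> c).
Proof.
have one := dnorm_cell1_ge delta_gt0 delta_le cell_content P.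
have ue : (0 < u * ell P)%R by rewrite mulr_gt0.
have fin (r : R) : (0 < r)%R -> (u * ell P)%:E * r%:E <= dnorm (cell P) (fun=> r%:E).
  move=> r0; have := dnormZ delta (cell P) (fun=> 1) r0.
  under [X in dnorm _ X]eq_fun do rewrite mule1.
  by move=> ->; rewrite muleC; apply: lee_wpmul2l => //; rewrite lee_fin ltW.
case: c => [r| |] //.
  rewrite lee_fin le_eqVlt => /orP[/eqP <-|r0]; last exact: (fin _ r0).
  by rewrite mule0 dnorm_ge0.
move=> _; rewrite gt0_muley ?lte_fin// leye_eq; apply/eqP/eq_infty => t.
have [t0|t0] := leP t 0%R; first by rewrite (@le_trans _ _ 0)// ?lee_fin ?dnorm_ge0.
have r0 : (0 < t / (u * ell P))%R by rewrite divr_gt0.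
apply: (@le_trans _ _ (dnorm (cell P) (fun=> (t / (u * ell P))%:E))).
  by apply: le_trans (fin _ r0); rewrite -EFinM mulrC divfK// gt_eqF.
by apply: dnorm_mono => // x _; exact: leey.
Qed.

Variables (w : 'rV[R]_n -> R) (p K : R).
Hypothesis p_gt1 : (1 < p)%R.

Let sigma x : R := (w x `^ (- (p - 1)^-1))%R.

(** Stars on both sides keep the condition symmetric under duality; restricting one average or the
    other to the cell gives [wpair] and [spair]. *)
Definition Ap_pair :=
  [/\ forall x, (0 < w x)%R,
    forall Q, dnorm (star Q) (fun x => (w x)%:E) < +oo,
    forall Q, dnorm (star Q) (fun x => (sigma x)%:E) < +oo &
    forall Q, ((fine (dnorm (star Q) (fun x => (w x)%:E)) / ell Q) `^ (p - 1)^-1 *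
      (fine (dnorm (star Q) (fun x => (sigma x)%:E)) / ell Q) <= K)%R].

Hypothesis wK : Ap_pair.

Let p1_gt0 : (0 < p - 1)%R. Proof. by rewrite subr_gt0. Qed.
Let w_gt0 x : (0 < w x)%R. Proof. by case: wK. Qed.
Let sigma_gt0 x : (0 < sigma x)%R. Proof. by rewrite powR_gt0. Qed.
Let w0 x : 0 <= (w x)%:E. Proof. by rewrite lee_fin ltW. Qed.
Let sigma0 x : 0 <= (sigma x)%:E. Proof. by rewrite lee_fin ltW. Qed.

Let fine_mono f Q : (forall x, 0 <= f x) -> dnorm (star Q) f < +oo ->
  (0 <= fine (dnorm (cell Q) f) / ell Q <= fine (dnorm (star Q) f) / ell Q)%R.
Proof.
move=> f0 fin; have le : dnorm (cell Q) f <= dnorm (star Q) f.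
  by apply: dnorm_mono => //; exact: sub_star.
rewrite divr_ge0 ?fine_ge0 ?dnorm_ge0 ?(ltW (e_gt0 _))//=.
rewrite ler_pM2r ?invr_gt0//; apply: fine_le => //.
  by rewrite ge0_fin_numE ?dnorm_ge0// (le_lt_trans le).
by rewrite ge0_fin_numE ?dnorm_ge0.
Qed.

Let wpair : avg_pair_le delta w (p - 1)^-1 K.
Proof.
case: wK => _ wf sf le; split=> //; first by rewrite invr_gt0.
  move=> Q; apply: le_lt_trans (sf Q); apply: dnorm_mono => //; exact: sub_star.
move=> Q; apply: le_trans (le Q); apply: ler_wpM2l; first exact: powR_ge0.
by have /andP[] := fine_mono sigma0 (sf Q).
Qed.

Let spair : avg_pair_le delta sigma (p - 1) (K `^ (p - 1)).
Proof.
case: wK => _ wf sf le.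
have sw : (fun x => (sigma x `^ (- (p - 1)))%:E) = (fun x => (w x)%:E).
  apply/funext => x; rewrite /sigma -powRrM mulrNN mulVf ?gt_eqF// powRr1//.
  exact: ltW.
rewrite /avg_pair_le sw; split=> // Q.
  by apply: le_lt_trans (wf Q); apply: dnorm_mono => //; exact: sub_star.
have /andP[a0 a1] := fine_mono w0 (wf Q); have /andP[b0 b1] := fine_mono sigma0 (sf Q).
have := le Q; set x := (fine (dnorm (star Q) (fun x => (w x)%:E)) / ell Q)%R.
set y := (fine (dnorm (star Q) (fun x => (sigma x)%:E)) / ell Q)%R => xyK.
have x0 : (0 <= x)%R := le_trans a0 a1; have y0 : (0 <= y)%R := le_trans b0 b1.
apply: (@le_trans _ _ (y `^ (p - 1) * x)%R); first by apply: ler_wpM2l => //; exact: powR_ge0.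
have -> : (y `^ (p - 1) * x = (x `^ (p - 1)^-1 * y) `^ (p - 1))%R.
  by rewrite powRM ?powR_ge0// -powRrM mulVf ?gt_eqF// powRr1// mulrC.
have xy0 : (0 <= x `^ (p - 1)^-1 * y)%R by rewrite mulr_ge0 ?powR_ge0.
have K0 : (0 <= K)%R := le_trans xy0 xyK.
by apply: ge0_ler_powR; rewrite ?nnegrE ?(ltW p1_gt0).
Qed.

Let K' : R := (K `^ (p - 1) / u)%R.
Let wtw := @wt R n delta w.
Let wts := @wt R n delta sigma.
Let wtw_gt0 Q : (0 < wtw Q)%R.
Proof. exact: (wt_gt0 delta_gt0 delta_le c0_gt0 cell_content wpair). Qed.
Let wts_gt0 Q : (0 < wts Q)%R.
Proof. exact: (wt_gt0 delta_gt0 delta_le c0_gt0 cell_content spair). Qed.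

Let ratio Q : ((wts Q / ell Q) `^ (p - 1) <= K `^ (p - 1) * (ell Q / wtw Q))%R.
Proof.
have [_ _ _ _ /(_ Q)le] := spair; have [_ _ sf _] := wK.
have sw : (fun x => (sigma x `^ (- (p - 1)))%:E) = (fun x => (w x)%:E).
  apply/funext => x; rewrite /sigma -powRrM mulrNN mulVf ?gt_eqF// powRr1//.
  exact: ltW.
rewrite sw in le.
have /andP[h1 h2] := fine_mono sigma0 (sf Q).
have we0 : (0 < wtw Q / ell Q)%R by rewrite divr_gt0.
have -> : (ell Q / wtw Q = (wtw Q / ell Q)^-1)%R by rewrite invf_div.
rewrite (ler_pdivlMr _ _ we0).
have hp : ((wts Q / ell Q) `^ (p - 1) <=
    (fine (dnorm (star Q) (fun x => (sigma x)%:E)) / ell Q) `^ (p - 1))%R.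
  apply: (ge0_ler_powR _ _ _ h2); first exact: ltW.
    by rewrite nnegrE.
  rewrite nnegrE; exact: le_trans h1 h2.
exact: le_trans (ler_wpM2r (ltW we0) hp) le.
Qed.

(* Lerner's pointwise bound. *)
Lemma dmax_le_wmax f x : (forall x, 0 <= f x) ->
  dmax f x `^ (p - 1) <= K'%:E * wmax delta w (fun y => wmax delta sigma
    (fun z => f z * (sigma z)^-1%:E) y `^ (p - 1) * (w y)^-1%:E) x.
Proof.
move=> f0; set g := fun z => f z * _; set h := fun y => _ * (w y)^-1%:E.
have K0 : (0 < K)%R := K_gt0 delta_gt0 delta_le c0_gt0 cell_content wpair.
have K'0 : (0 < K')%R by rewrite divr_gt0 ?powR_gt0.
have gs : (fun y => g y * (sigma y)%:E) = f.
  by apply/funext => y; rewrite /g -muleA -EFinM mulVf ?gt_eqF// mule1.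
have ms0 y : 0 <= wmax delta sigma g y.
  exact: (wmax_ge0 delta_gt0 delta_le c0_gt0 cell_content spair).
have hw : (fun y => h y * (w y)%:E) = (fun y => wmax delta sigma g y `^ (p - 1)).
  by apply/funext => y; rewrite /h -muleA -EFinM mulVf ?gt_eqF// mule1.
have mw0 y : 0 <= wmax delta w h y.
  exact: (wmax_ge0 delta_gt0 delta_le c0_gt0 cell_content wpair).
have B0 : 0 <= K'%:E * wmax delta w h x by rewrite mule_ge0// lee_fin ltW.
have inv1 y : 0 <= y -> (y `^ (p - 1)^-1) `^ (p - 1) = y.
  by move=> y0; rewrite -poweRrM mulVf ?gt_eqF// poweRe1.
have inv2 y : 0 <= y -> (y `^ (p - 1)) `^ (p - 1)^-1 = y.
  by move=> y0; rewrite -poweRrM mulfV ?gt_eqF// poweRe1.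
rewrite -[leRHS](inv1 _ B0).
apply: le_poweR; [exact: ltW|exact: dmax_ge0|].
apply: ge_ereal_sup => _ [P Px <-].
pose m := (wts P)^-1%:E * dnorm (cell P) f.
have m0 : 0 <= m by rewrite mule_ge0 ?dnorm_ge0// lee_fin invr_ge0 ltW.
have avgE : (ell P)^-1%:E * dnorm (cell P) f = (wts P / ell P)%:E * m.
  rewrite /m muleA -EFinM; congr (_%:E * _).
  by field; rewrite !gt_eqF.
(* The average [m] relative to [sigma] bounds the inner maximal function from below at every point
   of [P], so its power can be averaged once more over [P], relative to [w]. *)
have mle y : cell P y -> m <= wmax delta sigma g y.
  move=> Py; have := @wmax_ge R n delta sigma g P y (sub_star Py).
  by rewrite gs.
have key : (u * ell P)%:E * m `^ (p - 1) <= dnorm (cell P) (fun y => h y * (w y)%:E).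
  rewrite hw; apply: le_trans (dnorm_cell_cst_ge P (poweR_ge0 _ _)) _.
  apply: dnorm_mono => // y; last exact: poweR_ge0.
  by move=> /mle; apply: le_poweR => //; exact: ltW.
have se0 : 0 <= (wts P / ell P)%:E.
  by rewrite lee_fin divr_ge0 ?(ltW (e_gt0 _)) ?(ltW (wts_gt0 _)).
rewrite avgE -[leLHS](inv2 _ (mule_ge0 se0 m0)); apply: le_poweR.
- by rewrite invr_ge0 ltW.
- exact: poweR_ge0.
rewrite (poweRM _ se0 m0) poweR_EFin.
apply: (@le_trans _ _ ((K `^ (p - 1) * (ell P / wtw P))%:E * m `^ (p - 1))).
  by apply: lee_wpmul2r; [exact: poweR_ge0|rewrite lee_fin].
apply: (@le_trans _ _ (K'%:E * ((wtw P)^-1%:E * ((u * ell P)%:E * m `^ (p - 1))))).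
  rewrite !muleA -!EFinM; apply: lee_wpmul2r; first exact: poweR_ge0.
  rewrite lee_fin /K' le_eqVlt; apply/orP; left; apply/eqP; field.
  by rewrite !gt_eqF.
apply: lee_wpmul2l; first by rewrite lee_fin ltW.
apply: le_trans (@wmax_ge R n delta w h P x Px).
by apply: lee_wpmul2l => //; rewrite lee_fin invr_ge0 ltW.
Qed.

(** The exponents close up: [(p-1) p' = p] and [w^(1-p') = sigma] turn [h^p' w] into the [p]-th
    power of the inner maximal function times [sigma], and [g^p sigma = f^p w]. *)
Lemma dmax_bound : exists2 M : R, (0 < M)%R & forall f, (forall x, 0 <= f x) ->
  dnorm setT (fun x => dmax f x `^ p * (w x)%:E) <=
  M%:E * dnorm setT (fun x => f x `^ p * (w x)%:E).
Proof.
have K0 : (0 < K)%R := K_gt0 delta_gt0 delta_le c0_gt0 cell_content wpair.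
have K'0 : (0 < K')%R by rewrite divr_gt0 ?powR_gt0.
pose p' := (p / (p - 1))%R; have p'1 : (1 < p')%R.
  by rewrite ltr_pdivlMr// mul1r gtrBl.
have p'0 : (0 < p')%R := lt_trans ltr01 p'1.
have p0 : (0 < p)%R := lt_trans ltr01 p_gt1.
have pp' : ((p - 1) * p' = p)%R by rewrite mulrC divfK// gt_eqF.
have [Mw Mw0 HMw] := wmax_bound delta_gt0 delta_le c0_gt0 cell_content wpair p'1.
have [Ms Ms0 HMs] := wmax_bound delta_gt0 delta_le c0_gt0 cell_content spair p_gt1.
have K'p : (0 < K' `^ p')%R by rewrite powR_gt0.
exists (K' `^ p' * (Mw * Ms))%R; first exact: mulr_gt0 K'p (mulr_gt0 Mw0 Ms0).
move=> f f0.
pose g y := f y * (sigma y)^-1%:E.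
pose h y := wmax delta sigma g y `^ (p - 1) * (w y)^-1%:E.
have sinv0 y : 0 <= (sigma y)^-1%:E by rewrite lee_fin invr_ge0 ltW.
have winv0 y : 0 <= (w y)^-1%:E by rewrite lee_fin invr_ge0 ltW.
have g0 y : 0 <= g y by rewrite mule_ge0.
have ms0 y : 0 <= wmax delta sigma g y.
  exact: (wmax_ge0 delta_gt0 delta_le c0_gt0 cell_content spair).
have mw0 y : 0 <= wmax delta w h y.
  exact: (wmax_ge0 delta_gt0 delta_le c0_gt0 cell_content wpair).
have h0 y : 0 <= h y by rewrite mule_ge0 ?poweR_ge0.
rewrite !EFinM -!muleA.
apply: (@le_trans _ _ (dnorm setT (fun x => (K' `^ p')%:E * (wmax delta w h x `^ p' * (w x)%:E)))).
  apply: dnorm_mono => // x.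
    move=> _; rewrite muleA; apply: lee_wpmul2r => //.
    rewrite -{1}pp' poweRrM -poweR_EFin -poweRM//; last by rewrite lee_fin ltW.
    apply: le_poweR (ltW p'0) (poweR_ge0 _ _) _; exact: dmax_le_wmax.
  by rewrite mule_ge0 ?lee_fin ?(ltW K'p)// mule_ge0// poweR_ge0.
rewrite dnormZ//; apply: lee_wpmul2l; first by rewrite lee_fin ltW.
apply: le_trans (HMw _ h0) _; apply: lee_wpmul2l; first by rewrite lee_fin ltW.
have hE : (fun x => h x `^ p' * (w x)%:E) =
    (fun x => wmax delta sigma g x `^ p * (sigma x)%:E).
  apply/funext => x; rewrite /h poweRM ?poweR_ge0// -poweRrM pp' -muleA; congr (_ * _).
  rewrite poweR_EFin -EFinM; congr (_%:E); rewrite /sigma.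
  rewrite -(powR_inv1 (ltW (w_gt0 x))) -powRrM -{2}(powRr1 (ltW (w_gt0 x))) -powRD.
    by congr (_ `^ _)%R; rewrite /p'; field; rewrite gt_eqF.
  by rewrite (gt_eqF (w_gt0 x)) implybT.
rewrite hE; apply: le_trans (HMs _ g0) _; apply: lee_wpmul2l; first by rewrite lee_fin ltW.
rewrite (_ : (fun x => g x `^ p * (sigma x)%:E) = (fun x => f x `^ p * (w x)%:E))//.
apply/funext => x; rewrite /g poweRM// -muleA; congr (_ * _).
rewrite poweR_EFin -EFinM; congr (_%:E); rewrite /sigma.
rewrite -powRN opprK -powRrM -powRD; last by rewrite (gt_eqF (w_gt0 x)) implybT.
rewrite -[RHS](powRr1 (ltW (w_gt0 x))); congr (_ `^ _)%R.
by field; rewrite gt_eqF.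
Qed.

End maximal_theorem.

(** * Rubio de Francia iteration *)

Section minkowski.
Context {R : realType} {n : nat} (delta : R).
Local Notation dnorm := (@dnorm R n delta).

(** The graph of [x^r] lies above its tangent at [a], solved for [x]. *)
Lemma young_tangent (x : \bar R) (a r : R) : 0 <= x -> (0 < a)%R -> (1 <= r)%R ->
  x <= ((1 - r^-1) * a)%:E + (a `^ (1 - r) / r)%:E * x `^ r.
Proof.
move=> x0 a0 r1; have r0 : (0 < r)%R := lt_le_trans ltr01 r1.
have ar0 : (0 < a `^ (1 - r) / r)%R by rewrite divr_gt0 ?powR_gt0.
have c0 : (0 <= (1 - r^-1) * a)%R by rewrite mulr_ge0 ?(ltW a0)// subr_ge0 invf_le1.
case: x x0 => [x| |] // x0; last first.
  by rewrite poweRyr ?gt_eqF// gt0_muley ?lte_fin// addey// leey.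
rewrite lee_fin in x0; rewrite poweR_EFin -EFinM -EFinD lee_fin.
(* Separate because the conjugate exponent would be infinite. *)
have [->|rn1] := eqVneq r 1%R.
  by rewrite invr1 subrr mul0r add0r powRr0 mulr1 mul1r powRr1.
have r1' : (1 < r)%R by rewrite lt_neqAle eq_sym rn1.
pose q := (r / (r - 1))%R.
have q0 : (0 < q)%R by rewrite divr_gt0 ?subr_gt0.
have rm : (r - 1 != 0)%R by rewrite gt_eqF ?subr_gt0.
have rq : (r^-1 + q^-1 = 1)%R.
  by rewrite /q; field; rewrite rm gt_eqF.
have xa0 : (0 <= x / a)%R by rewrite divr_ge0// ltW.
have := @conjugate_powR R (x / a)%R 1%R r q xa0 ler01 r0 q0 rq.
rewrite mulr1 powR1 ler_pdivrMr// => /le_trans; apply.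
have -> : ((x / a) `^ r = x `^ r * a `^ (- r))%R.
  rewrite powRM ?invr_ge0 ?(ltW a0)//; congr (_ * _)%R.
  by rewrite -(powR_inv1 (ltW a0)) -powRrM mulN1r.
have -> : (a `^ (1 - r) = a * a `^ (- r))%R.
  by rewrite powRD ?powRr1 ?(ltW a0)// (gt_eqF a0) implybT.
have -> : (1 / q = 1 - r^-1)%R by rewrite div1r -rq addrAC subrr add0r.
by rewrite le_eqVlt; apply/orP; left; apply/eqP; field; rewrite gt_eqF.
Qed.

(** The tangent at [a = V^(1/r)], with [V] the right-hand side. Total weight at most one is enough
    since the constant term is nonnegative. *)
Lemma esum_jensen (th : nat -> R) (x : nat -> \bar R) (r : R) : (1 <= r)%R ->
  (forall k, 0 < th k)%R -> \esum_(k in [set: nat]) (th k)%:E <= 1 ->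
  (forall k, 0 <= x k) ->
  (\esum_(k in [set: nat]) (th k)%:E * x k) `^ r <= \esum_(k in [set: nat]) (th k)%:E * x k `^ r.
Proof.
move=> r1 th0 th1 x0; have r0 : (0 < r)%R := lt_le_trans ltr01 r1.
set V := \esum_(k in _) (_ * _ `^ r).
have t0 k : 0 <= (th k)%:E * x k `^ r by rewrite mule_ge0 ?poweR_ge0// lee_fin ltW.
have s0 k : 0 <= (th k)%:E * x k by rewrite mule_ge0// lee_fin ltW.
have V0 : 0 <= V by exact: esum_ge0.
have [Vfin|] := ltP V +oo; last by rewrite leye_eq => /eqP ->; rewrite leey.
have VE : V = (fine V)%:E by rewrite fineK// ge0_fin_numE.
have [VZ|Vn0] := eqVneq V 0.
  rewrite VZ esum1 ?poweR0r ?gt_eqF// => k _.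
  have : (th k)%:E * x k `^ r <= 0.
    by rewrite -VZ; exact: (@esum_lb _ _ setT (fun k => (th k)%:E * x k `^ r)).
  rewrite -lee_pdivlMl// mule0 => h.
  have /poweR_eq0_eq0 -> // : x k `^ r = 0; last by rewrite mule0.
  by apply/eqP; rewrite eq_le h poweR_ge0.
have v0 : (0 < fine V)%R by rewrite fine_gt0// lt_neqAle eq_sym Vn0 V0 Vfin.
pose a := (fine V `^ r^-1)%R; have a0 : (0 < a)%R by rewrite powR_gt0.
have c0 : (0 <= (1 - r^-1) * a)%R by rewrite mulr_ge0 ?(ltW a0)// subr_ge0 invf_le1.
have d0 : (0 <= a `^ (1 - r) / r)%R by rewrite divr_ge0 ?powR_ge0// ltW.
have le : \esum_(k in [set: nat]) (th k)%:E * x k <= a%:E.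
  apply: (@le_trans _ _ (\esum_(k in [set: nat]) (((1 - r^-1) * a)%:E * (th k)%:E +
      (a `^ (1 - r) / r)%:E * ((th k)%:E * x k `^ r)))).
    apply: le_esum => k _.
    apply: le_trans (lee_wpmul2l _ (young_tangent (x0 k) a0 r1)) _.
      by rewrite lee_fin ltW.
    rewrite ge0_muleDr ?lee_fin ?(ltW (th0 k))//; last first.
      by rewrite mule_ge0 ?poweR_ge0.
    by rewrite [X in X + _]muleC muleCA.
  rewrite esumD; last 2 first.
  - by move=> k _; rewrite mule_ge0// lee_fin ltW.
  - by move=> k _; rewrite mule_ge0.
  rewrite (esumZl _ c0); last by move=> k; rewrite lee_fin ltW.
  rewrite (esumZl _ d0 t0) -/V VE.
  apply: (@le_trans _ _ (((1 - r^-1) * a)%:E * 1 + (a `^ (1 - r) / r)%:E * (fine V)%:E)).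
    by apply: leeD2r; apply: lee_wpmul2l.
  rewrite mule1 -EFinM -EFinD lee_fin.
  have -> : (fine V = a `^ r)%R by rewrite /a -powRrM mulVf ?gt_eqF// powRr1// ltW.
  have -> : (a `^ (1 - r) / r * a `^ r = a / r)%R.
    rewrite mulrAC -powRD ?(gt_eqF a0) ?implybT//.
    by rewrite subrK powRr1// ltW.
  by rewrite le_eqVlt; apply/orP; left; apply/eqP; field; rewrite gt_eqF.
apply: le_trans (le_poweR (ltW r0) _ le) _; first exact: esum_ge0.
by rewrite poweR_EFin VE lee_fin /a -powRrM mulVf ?gt_eqF// powRr1// ltW.
Qed.

(** Jensen with weights [b k / B], proportional to the bounds on the single norms, reduces a power
    of a series to a series of powers, where countable subadditivity applies. [c] is the normalizing
    factor of an average. *)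
Lemma dnorm_minkowski A (c B r : R) (G : nat -> 'rV[R]_n -> \bar R) (b : nat -> R) :
  (1 <= r)%R -> (0 < c)%R -> (0 < B)%R -> (forall k, 0 < b k)%R ->
  (forall k x, 0 <= G k x) ->
  (forall k, c%:E * dnorm A (fun x => G k x `^ r) <= (b k `^ r)%:E) ->
  \esum_(k in [set: nat]) (b k)%:E <= B%:E ->
  c%:E * dnorm A (fun x => (\esum_(k in [set: nat]) G k x) `^ r) <= (B `^ r)%:E.
Proof.
move=> r1 c0 B0 b0 G0 Gb bB; have r0 : (0 < r)%R := lt_le_trans ltr01 r1.
pose th k := (b k / B)%R; have th0 k : (0 < th k)%R by rewrite divr_gt0.
have th1 : \esum_(k in [set: nat]) (th k)%:E <= 1.
  rewrite (_ : \esum_(k in _) _ = B^-1%:E * \esum_(k in [set: nat]) (b k)%:E).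
    by rewrite lee_pdivrMl// mule1.
  rewrite -esumZl ?invr_ge0 ?(ltW B0)//; last by move=> k; rewrite lee_fin ltW.
  by apply: eq_esum => k _; rewrite -EFinM mulrC.
have thr0 k : (0 < th k `^ (1 - r))%R by rewrite powR_gt0.
apply: (@le_trans _ _ (c%:E * \esum_(k in [set: nat])
    dnorm A (fun x => (th k `^ (1 - r))%:E * G k x `^ r))).
  apply: lee_wpmul2l; first by rewrite lee_fin ltW.
  apply: dnorm_sub; apply: null_sub (null0 delta) => x [Ax]; apply.
  have -> : [set j : nat | [set: nat] j /\ A x] = setT by apply/seteqP; split.
  have y0 k : 0 <= (th k)^-1%:E * G k x by rewrite mule_ge0// lee_fin invr_ge0 ltW.
  have := esum_jensen r1 th0 th1 y0.
  under eq_esum do rewrite muleA -EFinM mulfV ?gt_eqF// mul1e.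
  move=> /le_trans; apply; apply: le_esum => k _.
  rewrite poweRM//; last by rewrite lee_fin invr_ge0 ltW.
  rewrite muleA poweR_EFin -EFinM; apply: lee_wpmul2r; first exact: poweR_ge0.
  rewrite lee_fin -(powR_inv1 (ltW (th0 k))) -powRrM mulN1r.
  rewrite -{1}(powRr1 (ltW (th0 k))) -powRD ?(gt_eqF (th0 k)) ?implybT//.
rewrite -esumZl ?(ltW c0)//; last by move=> k; exact: dnorm_ge0.
have BrE : (B `^ r = B `^ (r - 1) * B)%R.
  by rewrite -{3}(powRr1 (ltW B0)) -powRD ?subrK// (gt_eqF B0) implybT.
rewrite BrE EFinM; apply: (le_trans _ (lee_wpmul2l _ bB)); last by rewrite lee_fin powR_ge0.
rewrite -esumZl ?powR_ge0//; last by move=> k; rewrite lee_fin ltW.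
apply: le_esum => k _; rewrite dnormZ// muleCA.
apply: le_trans (lee_wpmul2l _ (Gb k)) _; first by rewrite lee_fin ltW.
rewrite -!EFinM lee_fin /th powRM ?invr_ge0 ?(ltW B0) ?(ltW (b0 k))//.
have -> : (B^-1 `^ (1 - r) = B `^ (r - 1))%R.
  by rewrite -(powR_inv1 (ltW B0)) -powRrM; congr (_ `^ _)%R; ring.
rewrite mulrAC -powRD ?(gt_eqF (b0 k)) ?implybT// subrK powRr1 ?(ltW (b0 k))//.
by rewrite mulrC.
Qed.

End minkowski.

(** * A common majorant for two sublinear operators *)

Section rubio_de_francia.
Context {R : realType} {n : nat} (delta : R).
Hypotheses (delta_gt0 : (0 < delta)%R) (delta_le : (delta <= n%:R)%R).
Implicit Types (P Q : dyadic n) (f g h : 'rV[R]_n -> \bar R).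
Local Notation ell := (@ell R n delta).
Local Notation cell := (@cell R n).
Local Notation star := (@star R n).
Local Notation dnorm := (@dnorm R n delta).
Local Notation dmax := (@dmax R n delta).
Local Notation null := (@null R n delta).

Lemma poweR_add3 (x y z : \bar R) (q : R) : (0 <= q)%R -> 0 <= x -> 0 <= y -> 0 <= z ->
  (x + y + z) `^ q <= (3 `^ q)%:E * (x `^ q + y `^ q + z `^ q).
Proof.
move=> q0 x0 y0 z0.
have [m [m0 xm ym zm mle]] : exists m, [/\ 0 <= m, x <= m, y <= m, z <= m &
    m `^ q <= x `^ q + y `^ q + z `^ q].
  have [xy|/ltW yx] := leP x y; have [yz|/ltW zy] := leP y z; have [xz|/ltW zx] := leP x z.
  - by exists z; split=> //; rewrite leeDr// adde_ge0 ?poweR_ge0.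
  - by exists z; split=> //; [exact: le_trans yz|rewrite leeDr// adde_ge0 ?poweR_ge0].
  - exists y; split=> //; rewrite -addeA addeCA leeDl// adde_ge0 ?poweR_ge0//.
  - exists y; split=> //; rewrite -addeA addeCA leeDl// adde_ge0 ?poweR_ge0//.
  - by exists z; split=> //; rewrite leeDr// adde_ge0 ?poweR_ge0.
  - by exists x; split=> //; rewrite -addeA leeDl// adde_ge0 ?poweR_ge0.
  - exists x; split=> //; first exact: le_trans yx.
    by rewrite -addeA leeDl// adde_ge0 ?poweR_ge0.
  - by exists x; split=> //; rewrite -addeA leeDl// adde_ge0 ?poweR_ge0.
apply: (@le_trans _ _ ((3%:E * m) `^ q)).
  apply: le_poweR => //; first by rewrite !adde_ge0.
  have -> : 3%:E * m = m + m + m.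
    have -> : (3 = 1 + 1 + 1 :> R)%R by ring.
    by rewrite !EFinD !ge0_muleDl ?adde_ge0// !mul1e.
  by apply: leeD => //; apply: leeD.
by rewrite poweRM// poweR_EFin; apply: lee_wpmul2l => //; rewrite lee_fin powR_ge0.
Qed.

Lemma powR_expr_comm (a b : R) (k : nat) : (0 <= a)%R ->
  ((a ^+ k) `^ b = (a `^ b) ^+ k)%R.
Proof.
move=> a0; rewrite -(powR_mulrn _ a0) -(powR_mulrn _ (powR_ge0 a b)).
by rewrite -!powRrM mulrC.
Qed.

(** Seed of the iteration: constant on unit cells, with summable [q]-th powers. Being positive
    everywhere, it keeps [eta] positive everywhere. *)
Lemma exists_positive_dnorm_fin (q : R) : (0 < q)%R ->
  exists2 u : 'rV[R]_n -> R, (forall x, 0 < u x)%R &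
    dnorm setT (fun x => (u x)%:E `^ q) < +oo.
Proof.
move=> q0; pose e (m : {ffun 'I_n -> int}) : R := (1 / (2 ^ (pickle m).+1)%:R)%R.
have e0 m : (0 < e m)%R by rewrite divr_gt0// ltr0n expn_gt0.
exists (fun x => e (idx 0%R x) `^ q^-1)%R; first by move=> x; rewrite powR_gt0.
have uE x : (e (idx 0%R x) `^ q^-1)%:E `^ q = (e (idx 0%R x))%:E.
  by rewrite poweR_EFin -powRrM mulVf ?gt_eqF// powRr1// ltW.
under [X in dnorm _ X]eq_fun do rewrite uE.
apply: (@le_lt_trans _ _ (\esum_(m in [set: {ffun 'I_n -> int}])
    dnorm (cell (0%R, m)) (fun=> (e m)%:E))).
  apply: dnorm_sub; apply: null_sub (null0 delta) => x [_]; apply.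
  have m0 (m : {ffun 'I_n -> int}) : [set m | [set: {ffun 'I_n -> int}] m /\ cell (0%R, m) x] m -> 0 <= (e m)%:E.
    by rewrite lee_fin ltW.
  apply: (@esum_lb _ _ _ (fun m => (e m)%:E) (idx 0%R x)) => //.
  by split=> //; exact/idxP.
apply: (@le_lt_trans _ _ 1%:E); last exact: ltry.
apply: le_trans (esum_pickle_eps _ ltr01); apply: le_esum => m _.
have me0 : 0 <= (e m)%:E by rewrite lee_fin ltW.
apply: le_trans (dnorm_cell_cst delta _ me0) _.
by rewrite /ell /= /mesh expr0z powR1 mul1e.
Qed.

Variables (W : bool -> 'rV[R]_n -> R) (r t : bool -> R) (q C : R).
Hypotheses (W_gt0 : forall b x, (0 < W b x)%R) (r_ge1 : forall b, (1 <= r b)%R)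
  (q_gt0 : (0 < q)%R)
  (tr : forall b, (t b * r b = q)%R) (C_gt0 : (0 < C)%R).
Hypothesis dmaxW : forall b f, (forall x, 0 <= f x) ->
  dnorm setT (fun x => dmax f x `^ t b * (W b x)%:E) <=
  C%:E * dnorm setT (fun x => f x `^ t b * (W b x)%:E).

Let om b x : R := (W b x `^ q^-1)%R.
Let om_gt0 b x : (0 < om b x)%R. Proof. by rewrite powR_gt0. Qed.
Let r_gt0 b : (0 < r b)%R. Proof. exact: lt_le_trans ltr01 (r_ge1 b). Qed.
Let quot b h y := (om b y)^-1%:E * h y.
(** Conjugation by [W^(1/q)] and by the power [r b] turns the weighted bound with exponent [t b]
    into an unweighted bound with exponent [q], common to both values of [b]. *)
Let U b h x := (om b x)%:E * dmax (fun y => quot b h y `^ r b) x `^ (r b)^-1.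
Let T h x := h x + U false h x + U true h x.

Let quot0 b h y : (forall x, 0 <= h x) -> 0 <= quot b h y.
Proof. by move=> h0; rewrite mule_ge0// lee_fin invr_ge0 ltW. Qed.

Let U0 b h x : 0 <= U b h x.
Proof. by rewrite mule_ge0 ?poweR_ge0// lee_fin ltW. Qed.

Let T0 h : (forall x, 0 <= h x) -> forall x, 0 <= T h x.
Proof. by move=> h0 x; rewrite !adde_ge0. Qed.

Let U_leT b h x : (forall x, 0 <= h x) -> U b h x <= T h x.
Proof.
move=> h0; case: b; rewrite /T; first by apply: leeDr; rewrite adde_ge0.
by rewrite -addeA addeCA; apply: leeDl; rewrite adde_ge0.
Qed.

Let U_bound b h : (forall x, 0 <= h x) ->
  dnorm setT (fun x => U b h x `^ q) <= C%:E * dnorm setT (fun x => h x `^ q).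
Proof.
move=> h0.
have omq x : (om b x `^ q = W b x)%R.
  by rewrite /om -powRrM mulVf ?gt_eqF// powRr1// ltW.
have f0 y : 0 <= quot b h y `^ r b by exact: poweR_ge0.
have UE : (fun x => U b h x `^ q) =
    (fun x => dmax (fun y => quot b h y `^ r b) x `^ t b * (W b x)%:E).
  apply/funext => x; rewrite /U poweRM ?poweR_ge0 ?lee_fin ?(ltW (om_gt0 _ _))//.
  rewrite poweR_EFin omq muleC -poweRrM; congr (_ `^ _ * _).
  by rewrite -(tr b) mulrCA mulVf ?mulr1// gt_eqF.
rewrite UE; apply: le_trans (dmaxW b f0) _; apply: lee_wpmul2l; first by rewrite lee_fin ltW.
rewrite (_ : (fun x => (quot b h x `^ r b) `^ t b * (W b x)%:E) = (fun x => h x `^ q))//.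
apply/funext => x; rewrite -poweRrM mulrC tr /quot poweRM ?lee_fin ?invr_ge0 ?(ltW (om_gt0 _ _))//.
rewrite poweR_EFin muleAC -EFinM -omq.
rewrite -powRM ?invr_ge0 ?(ltW (om_gt0 _ _))// mulVf ?gt_eqF// powR1 mul1e.
by [].
Qed.

Let CT : R := (3 `^ q * (1 + C + C))%R.
Let CT_gt0 : (0 < CT)%R.
Proof. by rewrite mulr_gt0 ?powR_gt0// !addr_gt0. Qed.

Let T_bound h : (forall x, 0 <= h x) ->
  dnorm setT (fun x => T h x `^ q) <= CT%:E * dnorm setT (fun x => h x `^ q).
Proof.
move=> h0; have c3 : (0 < 3 `^ q :> R)%R by rewrite powR_gt0.
have N0 := dnorm_ge0 delta setT (fun x => h x `^ q).
have C0 : 0 <= C%:E by rewrite lee_fin ltW.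
apply: (@le_trans _ _ (dnorm setT (fun x => (3 `^ q)%:E *
    (h x `^ q + U false h x `^ q + U true h x `^ q)))).
  apply: dnorm_mono => // x.
    by move=> _; apply: poweR_add3 => //; exact: ltW.
  by rewrite mule_ge0 ?lee_fin ?(ltW c3)// !adde_ge0 ?poweR_ge0.
rewrite dnormZ// /CT EFinM -muleA; apply: lee_wpmul2l; first by rewrite lee_fin ltW.
apply: le_trans (dnormD delta _ _ _) _ => [x|x|]; [by rewrite adde_ge0 ?poweR_ge0|exact: poweR_ge0|].
rewrite !EFinD !ge0_muleDl ?adde_ge0 ?lee01// mul1e.
apply: leeD; last exact: U_bound.
apply: le_trans (dnormD delta _ _ _) _ => [x|x|]; [exact: poweR_ge0|exact: poweR_ge0|].
by apply: leeD; [exact: lexx|exact: U_bound].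
Qed.

Lemma rubio_de_francia : exists (eta : 'rV[R]_n -> \bar R) (th : R),
  [/\ (0 < th)%R, forall x, 0 < eta x, null [set x | eta x = +oo] &
   forall b x, eta x < +oo ->
     dmax (fun y => quot b eta y `^ r b) x <= (th `^ r b)%:E * quot b eta x `^ r b].
Proof.
have [u u0 ufin] := exists_positive_dnorm_fin q_gt0.
pose g k := iter k T (fun x => (u x)%:E).
have g0 k x : 0 <= g k x.
  elim: k x => [x|k IH x]; first by rewrite lee_fin ltW.
  exact: T0.
have gS k x : g k x <= g k.+1 x.
  by rewrite /g /= /T -addeA leeDl// adde_ge0.
have gu k x : (u x)%:E <= g k x.
  by elim: k => // k IH; exact: le_trans (gS k x).
pose N0 := fine (dnorm setT (fun x => (u x)%:E `^ q)).
have N00 : (0 <= N0)%R by rewrite fine_ge0// dnorm_ge0.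
have gN k : dnorm setT (fun x => g k x `^ q) <= (CT ^+ k * N0)%:E.
  elim: k => [|k IH].
    by rewrite expr0 mul1r /N0 fineK// ge0_fin_numE ?dnorm_ge0.
  apply: le_trans (T_bound (g0 k)) _.
  by rewrite exprS -mulrA [leRHS]EFinM; apply: lee_wpmul2l => //; rewrite lee_fin ltW.
(* Chosen so that the norms of [(la^k g_k)^q] decay like [2^-k]. *)
pose la : R := ((2 * CT)^-1 `^ q^-1)%R.
have la0 : (0 < la)%R by rewrite powR_gt0// invr_gt0 (mulr_gt0 _ CT_gt0).
have laq : (la `^ q * CT = 2^-1)%R.
  have ct0 : (0 < (2 * CT)^-1)%R by rewrite invr_gt0 (mulr_gt0 _ CT_gt0).
  rewrite /la -powRrM mulVf ?gt_eqF// (powRr1 (ltW ct0)).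
  by rewrite invfM mulfVK// gt_eqF.
(* The extra [2^-k] makes [eta] converge wherever the sequence [la^k g_k] is bounded. *)
pose s : R := (la / 2)%R.
have s0 : (0 < s)%R by rewrite divr_gt0.
have sk0 k : (0 < s ^+ k)%R by rewrite exprn_gt0.
have lk0 k : (0 < la ^+ k)%R by rewrite exprn_gt0.
pose eta x := \esum_(k in [set: nat]) (s ^+ k)%:E * g k x.
have t0 k x : 0 <= (s ^+ k)%:E * g k x by rewrite mule_ge0// lee_fin ltW.
have eta_ge k x : (s ^+ k)%:E * g k x <= eta x.
  exact: (@esum_lb _ _ setT (fun k => (s ^+ k)%:E * g k x)).
have eta0 x : 0 < eta x.
  by apply: lt_le_trans (eta_ge 0%N x); rewrite expr0 mul1e lte_fin.
exists eta, (s^-1)%R; split; [by rewrite invr_gt0|exact: eta0| |].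
(* [F] has finite norm, hence is finite almost everywhere, and there [la^k g_k <= F^(1/q)] for all
   [k]. *)
- pose F x := \esum_(k in [set: nat]) ((la ^+ k)%:E * g k x) `^ q.
  have F0 x : 0 <= F x by apply: esum_ge0 => k _; exact: poweR_ge0.
  have Ffin : dnorm setT F < +oo.
    apply: (@le_lt_trans _ _ (N0 / (1 - 2^-1))%:E); last exact: ltry.
    apply: (@le_trans _ _ (\esum_(k in [set: nat])
        dnorm setT (fun x => ((la ^+ k)%:E * g k x) `^ q))).
      apply: dnorm_sub; apply: null_sub (null0 delta) => x [_]; apply.
      by apply: le_esum_subset => // k _; exact: poweR_ge0.
    apply: le_trans (esum_geometric N00 _); last by rewrite invr_ge0 invf_lt1// ltr1n ler0n.
    apply: le_esum => k _.
    have lq x : ((la ^+ k)%:E * g k x) `^ q = ((la ^+ k) `^ q)%:E * g k x `^ q.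
      by rewrite poweRM ?lee_fin ?(ltW (lk0 k))// poweR_EFin.
    under [X in dnorm _ X]eq_fun do rewrite lq.
    rewrite dnormZ ?powR_gt0//.
    apply: le_trans (lee_wpmul2l _ (gN k)) _; first by rewrite lee_fin powR_ge0.
    rewrite -EFinM lee_fin mulrA (powR_expr_comm _ _ (ltW la0)) -exprMn laq mulrC.
    exact: lexx.
  apply: null_sub (dnorm_fin_ae delta_gt0 delta_le F0 Ffin) => x /= etax; split=> //.
  apply: contrapT => /eqP; rewrite -ltey => Fx.
  pose c := fine (F x `^ q^-1).
  have Fc : F x `^ q^-1 = c%:E.
    by rewrite fineK// ge0_fin_numE ?poweR_ge0// poweR_lty.
  have c0 : (0 <= c)%R by rewrite fine_ge0// poweR_ge0.
  suff : eta x <= (c / (1 - 2^-1))%:E by rewrite etax leye_eq.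
  apply: le_trans (esum_geometric c0 _); last by rewrite invr_ge0 invf_lt1// ltr1n ler0n.
  apply: le_esum => k _.
  have -> : (s ^+ k)%:E * g k x = (2^-1 ^+ k)%:E * ((la ^+ k)%:E * g k x).
    by rewrite muleA -EFinM -exprMn /s [(la / 2)%R]mulrC.
  rewrite mulrC EFinM; apply: lee_wpmul2l; first by rewrite lee_fin exprn_ge0// invr_ge0.
  have lg0 : 0 <= (la ^+ k)%:E * g k x by rewrite mule_ge0// lee_fin ltW.
  have -> : (la ^+ k)%:E * g k x = (((la ^+ k)%:E * g k x) `^ q) `^ q^-1.
    by rewrite -poweRrM mulfV ?gt_eqF// poweRe1.
  rewrite -Fc; apply: le_poweR; [by rewrite invr_ge0 ltW|exact: poweR_ge0|].
  by apply: (@esum_lb _ _ setT (fun k => ((la ^+ k)%:E * g k x) `^ q)) => // j _; exact: poweR_ge0.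
have U_le_T k b x : U b (g k) x <= g k.+1 x by apply: U_leT; exact: g0.
move=> b x etafin.
have [e e0 etaE] : exists2 e : R, (0 < e)%R & eta x = e%:E.
  exists (fine (eta x)); first by rewrite fine_gt0// eta0 etafin.
  by rewrite fineK// ge0_fin_numE// ltW.
have sk k : (s ^+ k)%:E * g k x < +oo by apply: le_lt_trans (eta_ge k x) etafin.
have gfin k : g k x < +oo.
  rewrite ltey; apply/eqP => goo; have := sk k.
  by rewrite goo gt0_muley ?lte_fin// ltxx.
have gE k : g k x = (fine (g k x))%:E by rewrite fineK// ge0_fin_numE.
have gk0 k : (0 < fine (g k x))%R.
  by rewrite fine_gt0// gfin andbT (lt_le_trans _ (gu k x))// lte_fin.
pose o := om b x; have o0 : (0 < o)%R := om_gt0 b x.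
pose bk k : R := (s ^+ k * fine (g k.+1 x) / o)%R.
have bk0 k : (0 < bk k)%R by rewrite divr_gt0// mulr_gt0.
pose B : R := (s^-1 * (o^-1 * e))%R.
have B0 : (0 < B)%R by rewrite !mulr_gt0// invr_gt0.
have BE : (s^-1 `^ r b)%:E * quot b eta x `^ r b = (B `^ r b)%:E.
  have oe0 : (0 <= o^-1 * e)%R by rewrite mulr_ge0 ?invr_ge0 ?(ltW o0) ?(ltW e0).
  have si0 : (0 <= s^-1)%R by rewrite invr_ge0 ltW.
  have -> : quot b eta x = (o^-1 * e)%:E by rewrite /quot etaE EFinM.
  rewrite poweR_EFin -EFinM; congr (_%:E).
  exact: esym (powRM _ si0 oe0).
rewrite BE; apply: ge_ereal_sup => _ [P Px <-].
pose G k y := quot b (fun y => (s ^+ k)%:E * g k y) y.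
have GE y : quot b eta y = \esum_(k in [set: nat]) G k y.
  by rewrite /quot /eta -esumZl// ?invr_ge0 ?(ltW (om_gt0 _ _)).
under [X in dnorm _ X]eq_fun do rewrite GE.
have eP : (0 < (ell P)^-1)%R by rewrite invr_gt0 ell_gt0.
apply: (dnorm_minkowski (r_ge1 b) eP B0 bk0).
- by move=> k y; apply: quot0.
- move=> k.
  have Gr y : G k y `^ r b = ((s ^+ k) `^ r b)%:E * quot b (g k) y `^ r b.
    have -> : G k y = (s ^+ k)%:E * quot b (g k) y by rewrite /G /quot muleCA.
    have sk1 : 0 <= (s ^+ k)%:E by rewrite lee_fin ltW.
    by rewrite (poweRM _ sk1 (quot0 b y (g0 k))) poweR_EFin.
  under [X in dnorm _ X]eq_fun do rewrite Gr.
  rewrite dnormZ ?powR_gt0// muleCA.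
  apply: (@le_trans _ _ (((s ^+ k) `^ r b)%:E * dmax (fun y => quot b (g k) y `^ r b) x)).
    by apply: lee_wpmul2l; [rewrite lee_fin powR_ge0|exact: dmax_ge].
  have Ug : U b (g k) x <= g k.+1 x := U_le_T k b x.
  have dm : dmax (fun y => quot b (g k) y `^ r b) x <= ((fine (g k.+1 x) / o) `^ r b)%:E.
    have M0 := dmax_ge0 delta (fun y => quot b (g k) y `^ r b) x.
    have -> : dmax (fun y => quot b (g k) y `^ r b) x =
        (dmax (fun y => quot b (g k) y `^ r b) x `^ (r b)^-1) `^ r b.
      by rewrite -poweRrM mulVf ?gt_eqF// poweRe1.
    rewrite -poweR_EFin.
    apply: le_poweR; [exact: ltW|exact: poweR_ge0|].
    rewrite EFinM muleC -gE lee_pdivlMl//.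
  apply: le_trans (lee_wpmul2l _ dm) _; first by rewrite lee_fin powR_ge0.
  rewrite -EFinM -powRM ?(ltW (sk0 k)) ?divr_ge0 ?(ltW o0) ?(ltW (gk0 _))//.
  by rewrite /bk mulrA.
- have bE k : (bk k)%:E = (s^-1 * o^-1)%:E * ((s ^+ k.+1)%:E * g k.+1 x).
    rewrite gE -!EFinM; congr (_%:E); rewrite /bk exprS; field.
    by rewrite !gt_eqF.
  under eq_esum do rewrite bE.
  rewrite esumZl ?mulr_ge0 ?invr_ge0 ?(ltW s0) ?(ltW o0)//.
  have so0 : 0 <= (s^-1 * o^-1)%:E.
    by rewrite lee_fin mulr_ge0 ?invr_ge0 ?(ltW s0) ?(ltW o0).
  have -> : B%:E = (s^-1 * o^-1)%:E * eta x by rewrite etaE -EFinM /B mulrA.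
  apply: lee_wpmul2l => //.
  rewrite -(@esum_image _ _ _ _ succn (fun k => (s ^+ k)%:E * g k x)); last first.
    by move=> i j _ _ [].
  exact: le_esum_subset.
Qed.

End rubio_de_francia.

(** * Capacitary weights *)

Section cubes.
Context {R : realType} {n : nat} (delta : R).
Hypotheses (delta_gt0 : (0 < delta)%R) (delta_le : (delta <= n%:R)%R).
Implicit Types (P : dyadic n) (Q : cube R n) (f g w : 'rV[R]_n -> \bar R).
Local Notation ell := (@ell R n delta).
Local Notation cell := (@cell R n).
Local Notation star := (@star R n).
Local Notation dnorm := (@dnorm R n delta).
Local Notation dmax := (@dmax R n delta).
Local Notation null := (@null R n delta).
Local Notation vol Q := (edge Q `^ delta)%R.

Lemma vol_gt0 Q : (0 < vol Q)%R.
Proof. by rewrite powR_gt0// edge_gt0. Qed.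

(** The cell of the centre with mesh between a quarter and a half of the edge. *)
Lemma cube_cell Q : exists2 P : dyadic n, cell P `<=` Q & (4^-1 `^ delta * vol Q <= ell P)%R.
Proof.
have e0 := edge_gt0 Q; have e2 : (0 < edge Q / 2)%R by rewrite divr_gt0.
have [k /andP[k1 k2]] := mesh_itv e2.
pose z : 'rV[R]_n := (\row_i (corner Q ord0 i + edge Q / 2))%R.
exists (at_level k z).
  move=> y Py i; have [p1 p2] := Py i; have [q1 q2] := at_levelP k z i.
  move: p1 p2 q1 q2; rewrite /= !mxE => p1 p2 q1 q2.
  set m := (_%:~R * _)%R in p1 p2 q1 q2; split; lra.
rewrite -powRM ?invr_ge0 ?(ltW e0)//; apply: ge0_ler_powR => //.
- exact: ltW.
- by rewrite nnegrE mulr_ge0 ?invr_ge0 ?(ltW e0).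
- by rewrite nnegrE ltW// mesh_gt0.
- by move: k2; rewrite meshS /=; lra.
Qed.

Lemma hcontent_cube_ge : exists2 c : R, (0 < c)%R &
  forall Q, (c * vol Q)%:E <= hcontent delta Q.
Proof.
have [c c0 cP] := @hcontent_cell_ge R n delta delta_gt0 delta_le.
exists (c * 4^-1 `^ delta)%R => [|Q]; first by rewrite mulr_gt0 ?powR_gt0.
have [P PQ lP] := cube_cell Q.
apply: le_trans (hcontent_le delta PQ); apply: le_trans (cP P).
by rewrite lee_fin -mulrA ler_pM2l.
Qed.

Lemma cube_not_null Q : ~ null Q.
Proof.
have [c c0 /(_ Q)] := hcontent_cube_ge.
move=> h e; move: h; rewrite e lee_fin leNgt mulr_gt0 ?vol_gt0//.
Qed.

Lemma average_le_dnorm : exists2 c : R, (0 < c)%R & forall Q f,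
  average delta Q f <= (c / vol Q)%:E * dnorm Q f.
Proof.
have [c c0 cQ] := hcontent_cube_ge; exists c^-1%R; first by rewrite invr_gt0.
move=> Q f; have v0 := vol_gt0 Q; have cv0 : (0 < c * vol Q)%R by rewrite mulr_gt0.
apply: lee_pmul; rewrite ?inve_ge0 ?hcontent_ge0 ?choquet_ge0//.
- by rewrite integral_ge0// => t _; exact: hcontent_ge0.
- apply: (@le_trans _ _ ((c * vol Q)%:E^-1)); last by rewrite inver gt_eqF// invfM.
  by rewrite lee_pV2// inE ?hcontent_ge0 ?lee_fin ?(ltW cv0).
- exact: choquet_le_dnorm.
Qed.

Lemma dnorm_le_average : exists2 c : R, (0 < c)%R & forall Q f, (forall x, 0 <= f x) ->
  dnorm Q f <= (c * vol Q)%:E * average delta Q f.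
Proof.
have L0 := level_cst_gt0 (R := R) (n := n) delta.
exists (2 * level_cst (n := n) delta)%R; first by rewrite mulr_gt0.
move=> Q f f0; apply: le_trans (dnorm_le_choquet delta_gt0 delta_le Q f0) _.
have [c c0 /(_ Q) cQ] := hcontent_cube_ge; have hQ := hcontent_cube delta Q.
have h0 : 0 < hcontent delta Q by apply: lt_le_trans cQ; rewrite lte_fin mulr_gt0 ?vol_gt0.
have hE : hcontent delta Q = (fine (hcontent delta Q))%:E.
  by rewrite fineK// ge0_fin_numE ?(ltW h0)// (le_lt_trans hQ)// ltry.
have ch0 : 0 <= choquet delta Q f.
  by rewrite integral_ge0// => t _; exact: hcontent_ge0.
rewrite /average (EFinM _ (vol Q)) -muleA; apply: lee_wpmul2l; first by rewrite lee_fin mulr_ge0// ltW.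
have hr : (0 < fine (hcontent delta Q))%R by rewrite -lte_fin -hE.
rewrite muleA -[leLHS]mul1e; apply: lee_wpmul2r => //.
rewrite hE inver gt_eqF// -EFinM lee_fin ler_pdivlMr// mul1r.
by rewrite -lee_fin -hE.
Qed.

Lemma compact_sub_cube (E : set 'rV[R]_n) : compact E -> exists Q : cube R n, E `<=` Q.
Proof.
move=> /compact_bounded [M [_ /(_ (`|M| + 1)%R)]].
have M0 : (0 < `|M| + 1)%R by rewrite ltr_wpDl.
have MM : (M < `|M| + 1)%R by rewrite (le_lt_trans (ler_norm M))// ltrDl.
move=> /(_ MM) EM.
have e0 : (0 < 4 * (`|M| + 1))%R by rewrite mulr_gt0.
exists (Cube (\row_(i < n) (- (2 * (`|M| + 1))))%R e0) => x Ex i.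
have : (`|x ord0 i| <= `|M| + 1)%R.
  apply: le_trans (EM x Ex).
  by rewrite /Num.Def.normr /= mx_normrE; apply: le_trans (le_bigmax_cond _ _ (j := (ord0, i)) _).
rewrite ler_norml /= mxE => /andP[h1 h2]; split; lra.
Qed.

Lemma cube_sub_compact Q : exists2 E : set 'rV[R]_n, compact E & (Q `<=` E).
Proof.
exists [set v : 'rV[R]_n | forall i, `[corner Q ord0 i, (corner Q ord0 i + edge Q)%R]%classic (v ord0 i)].
  by apply: (@rV_compact R n (fun i => `[corner Q ord0 i, (corner Q ord0 i + edge Q)%R]%classic)) => i; exact: segment_compact.
by move=> x Qx i; have [h1 h2] := Qx i; rewrite /= in_itv/= (ltW h1).
Qed.

(** Compact sets lie in cubes, and cubes lie in compact boxes. *)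
Lemma locally_finiteP f : (forall x, 0 <= f x) ->
  (forall E : set 'rV[R]_n, compact E -> choquet delta E f < +oo) <->
  (forall Q, dnorm Q f < +oo).
Proof.
move=> f0; split=> [H Q|H E cE].
  have [E cE QE] := cube_sub_compact Q.
  apply: le_lt_trans (dnorm_mono _ QE (fun x _ => lexx (f x)) f0) _.
  apply: le_lt_trans (dnorm_le_choquet delta_gt0 delta_le E f0) _.
  have c0 : 0 <= choquet delta E f by rewrite integral_ge0// => t _; exact: hcontent_ge0.
  by rewrite lte_mul_pinfty ?H// lee_fin mulr_ge0// ltW// level_cst_gt0.
have [Q EQ] := compact_sub_cube cE.
apply: le_lt_trans (choquet_le_dnorm delta_gt0 delta_le E f) _.
exact: le_lt_trans (dnorm_mono _ EQ (fun x _ => lexx (f x)) f0) (H Q).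
Qed.

(** [Q] is covered by the [3^n] neighbours of a cell of comparable size containing [x], and by
    symmetry of adjacency [x] lies in the star of each of them. *)
Lemma dnorm_cube_le_dmax : exists2 c : R, (0 < c)%R & forall Q f x,
  (forall x, 0 <= f x) -> cube_set Q x -> dnorm Q f <= (c * vol Q)%:E * dmax f x.
Proof.
pose c : R := ((3 ^ n)%:R * 2 `^ delta)%R.
have c0 : (0 < c)%R by rewrite mulr_gt0 ?powR_gt0// ltr0n expn_gt0.
exists c => // Q f x f0 Qx; have e0 := edge_gt0 Q; have v0 := vol_gt0 Q.
have cv0 : (0 < c * vol Q)%R by rewrite mulr_gt0.
have M0 := dmax_ge0 delta f x.
have [->|Mfin] := eqVneq (dmax f x) +oo; first by rewrite gt0_muley ?lte_fin// leey.
have ME : dmax f x = (fine (dmax f x))%:E by rewrite fineK// ge0_fin_numE// ltey.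
have [k /andP[k1 k2]] := mesh_itv e0; pose P := at_level (k + 1) x.
apply: (@le_trans _ _ (\esum_(e in [set: {ffun 'I_n -> 'I_3}]) dnorm (cell (nbr P e)) f)).
  apply: dnorm_bigcup => //; apply: null_sub (null0 delta) => y [Qy]; apply.
  by have [e] := star_nbr (cube_sub_star k2 Qx Qy); exists e.
have lP : (ell P <= 2 `^ delta * vol Q)%R.
  rewrite /ell /= meshS powRM ?(ltW (mesh_gt0 _))// ler_pM2l ?powR_gt0//.
  by apply: ge0_ler_powR; rewrite ?nnegrE ?(ltW delta_gt0) ?(ltW e0) ?(ltW k1) ?(ltW (mesh_gt0 _)).
rewrite ME /c -EFinM -!mulrA.
apply: (star_sum (phi' := fun P => dnorm (cell P) f)) => [|e].
  by rewrite mulr_ge0 ?powR_ge0// mulr_ge0 ?(ltW v0)// fine_ge0.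
have xe : star (nbr P e) x.
  rewrite (cell_at (cell_tip (R := R) (nbr P e))); apply: star_sym.
  exact: sub_star_nbr (cell_tip _).
have := dmax_ge delta f xe; have -> : ell (nbr P e) = ell P by [].
rewrite ME lee_pdivrMl ?ell_gt0// => /le_trans; apply.
by rewrite -EFinM lee_fin mulrA ler_wpM2r// fine_ge0.
Qed.

End cubes.

(** * The weight classes in terms of the dyadic norm *)

Section classes.
Context {R : realType} {n : nat} (delta : R).
Hypotheses (delta_gt0 : (0 < delta)%R) (delta_le : (delta <= n%:R)%R).
Implicit Types (P : dyadic n) (Q : cube R n) (f g w : 'rV[R]_n -> \bar R).
Local Notation ell := (@ell R n delta).
Local Notation cell := (@cell R n).
Local Notation star := (@star R n).
Local Notation dnorm := (@dnorm R n delta).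
Local Notation dmax := (@dmax R n delta).
Local Notation null := (@null R n delta).
Local Notation vol Q := (edge Q `^ delta)%R.

Lemma ae_le_cap_maximalP w : (forall x, 0 <= w x) ->
  (exists2 K : R, (0 < K)%R & null [set x | ~ cap_maximal delta w x <= K%:E * w x]) <->
  (exists2 K : R, (0 < K)%R &
    null [set x | ~ forall Q, cube_set Q x -> dnorm Q w <= (K * vol Q)%:E * w x]).
Proof.
move=> w0; have absw : (fun y => `|w y|) = w by apply/funext => y; rewrite gee0_abs.
rewrite /cap_maximal absw; split=> -[K K0 KN].
  have [c c0 cQ] := dnorm_le_average delta_gt0 delta_le.
  exists (c * K)%R; first by rewrite mulr_gt0.
  apply: null_sub KN => x; apply: contra_not => H Q Qx.
  have cv0 : (0 < c * vol Q)%R by rewrite mulr_gt0 ?vol_gt0.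
  apply: le_trans (cQ Q w w0) _.
  have -> : (c * K * vol Q)%:E * w x = (c * vol Q)%:E * (K%:E * w x).
    by rewrite muleA -EFinM mulrAC.
  apply: lee_wpmul2l; first by rewrite lee_fin ltW.
  by apply: le_trans H; apply: ereal_sup_ubound; exists Q.
have [c c0 cQ] := average_le_dnorm delta_gt0 delta_le.
exists (c * K)%R; first by rewrite mulr_gt0.
apply: null_sub KN => x; apply: contra_not => H.
apply: ge_ereal_sup => _ [Q Qx <-]; apply: le_trans (cQ Q w) _.
have v0 := vol_gt0 delta Q; have cv0 : (0 < c / vol Q)%R by rewrite divr_gt0.
apply: le_trans (lee_wpmul2l _ (H Q Qx)) _; first by rewrite lee_fin ltW.
rewrite muleA -EFinM; apply: lee_wpmul2r => //.
by rewrite lee_fin [(K * _)%R]mulrC mulrA mulfVK ?gt_eqF.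
Qed.

Lemma A1_classP w : A_class 1%R delta w <->
  [/\ forall x, 0 <= w x, forall Q, dnorm Q w < +oo,
      null [set x | ~ (0 < w x /\ w x < +oo)] &
      exists2 K : R, (0 < K)%R &
        null [set x | ~ forall Q, cube_set Q x -> dnorm Q w <= (K * vol Q)%:E * w x]].
Proof.
rewrite /A_class eqxx; split=> [[[w0 wc wN] wK]|[w0 wc wN wK]].
  split=> //; first exact/(locally_finiteP delta_gt0 delta_le w0).
  apply/(ae_le_cap_maximalP w0).
  by have [_ [K [K0 KN] <-] _] := ereal_inf_lt wK; exists K.
split; first by split=> //; exact/(locally_finiteP delta_gt0 delta_le w0).
have [K K0 KN] := (ae_le_cap_maximalP w0).2 wK.
by apply: (@le_lt_trans _ _ K%:E); [apply: ereal_inf_lbound; exists K|exact: ltry].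
Qed.

(** Local finiteness is a consequence: no cube is null, so each contains a point where the bound
    holds with [v x] finite. Allowing [w] to differ from [v] on a null set prepares a factorization
    valid at every point. *)
Lemma A1_class_of_dmax w v (K : R) : (0 < K)%R -> (forall x, 0 <= w x) ->
  (forall x, 0 <= v x) ->
  null [set x | ~ [/\ w x = v x, 0 < v x, v x < +oo & dmax v x <= K%:E * v x]] ->
  A_class 1%R delta w.
Proof.
move=> K0 w0 v0 N; have [c c0 cQ] := dnorm_cube_le_dmax delta_gt0 (n := n).
have wv A : dnorm A w <= dnorm A v.
  apply: dnorm_le => //; apply: null_sub N => x [Ax H] [e _ _ _].
  by apply: H; rewrite e.
have key x : [/\ w x = v x, 0 < v x, v x < +oo & dmax v x <= K%:E * v x] ->
    forall Q, cube_set Q x -> dnorm Q w <= (c * K * vol Q)%:E * w x.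
  move=> [-> _ _ d] Q Qx; apply: le_trans (wv Q) _.
  have cv0 : 0 <= (c * vol Q)%:E by rewrite lee_fin mulr_ge0 ?powR_ge0// ltW.
  apply: le_trans (cQ Q v x v0 Qx) _; apply: le_trans (lee_wpmul2l cv0 d) _.
  by rewrite muleA -EFinM mulrAC.
apply/A1_classP; split=> //.
- move=> Q; have [x [Qx xN]] : exists x, cube_set Q x /\
      [/\ w x = v x, 0 < v x, v x < +oo & dmax v x <= K%:E * v x].
    apply: contrapT => H; apply: (@cube_not_null R n delta delta_gt0 delta_le Q).
    by apply: null_sub N => x Qx xN; apply: H; exists x.
  apply: le_lt_trans (key x xN Q Qx) _; have [-> _ voo _] := xN.
  by rewrite lte_mul_pinfty// lee_fin !mulr_ge0 ?powR_ge0// ltW.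
- by apply: null_sub N => x; apply: contra_not => -[-> ? ? _].
- exists (c * K)%R; first by rewrite mulr_gt0.
  by apply: null_sub N => x; apply: contra_not; exact: key.
Qed.

Lemma epow_ge0 (x : \bar R) (r : R) : 0 <= epow x r.
Proof. by rewrite /epow; case: ifP => _; rewrite ?inve_ge0 poweR_ge0. Qed.

Lemma epow_EFin (x r : R) : (0 < x)%R -> epow x%:E r = (x `^ r)%:E.
Proof.
move=> x0; rewrite /epow; case: ifP => _; first by rewrite poweR_EFin.
by rewrite poweR_EFin inver gt_eqF ?powR_gt0// -powRN opprK.
Qed.

(** Each of the two averages costs a comparison constant, the second one to the power [p - 1]. *)
Lemma Ap_classP (p : R) w : (1 < p)%R -> A_class p delta w <->
  [/\ forall x, 0 <= w x, forall Q, dnorm Q w < +oo,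
      null [set x | ~ (0 < w x /\ w x < +oo)] &
      exists2 K : R, (0 < K)%R & forall Q,
        dnorm Q w * dnorm Q (fun x => epow (w x) (- (p - 1)^-1)) `^ (p - 1) <=
        (K * vol Q * vol Q `^ (p - 1))%:E].
Proof.
move=> p1; have p0 : (0 < p - 1)%R by rewrite subr_gt0.
have ep0 (x : \bar R) : epow x (p - 1) = x `^ (p - 1) by rewrite /epow ltW.
have s0 : forall x, 0 <= epow (w x) (- (p - 1)^-1) by move=> x; exact: epow_ge0.
have av0 Q f : (forall x, 0 <= f x) -> 0 <= average delta Q f.
  move=> f0; rewrite mule_ge0 ?inve_ge0 ?hcontent_ge0//.
  by rewrite integral_ge0// => t _; exact: hcontent_ge0.
rewrite /A_class gt_eqF//; split=> [[[w0 wc wN] wK]|[w0 wc wN [K K0 wK]]].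
  split=> //; first exact/(locally_finiteP delta_gt0 delta_le w0).
  have [c c0 cQ] := dnorm_le_average delta_gt0 delta_le.
  have [K0 K00 K0P] : exists2 K0 : R, (0 < K0)%R & Ap_const p delta w <= K0%:E.
    case: (Ap_const p delta w) wK => [r _| |] //; last by exists 1%R; rewrite ?leNye.
    by exists (`|r| + 1)%R; rewrite ?ltr_wpDl// lee_fin (le_trans (ler_norm r))// lerDl.
  exists (c * c `^ (p - 1) * K0)%R => [|Q]; first by rewrite !mulr_gt0 ?powR_gt0.
  have v0 := vol_gt0 delta Q; have cv0 : (0 < c * vol Q)%R by rewrite mulr_gt0.
  have q0 : 0 <= average delta Q (fun x => epow (w x) (- (p - 1)^-1)) by exact: av0.
  apply: le_trans (lee_pmul _ _ (cQ Q w w0) (le_poweR (ltW p0) _ (cQ Q _ s0))) _;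
    rewrite ?dnorm_ge0 ?poweR_ge0//.
  rewrite (poweRM _ _ q0) ?lee_fin ?(ltW cv0)// poweR_EFin muleACA -EFinM.
  have : average delta Q w * average delta Q (fun x => epow (w x) (- (p - 1)^-1)) `^ (p - 1)
     <= K0%:E.
    by apply: le_trans K0P; apply: ereal_sup_ubound; exists Q => //; rewrite ep0.
  move=> h; apply: le_trans (lee_wpmul2l _ h) _.
    by rewrite lee_fin mulr_ge0 ?powR_ge0// ltW.
  rewrite -EFinM lee_fin (powRM _ (ltW c0) (ltW v0)) le_eqVlt; apply/orP; left; apply/eqP.
  ring.
split; first by split=> //; exact/(locally_finiteP delta_gt0 delta_le w0).
have [c c0 cQ] := average_le_dnorm delta_gt0 delta_le.
apply: (@le_lt_trans _ _ (c * c `^ (p - 1) * K)%:E); last exact: ltry.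
apply: ge_ereal_sup => _ [Q _ <-]; rewrite ep0.
have v0 := vol_gt0 delta Q; have cv0 : (0 < c / vol Q)%R by rewrite divr_gt0.
apply: le_trans (lee_pmul _ _ (cQ Q w) (le_poweR (ltW p0) _ (cQ Q _))) _;
  rewrite ?poweR_ge0 ?av0//.
rewrite poweRM ?dnorm_ge0 ?lee_fin ?(ltW cv0)// poweR_EFin muleACA -EFinM.
apply: le_trans (lee_wpmul2l _ (wK Q)) _; first by rewrite lee_fin mulr_ge0 ?powR_ge0// ltW.
have vi : (0 <= (vol Q)^-1)%R by rewrite invr_ge0 ltW.
have E : ((vol Q)^-1 `^ (p - 1) * vol Q `^ (p - 1) = 1)%R.
  by rewrite -(powRM _ vi (ltW v0)) mulVf ?gt_eqF// powR1.
rewrite -EFinM lee_fin (powRM _ (ltW c0) vi) le_eqVlt; apply/orP; left; apply/eqP.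
set a := (vol Q `^ (p - 1))%R in E *; set b := (_^-1 `^ _)%R in E *.
set d := (c `^ (p - 1))%R; have vn : vol Q != 0%R by rewrite gt_eqF.
have -> : (c / vol Q * (d * b) * (K * vol Q * a) = c * d * K * (b * a))%R by field.
by rewrite E mulr1.
Qed.

Lemma dnorm_cube_gt0 Q f : (forall x, 0 <= f x) -> null [set x | ~ 0 < f x] ->
  0 < dnorm Q f.
Proof.
move=> f0 N; rewrite lt0e dnorm_ge0 andbT; apply/eqP => e.
apply: (@cube_not_null R n delta delta_gt0 delta_le Q).
apply: null_sub (nullU (dnorm_eq0_ae delta_gt0 delta_le f0 e) N) => x Qx.
by have [?|?] := pselect (0 < f x); [left|right].
Qed.

End classes.

(** * Products of [A_1] weights and the factorization of [A_p] weights *)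

Section factorization.
Context {R : realType} {n : nat} (delta : R).
Hypotheses (delta_gt0 : (0 < delta)%R) (delta_le : (delta <= n%:R)%R).
Implicit Types (P : dyadic n) (Q : cube R n) (f g w : 'rV[R]_n -> \bar R).
Local Notation ell := (@ell R n delta).
Local Notation cell := (@cell R n).
Local Notation star := (@star R n).
Local Notation dnorm := (@dnorm R n delta).
Local Notation dmax := (@dmax R n delta).
Local Notation null := (@null R n delta).
Local Notation vol Q := (edge Q `^ delta)%R.

Lemma ge0_powRN_le (x y s : R) : (0 <= s)%R -> (0 < x)%R -> (x <= y)%R ->
  (y `^ (- s) <= x `^ (- s))%R.
Proof.
move=> s0 x0 xy; have y0 : (0 < y)%R := lt_le_trans x0 xy.
rewrite !powRN lef_pV2 ?posrE ?powR_gt0//.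
by apply: ge0_ler_powR; rewrite ?nnegrE ?(ltW x0) ?(ltW y0).
Qed.

Lemma posfinE (x : \bar R) : 0 < x -> x < +oo -> exists2 r : R, (0 < r)%R & x = r%:E.
Proof.
move=> x0 xoo; exists (fine x); first by rewrite fine_gt0// x0.
by rewrite fineK// ge0_fin_numE// ltW.
Qed.

(** With [m0], [m1] the norms on [Q], the lower bounds [m0 / (K0 vol Q)] and [m1 / (K1 vol Q)] are
    inserted only into negative powers. In the product all powers of [m0] and [m1] cancel and
    [K0 K1^(p-1)] remains. *)
Lemma A_class_of_factors (p : R) w w0 w1 : (1 < p)%R ->
  A_class 1%R delta w0 -> A_class 1%R delta w1 ->
  (forall x, w x = w0 x * epow (w1 x) (1 - p)%R) -> A_class p delta w.
Proof.
move=> p1 /(A1_classP delta_gt0 delta_le)[w00 w0fin N0 [K0 K00 N0K]]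
  /(A1_classP delta_gt0 delta_le)[w10 w1fin N1 [K1 K10 N1K]] wE.
have p0 : (0 < p - 1)%R by rewrite subr_gt0.
pose good x := exists a b : R, [/\ (0 < a)%R, (0 < b)%R, w0 x = a%:E, w1 x = b%:E &
  forall Q, cube_set Q x -> dnorm Q w0 <= (K0 * vol Q * a)%:E /\ dnorm Q w1 <= (K1 * vol Q * b)%:E].
have N : null [set x | ~ good x].
  apply: null_sub (nullU (nullU N0 N1) (nullU N0K N1K)) => x /= gx.
  apply: contrapT => /not_orP[/not_orP[/contrapT[h1 h2] /contrapT[h3 h4]] /not_orP[/contrapT h5 /contrapT h6]].
  have [a a0 aE] := posfinE h1 h2; have [b b0 bE] := posfinE h3 h4.
  apply: gx; exists a, b; split=> // Q Qx.
  by rewrite EFinM -aE [X in _ /\ _ <= X]EFinM -bE; split; [exact: h5|exact: h6].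
have wab x (a b : R) : (0 < b)%R -> w0 x = a%:E -> w1 x = b%:E ->
    w x = (a * b `^ (- (p - 1)))%:E.
  by move=> b0 aE bE; rewrite wE aE bE epow_EFin// opprB.
pose s : R := ((p - 1)^-1)%R; have s0 : (0 < s)%R by rewrite invr_gt0.
have sab x (a b : R) : (0 < a)%R -> (0 < b)%R -> w0 x = a%:E -> w1 x = b%:E ->
    epow (w x) (- s) = (a `^ (- s) * b)%:E.
  move=> a0 b0 aE bE; rewrite (wab _ _ _ b0 aE bE) epow_EFin ?mulr_gt0 ?powR_gt0//.
  rewrite powRM ?powR_ge0 ?(ltW a0)// -powRrM mulrNN mulfV ?gt_eqF//.
  by rewrite powRr1// ltW.
have main Q : exists m0 m1 : R, [/\ (0 < m0)%R, (0 < m1)%R,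
    dnorm Q w <= ((m1 / (K1 * vol Q)) `^ (- (p - 1)) * m0)%:E &
    dnorm Q (fun x => epow (w x) (- s)) <= ((m0 / (K0 * vol Q)) `^ (- s) * m1)%:E].
  have [m0 m00 m0E] := posfinE (dnorm_cube_gt0 delta_gt0 delta_le Q w00
     (null_sub (fun x => contra_not (fun h => proj1 h)) N0)) (w0fin Q).
  have [m1 m10 m1E] := posfinE (dnorm_cube_gt0 delta_gt0 delta_le Q w10
     (null_sub (fun x => contra_not (fun h => proj1 h)) N1)) (w1fin Q).
  have v0 := vol_gt0 delta Q.
  have k0 : (0 < K0 * vol Q)%R by rewrite mulr_gt0.
  have k1 : (0 < K1 * vol Q)%R by rewrite mulr_gt0.
  exists m0, m1; split=> //.
  - rewrite EFinM -m0E -dnormZ ?powR_gt0 ?divr_gt0//.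
    apply: dnorm_le => [|x]; last by rewrite mule_ge0// lee_fin powR_ge0.
    apply: null_sub N => x /= [Qx H] [a [b [a0 b0 aE bE /(_ Q Qx) [_]]]].
    rewrite m1E lee_fin => mb; apply: H; split=> //.
    rewrite (wab _ _ _ b0 aE bE) aE -EFinM lee_fin mulrC ler_pM2r//.
    apply: ge0_powRN_le; rewrite ?divr_gt0 ?(ltW p0)//.
    by rewrite ler_pdivrMr// mulrC.
  - rewrite EFinM -m1E -dnormZ ?powR_gt0 ?divr_gt0//.
    apply: dnorm_le => [|x]; last by rewrite mule_ge0// lee_fin powR_ge0.
    apply: null_sub N => x /= [Qx H] [a [b [a0 b0 aE bE /(_ Q Qx) [+ _]]]].
    rewrite m0E lee_fin => ma; apply: H; split=> //.
    rewrite (sab _ _ _ a0 b0 aE bE) bE -EFinM lee_fin ler_pM2r//.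
    apply: ge0_powRN_le; rewrite ?divr_gt0 ?(ltW s0)//.
    by rewrite ler_pdivrMr// mulrC.
apply/(Ap_classP delta_gt0 delta_le _ p1); split.
- by move=> x; rewrite wE mule_ge0// epow_ge0.
- by move=> Q; have [m0 [m1 [_ _ h _]]] := main Q; rewrite (le_lt_trans h)// ltry.
- apply: null_sub N => x /=; apply: contra_not => -[a [b [a0 b0 aE bE _]]].
  by rewrite (wab _ _ _ b0 aE bE) ltry lte_fin mulr_gt0 ?powR_gt0.
- exists (K0 * K1 `^ (p - 1))%R => [|Q]; first by rewrite mulr_gt0 ?powR_gt0.
  have [m0 [m1 [m00 m10 h0 h1]]] := main Q; have v0 := vol_gt0 delta Q.
  have k0 : (0 < K0 * vol Q)%R by rewrite mulr_gt0.
  have k1 : (0 < K1 * vol Q)%R by rewrite mulr_gt0.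
  apply: le_trans (lee_pmul _ _ h0 (le_poweR (ltW p0) _ h1)) _;
    rewrite ?dnorm_ge0 ?poweR_ge0//.
  rewrite poweR_EFin -EFinM lee_fin le_eqVlt; apply/orP; left; apply/eqP.
  rewrite (powRM _ (powR_ge0 _ _) (ltW m10)) -powRrM mulNr mulVf ?gt_eqF//.
  rewrite powRN powR_inv1 ?divr_ge0 ?(ltW k0) ?(ltW m00)//.
  have k1' : (0 <= (K1 * vol Q)^-1)%R by rewrite invr_ge0 ltW.
  rewrite (powRM _ (ltW m10) k1') (_ : ((K1 * vol Q)^-1 `^ (p - 1) = ((K1 * vol Q) `^ (p - 1))^-1)%R); last first.
    by rewrite -(powR_inv1 (ltW k1)) -powRrM mulN1r powRN.
  rewrite (powRM _ (ltW K10) (ltW v0)).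
  have := powR_gt0 (p - 1) m10; have := powR_gt0 (p - 1) K10; have := powR_gt0 (p - 1) v0.
  move: (vol Q `^ (p - 1))%R (K1 `^ (p - 1))%R (m1 `^ (p - 1))%R => A B D A0 B0 D0.
  by field; rewrite !gt_eqF.
Qed.

Lemma Ap_pair_dual (w : 'rV[R]_n -> R) (p K : R) : (1 < p)%R -> Ap_pair delta w p K ->
  Ap_pair delta (fun x => w x `^ (- (p - 1)^-1))%R (p / (p - 1))%R (K `^ (p - 1))%R.
Proof.
move=> p1; have p0 : (0 < p - 1)%R by rewrite subr_gt0.
have pE : ((p / (p - 1) - 1)^-1 = p - 1)%R by field; rewrite gt_eqF//=; lra.
move=> [w0 wfin sfin wK]; rewrite /Ap_pair pE.
have e : (fun x => ((w x `^ (- (p - 1)^-1)) `^ (- (p - 1)))%:E) = (fun x => (w x)%:E).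
  by apply/funext => x; rewrite -powRrM mulrNN mulVf ?gt_eqF// powRr1// ltW.
split=> [x|Q|Q|Q]; rewrite ?e; [by rewrite powR_gt0|exact: sfin|exact: wfin|].
set a := (fine _ / _)%R; set b := (fine _ / _)%R.
have a0 : (0 <= a)%R by rewrite divr_ge0 ?fine_ge0 ?dnorm_ge0// ell_ge0.
have b0 : (0 <= b)%R by rewrite divr_ge0 ?fine_ge0 ?dnorm_ge0// ell_ge0.
have bE : (b = (b `^ (p - 1)^-1) `^ (p - 1))%R.
  by rewrite -powRrM mulVf ?gt_eqF// powRr1.
rewrite bE -powRM ?powR_ge0// mulrC; apply: ge0_ler_powR; rewrite ?(ltW p0)//.
- by rewrite nnegrE mulr_ge0 ?powR_ge0.
- by rewrite nnegrE (le_trans _ (wK Q))// mulr_ge0 ?powR_ge0.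
- exact: wK.
Qed.

(** The value [1] on the exceptional null set makes the weight positive and finite everywhere.
    Finiteness of the dual norm on a star comes from the product bound, because the other factor is
    positive. *)
Lemma regular_representative (p : R) w : (1 < p)%R -> A_class p delta w ->
  exists (w' : 'rV[R]_n -> R) (K : R),
    null [set x | w x <> (w' x)%:E] /\ Ap_pair delta w' p K.
Proof.
move=> p1 /(Ap_classP delta_gt0 delta_le _ p1)[w0 wfin N [K K0 wK]].
have p0 : (0 < p - 1)%R by rewrite subr_gt0.
have s0 : (0 < (p - 1)^-1)%R by rewrite invr_gt0.
pose w' x : R := if `[< 0 < w x /\ w x < +oo >] then fine (w x) else 1%R.
have w'0 x : (0 < w' x)%R.
  by rewrite /w'; case: asboolP => // -[h1 h2]; rewrite fine_gt0// h1.
have ww' x : (0 < w x /\ w x < +oo) -> w x = (w' x)%:E.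
  move=> h; have [h1 h2] := h; rewrite /w'; case: asboolP => // _.
  by rewrite fineK// ge0_fin_numE.
have N' : null [set x | w x <> (w' x)%:E].
  by apply: null_sub N => x; apply: contra_not; exact: ww'.
pose sg x : R := (w' x `^ (- (p - 1)^-1))%R.
have wN A : dnorm A (fun x => (w' x)%:E) <= dnorm A w.
  apply: dnorm_le => //; apply: null_sub N' => x [Ax H] e; apply: H.
  by rewrite -e.
have sN A : dnorm A (fun x => (sg x)%:E) <= dnorm A (fun x => epow (w x) (- (p - 1)^-1)).
  apply: dnorm_le => [|x]; last exact: epow_ge0.
  by apply: null_sub N' => x [Ax H] e; apply: H; rewrite e epow_EFin.
pose D P := dnorm (star P) (fun x => (w' x)%:E).
pose S P := dnorm (star P) (fun x => (sg x)%:E).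
pose K1 : R := (K * 3 `^ delta * (3 `^ delta) `^ (p - 1))%R.
have DS P : D P * S P `^ (p - 1) <= (K1 * (ell P * ell P `^ (p - 1)))%:E.
  have sP : dstar P = star P :> set _ := dstarE P.
  rewrite /D /S -sP; apply: le_trans (lee_pmul _ _ (wN _) (le_poweR (ltW p0) _ (sN _))) _;
    rewrite ?dnorm_ge0 ?poweR_ge0//.
  apply: le_trans (wK (dstar P)) _; rewrite lee_fin /=.
  have m0 := mesh_gt0 (R := R) P.1.
  rewrite (powRM _ (_ : 0 <= 3)%R (ltW m0))// -/(ell P).
  rewrite (powRM _ (powR_ge0 _ _) (ell_ge0 _ _)) /K1 le_eqVlt; apply/orP; left; apply/eqP.
  by rewrite [(K * (_ * _))%R]mulrA mulrACA.
have D0 P : 0 < D P.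
  rewrite /D -dstarE; apply: dnorm_cube_gt0 => //= [x|]; first by rewrite lee_fin ltW.
  by apply: null_sub (null0 delta) => x; apply; rewrite lte_fin.
have Dfin P : D P < +oo.
  by apply: le_lt_trans (wN _) _; rewrite -dstarE; exact: wfin.
have S0 P : 0 <= S P by exact: dnorm_ge0.
have Sfin P : S P < +oo.
  rewrite ltey; apply/eqP => Soo; have := DS P.
  by rewrite Soo poweRyr ?gt_eqF// gt0_muley// leye_eq.
exists w', (K1 `^ (p - 1)^-1)%R; split=> //; split=> // P.
rewrite -/(sg _) -/(D P) -/(S P).
have DE : D P = (fine (D P))%:E by rewrite fineK// ge0_fin_numE// ltW.
have SE : S P = (fine (S P))%:E by rewrite fineK// ge0_fin_numE.
have := DS P; rewrite DE SE poweR_EFin -EFinM lee_fin.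
have d0 : (0 <= fine (D P))%R by rewrite fine_ge0// ltW.
have t0 : (0 <= fine (S P))%R by rewrite fine_ge0.
move: (fine (D P)) (fine (S P)) d0 t0 => d t d0 t0 h.
have l0 := ell_gt0 delta P; have li : (0 <= (ell P)^-1)%R by rewrite invr_ge0 ltW.
have dl0 : (0 <= d / ell P)%R := mulr_ge0 d0 li.
have tl0 : (0 <= t / ell P)%R := mulr_ge0 t0 li.
have tE : (t / ell P = ((t / ell P) `^ (p - 1)) `^ (p - 1)^-1)%R.
  by rewrite -powRrM mulfV ?gt_eqF// powRr1.
rewrite tE -(powRM _ dl0 (powR_ge0 _ _)).
have H : (d / ell P * (t / ell P) `^ (p - 1) <= K1)%R.
  have -> : ((t / ell P) `^ (p - 1) = t `^ (p - 1) / ell P `^ (p - 1))%R.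
    by rewrite (powRM _ t0 li) -(powR_inv1 (ltW l0)) -powRrM mulN1r powRN.
  rewrite mulrACA -invfM ler_pdivrMr; first exact: h.
  exact: mulr_gt0 l0 (powR_gt0 _ l0).
have H0 : (0 <= d / ell P * (t / ell P) `^ (p - 1))%R := mulr_ge0 dl0 (powR_ge0 _ _).
apply: ge0_ler_powR; rewrite ?nnegrE ?(ltW s0)//.
exact: le_trans H0 H.
Qed.

Lemma powR_inv (x a : R) : (0 <= x)%R -> (x^-1 `^ a = x `^ (- a))%R.
Proof. by move=> x0; rewrite -(powR_inv1 x0) -powRrM mulN1r. Qed.

(** The factors are [w^(1/p) e^((p-1)/s)] and [(w^(-1/p) e^(1/s))^(1-p)]: the powers of [e] cancel
    and the exponents of [w] add up to one. *)
Lemma factors_mul (w e s p : R) : (0 < w)%R -> (0 < e)%R -> (0 < s)%R -> (1 < p)%R ->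
  ((((w `^ (- (p - 1)^-1)) `^ (p / s)^-1)^-1 * e) `^ ((p - 1) / s) *
   ((((w `^ (p / s)^-1)^-1 * e) `^ s^-1) `^ (1 - p)) = w)%R.
Proof.
move=> w0 e0 s0 p1; have p0 : (0 < p - 1)%R by rewrite subr_gt0.
have pp : (0 < p)%R by lra.
have sn : s != 0%R by rewrite gt_eqF.
have pn : p != 0%R by rewrite gt_eqF.
have p1n : (p - 1 != 0)%R by rewrite gt_eqF.
set a := ((p / s)^-1)%R; have wa (b : R) : (0 <= (w `^ b)^-1)%R by rewrite invr_ge0 powR_ge0.
rewrite -(powRrM w) -powRrM (powRM _ (wa _) (ltW e0)) (powRM _ (wa _) (ltW e0)).
rewrite !(powR_inv _ (powR_ge0 _ _)) -!powRrM mulrACA.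
rewrite -powRD ?(gt_eqF w0) ?implybT// -powRD ?(gt_eqF e0) ?implybT//.
have -> : ((p - 1) / s + s^-1 * (1 - p) = 0)%R by field.
have -> : (- (p - 1)^-1 * a * - ((p - 1) / s) + a * - (s^-1 * (1 - p)) = 1)%R.
  by rewrite /a; field; rewrite ?p1n ?pn ?sn.
by rewrite powRr0 mulr1 powRr1// ltW.
Qed.

Lemma Ap_pair_factors (w : 'rV[R]_n -> R) (p K : R) : (1 < p)%R ->
  Ap_pair delta w p K -> exists (v : bool -> 'rV[R]_n -> \bar R) (M : R),
  [/\ (0 < M)%R, forall b x, 0 <= v b x & null [set x | ~ ((forall b,
      [/\ 0 < v b x, v b x < +oo & dmax (v b) x <= M%:E * v b x]) /\
    (w x)%:E = v false x * epow (v true x) (1 - p))]].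
Proof.
move=> p1 wK; have p0 : (0 < p - 1)%R by rewrite subr_gt0.
have pp : (0 < p)%R by lra.
have [c c0 cP] := @hcontent_cell_ge R n delta delta_gt0 delta_le.
have w0 : forall x, (0 < w x)%R by case: wK.
have [M1 M10 H1] := dmax_bound delta_gt0 delta_le c0 cP p1 wK.
have p'1 : (1 < p / (p - 1))%R by rewrite ltr_pdivlMr// mul1r; lra.
have [M0 M00 H0] := dmax_bound delta_gt0 delta_le c0 cP p'1 (Ap_pair_dual p1 wK).
(* The largest [s] for which [1/s] and [(p-1)/s] are both at least one. *)
pose s := Num.min 1%R (p - 1)%R.
have s0 : (0 < s)%R by rewrite lt_min ltr01.
have sn : s != 0%R by rewrite gt_eqF.
pose W b x : R := if b then w x else (w x `^ (- (p - 1)^-1))%R.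
pose r b : R := if b then s^-1%R else ((p - 1) / s)%R.
pose t b : R := if b then p else (p / (p - 1))%R.
have W0 b x : (0 < W b x)%R by case: b; rewrite /W ?powR_gt0.
have r1 b : (1 <= r b)%R.
  by case: b; rewrite /r ?invf_ge1 ?ler_pdivlMr ?mul1r// /s ge_min lexx ?orbT.
have r0 b : (0 < r b)%R by rewrite (lt_le_trans ltr01).
have q0 : (0 < p / s)%R by rewrite divr_gt0.
have tr b : (t b * r b = p / s)%R.
  by case: b; rewrite /t /r//; field; rewrite sn gt_eqF.
have C0 : (0 < M1 + M0)%R by rewrite addr_gt0.
have bd b f : (forall x, 0 <= f x) ->
    dnorm setT (fun x => dmax f x `^ t b * (W b x)%:E) <=
    (M1 + M0)%:E * dnorm setT (fun x => f x `^ t b * (W b x)%:E).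
  move=> f0; have D0 := dnorm_ge0 delta setT (fun x => f x `^ t b * (W b x)%:E).
  apply: (@le_trans _ _ ((if b then M1 else M0)%:E * dnorm setT (fun x => f x `^ t b * (W b x)%:E))).
    by case: b {D0}; [exact: H1|exact: H0].
  by apply: lee_wpmul2r => //; rewrite lee_fin; case: (b); rewrite ?lerDl ?lerDr ltW.
have [eta [th [th0 eta0 N et]]] := rubio_de_francia delta_gt0 delta_le W0 r1 q0 tr C0 bd.
pose v b x := ((W b x `^ (p / s)^-1)^-1%:E * eta x) `^ r b.
exists v, (th `^ r true + th `^ r false)%R; split.
- by rewrite addr_gt0 ?powR_gt0.
- by move=> b x; exact: poweR_ge0.
apply: null_sub N => x /= H; apply/eqP; rewrite eq_le leey/= leNgt; apply/negP => etafin.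
apply: H; have [e e0 eE] := posfinE (eta0 x) etafin.
have we0 b : (0 < (W b x `^ (p / s)^-1)^-1 * e)%R.
  by rewrite mulr_gt0// invr_gt0 powR_gt0.
have vE b : v b x = (((W b x `^ (p / s)^-1)^-1 * e) `^ r b)%:E.
  by rewrite /v eE -EFinM poweR_EFin.
split=> [b|].
  split; [by rewrite vE lte_fin powR_gt0|by rewrite vE ltry|].
  apply: le_trans (et b x etafin) _; apply: lee_wpmul2r; first exact: poweR_ge0.
  by rewrite lee_fin; case: b; rewrite ?lerDl ?lerDr powR_ge0.
rewrite !vE epow_EFin ?powR_gt0// -EFinM; congr (_%:E).
by rewrite /W /r factors_mul.
Qed.

Lemma A_class_factors (p : R) w : (1 < p)%R -> A_class p delta w ->
  exists w0 w1, [/\ A_class 1%R delta w0, A_class 1%R delta w1 &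
    forall x, w x = w0 x * epow (w1 x) (1 - p)%R].
Proof.
move=> p1 wA; have [w' [K [N wK]]] := regular_representative p1 wA.
have [[w0 _ _] _] := wA.
have [v [M [M0 v0 Nv]]] := Ap_pair_factors p1 wK.
pose bad x := w x <> (w' x)%:E \/ ~ ((forall b,
      [/\ 0 < v b x, v b x < +oo & dmax (v b) x <= M%:E * v b x]) /\
    (w' x)%:E = v false x * epow (v true x) (1 - p)).
have Nb : null [set x | bad x] := nullU N Nv.
(* On the null set where the construction fails, the factors are [w] and [1], so that the identity
   holds at every point. *)
exists (fun x => if `[< bad x >] then w x else v false x),
  (fun x => if `[< bad x >] then 1 else v true x); split.
- apply: (A1_class_of_dmax delta_gt0 delta_le M0 (v := v false)) => //.
    by move=> x; case: ifP.
  apply: null_sub Nb => x /= H; apply: contrapT => bx; apply: H.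
  have := bx => /not_orP[_ /contrapT[/(_ false)[h1 h2 h3] _]].
  by case: asboolP.
- apply: (A1_class_of_dmax delta_gt0 delta_le M0 (v := v true)) => //.
    by move=> x; case: ifP => // _; exact: lee01.
  apply: null_sub Nb => x /= H; apply: contrapT => bx; apply: H.
  have := bx => /not_orP[_ /contrapT[/(_ true)[h1 h2 h3] _]].
  by case: asboolP.
- move=> x; case: asboolP => [_|/not_orP[/contrapT-> /contrapT[_ ->]]//].
  by rewrite epow_EFin// powR1 mule1.
Qed.

End factorization.

Theorem theorem1p10 (R : realType) (n : nat) (delta p : R)
    (hdelta0 : (0 < delta)%R) (hdeltan : (delta <= n%:R)%R)
    (hp : (1 <= p)%R) (w : 'rV[R]_n -> \bar R) :
  A_class p delta w <->
  exists w0 w1 : 'rV[R]_n -> \bar R,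
    [/\ A_class 1%R delta w0, A_class 1%R delta w1
      & forall x, w x = w0 x * epow (w1 x) (1 - p)%R].
Proof.
have [->|p1] := eqVneq p 1%R.
  (* Power zero is [1] even at [0] and [+oo], so for [p = 1] the identity reads [w = w0]. *)
  have e1 (x : \bar R) : epow x (1 - 1)%R = 1 by rewrite subrr /epow lexx poweRe0.
  split=> [wA|[w0 [w1 [w0A _ wE]]]].
    by exists w, w; split=> // x; rewrite e1 mule1.
  by rewrite (_ : w = w0)//; apply/funext => x; rewrite wE e1 mule1.
have {}p1 : (1 < p)%R by rewrite lt_neqAle eq_sym p1.
split; first exact: A_class_factors.
by move=> [w0 [w1 [w0A w1A wE]]]; exact: A_class_of_factors p1 w0A w1A wE.
Qed.
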